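(* Let $g=9.8$, let $a$ be a function of class $\mathcal{C}^2$ on $\mathbb{T}$, and let $0<\alpha<\frac14$. Let $\rho_0\in L^1(\mathbb{T})$ with $\rho_0\ge 0$ and $u_0\in L^\infty(\mathbb{T})$. Let $(\rho_0^\epsilon,u_0^\epsilon)_{0<\epsilon<1}$ be a family in $\mathcal{C}(\mathbb{T})^2$ such that $\rho_0^\epsilon(x)>0$ for all $x$, and $\|\rho_0-\rho_0^\epsilon\|_{L^1(\mathbb{T})}\to 0$, $\|u_0-u_0^\epsilon\|_\infty\to 0$ when $\epsilon\to 0$. For each $\epsilon$ consider the following system of ODEs in $\mathcal{C}(\mathbb{T})$ for the unknowns $t\mapsto\rho(\cdot,t,\epsilon)$ and $t\mapsto(\rho u)(\cdot,t,\epsilon)$: $$\frac{d}{dt}\rho(x,t,\epsilon)=\frac1\epsilon\big[(\rho u^+)(x-\epsilon,t,\epsilon)-(\rho|u|)(x,t,\epsilon)+(\rho u^-)(x+\epsilon,t,\epsilon)\big],$$ $$\frac{d}{dt}(\rho u)(x,t,\epsilon)=\frac1\epsilon\big[(\rho u u^+)(x-\epsilon,t,\epsilon)-(\rho u|u|)(x,t,\epsilon)+(\rho u u^-)(x+\epsilon,t,\epsilon)\big]-\rho(x,t,\epsilon)\frac{\partial}{\partial x}\Phi(x,t,\epsilon),$$ where $$\Phi(x,t,\epsilon)=g\,\big(\rho(\cdot,t,\epsilon)*\phi_{\epsilon^\alpha}\big)(x)+g\,a(x),\qquad u(x,t,\epsilon)=\frac{(\rho u)(x,t,\epsilon)}{\rho(x,t,\epsilon)},$$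 with initial conditions $\rho(\cdot,0,\epsilon)=\rho_0^\epsilon$, $(\rho u)(\cdot,0,\epsilon)=\rho_0^\epsilon u_0^\epsilon$. Then the solution of this system (which exists, is unique, has $\rho>0$, and is defined for all $t\in[0,+\infty[$ and $x\in\mathbb{T}$) provides a weak asymptotic solution, global in time $t\in[0,+\infty[$ and in space $x\in\mathbb{T}$, of the 1-D shallow water equations $$\partial_t\rho+\partial_x(\rho u)=0,\qquad \partial_t(\rho u)+\partial_x(\rho u^2)+\rho\,\partial_x\Phi=0,\qquad \Phi=g(\rho+a),$$ where $\rho$ denotes the water elevation and $a$ the bottom elevation.
   Context: $\mathbb{T}=\mathbb{R}/(2\pi\mathbb{Z})$; functions on $\mathbb{T}$ are identified with $2\pi$-periodic functions on $\mathbb{R}$, and $\mathcal{C}(\mathbb{T})$ is the Banach space of continuous functions on $\mathbb{T}$ with the sup norm $\|\cdot\|_\infty$. For real $u$: $u^+=\max(u,0)$, $u^-=\max(-u,0)$, so $u=u^+-u^-$ and $|u|=u^++u^-$. Products such as $\rho u^\pm$, $\rho u|u|$ are evaluated at the indicated point. A function $\phi\in\mathcal{C}_c^\infty(\mathbb{R})$ is fixed with $\phi\ge 0$, $\phi(-x)=\phi(x)$ for all $x$, $\int\phi(x)\,dx=1$; for $\mu>0$, $\phi_\mu(x)=\frac1\mu\phi(\frac x\mu)$; $*$ denotes convolution on $\mathbb{R}$. A solution of the system of ODEs is a continuously differentiable map $t\mapsto(\rho(\cdot,t,\epsilon),(\rho u)(\cdot,t,\epsilon))\in\mathcal{C}(\mathbb{T})^2$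 (one-sided derivative at $t=0$) with $\rho>0$ that satisfies the equations. The family $(\rho,\rho u,\Phi)(\cdot,\cdot,\epsilon)$ is a weak asymptotic solution of the shallow water equations (strong derivative in $t$, weak derivative in $x$) if for every $t>0$ and every $\psi\in\mathcal{C}_c^\infty(\mathbb{R})$, as $\epsilon\to 0$ (integrals over $\mathbb{R}$), $$\int\frac{d}{dt}\rho(x,t,\epsilon)\psi(x)dx-\int(\rho u)(x,t,\epsilon)\psi'(x)dx\to 0,$$ $$\int\frac{d}{dt}(\rho u)(x,t,\epsilon)\psi(x)dx-\int(\rho u^2)(x,t,\epsilon)\psi'(x)dx+\int\rho(x,t,\epsilon)\frac{\partial}{\partial x}\Phi(x,t,\epsilon)\psi(x)dx\to 0,$$ $$\int\Phi(x,t,\epsilon)\psi(x)dx-g\int\rho(x,t,\epsilon)\psi(x)dx-g\int a(x)\psi(x)dx\to 0 .$$ *)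

(* Defs.v *)
From HB Require Import structures.
From mathcomp Require Import all_boot all_order all_algebra.
From mathcomp Require Import all_classical all_reals all_analysis.

Set Implicit Arguments.
Unset Strict Implicit.
Unset Printing Implicit Defensive.
Import Order.TTheory GRing.Theory Num.Theory.
Import numFieldNormedType.Exports.

Local Open Scope ring_scope.
Local Open Scope classical_set_scope.

(* Functions on the torus R/(2 pi Z) are 2pi-periodic functions R -> R. *)
Definition torus_periodic (R : realType) (f : R -> R) : Prop :=
  periodic f (pi *+ 2).

Definition CT (R : realType) : set (R -> R) :=
  [set f | continuous f /\ torus_periodic f].

(* Lebesgue measure of one period; with it Lfun and the Lnorm of the library
   give the spaces L^p of the torus and their norms, including p = +oo. *)
Definition torus_measure (R : realType) :
    {measure set (measurableTypeR R) -> \bar R} :=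
  mrestr (@lebesgue_measure R) (measurable_itv `[0 : R, pi *+ 2[%R).

Definition LT (R : realType) (p : \bar R) : set (R -> R) :=
  [set f | f \in Lfun (torus_measure R) p /\ torus_periodic f].

Definition normLT (R : realType) (p : \bar R) (f : R -> R) : \bar R :=
  'N[torus_measure R]_p[EFin \o f]%E.

Definition C2 (R : realType) (f : R -> R) : Prop :=
  (forall n, (n < 2)%N -> forall x, derivable f^`(n) x 1) /\ continuous f^`(2).

Definition smooth (R : realType) (f : R -> R) : Prop :=
  forall n x, derivable f^`(n) x 1.

Definition Cc_infty (R : realType) : set (R -> R) :=
  [set f | smooth f /\ compact (closure [set x | f x != 0])].

Definition convolution (R : realType) (f h : R -> R) (x : R) : R :=
  \int[lebesgue_measure]_y (f y * h (x - y)).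

Definition dilation (R : realType) (phi : R -> R) (mu : R) (x : R) : R :=
  mu^-1 * phi (x / mu).

(* Continuous differentiability on D of a map F from the line to the Banach
   space CT, with derivative F'.  {uniform R -> R} carries the topology of the
   sup norm.  The increments h keep t + h in D, so that the derivative is
   one-sided at an endpoint of D that belongs to D. *)
Definition C1_to_CT (R : realType) (D : set R) (F F' : R -> R -> R) : Prop :=
  [/\ forall t, D t -> CT (F t),
      forall t, D t ->
        {uniform, (fun h x => h^-1 * (F (t + h) x - F t x))
                    @ within [set h | D (t + h)] 0^' --> F' t}
    & {within D, continuous (F' : R -> {uniform R -> R})}].

Section system.
Variables (R : realType) (g : R) (a phi : R -> R) (alpha eps : R).

(* In this section, rho and m stand for the unknowns rho and rho u at a fixed
   time. *)
Definition velocity (rho m : R -> R) (x : R) : R := m x / rho x.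

Definition potential (rho : R -> R) (x : R) : R :=
  g * convolution rho (dilation phi (eps `^ alpha)) x + g * a x.

Definition transport (f u : R -> R) (x : R) : R :=
  eps^-1 * (f (x - eps) * u^\+ (x - eps) - f x * `|u x|
            + f (x + eps) * u^\- (x + eps)).

Definition mass_rhs (rho m : R -> R) (x : R) : R :=
  transport rho (velocity rho m) x.

Definition momentum_rhs (rho m : R -> R) (x : R) : R :=
  transport m (velocity rho m) x - rho x * derive1 (potential rho) x.

Definition time_interval (T : \bar R) : set R :=
  [set t | 0 <= t /\ (t%:E < T)%E].

(* Solution on [0, T[ with initial data rho0 and m0; T may be +oo.  The values
   rho t and m t at times outside [0, T[ are irrelevant. *)
Definition is_solution (rho0 m0 : R -> R) (T : \bar R)
    (rho m : R -> R -> R) : Prop :=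
  [/\ forall t x, time_interval T t -> 0 < rho t x,
      C1_to_CT (time_interval T) rho (fun t => mass_rhs (rho t) (m t)),
      C1_to_CT (time_interval T) m (fun t => momentum_rhs (rho t) (m t)),
      rho 0 = rho0
    & m 0 = m0].

End system.

(* The arguments of rho, m (for rho u) and Phi are eps, t, x in this order. *)
Definition weak_asymptotic_solution (R : realType) (g : R) (a : R -> R)
    (rho m Phi : R -> R -> R -> R) : Prop :=
  forall (t : R) (psi : R -> R), 0 < t -> Cc_infty psi ->
  [/\ (\int[lebesgue_measure]_x (derive1 (fun s => rho eps s x) t * psi x)
       - \int[lebesgue_measure]_x (m eps t x * derive1 psi x))
        @[eps --> 0^'+] --> (0 : R),
      (\int[lebesgue_measure]_x (derive1 (fun s => m eps s x) t * psi x)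
       - \int[lebesgue_measure]_x
           (m eps t x * velocity (rho eps t) (m eps t) x * derive1 psi x)
       + \int[lebesgue_measure]_x (rho eps t x * derive1 (Phi eps t) x * psi x))
        @[eps --> 0^'+] --> (0 : R)
    & (\int[lebesgue_measure]_x (Phi eps t x * psi x)
       - g * \int[lebesgue_measure]_x (rho eps t x * psi x)
       - g * \int[lebesgue_measure]_x (a x * psi x))
        @[eps --> 0^'+] --> (0 : R)].

(* Main.v *)
(* Work with the unknowns rho and m = rho u.  Four bounds hold along a solution:
   the total mass is conserved; |m| <= b(t) rho, where b grows faster than the
   force dPhi/dx, because the transport part of (m - b rho)' has the right sign
   at a first contact; and rho lies between two exponentials in t.  The
   derivative of phi_(eps^alpha) being O(eps^(-2 alpha)), the force and hence u
   are O(eps^(-2 alpha)), locally uniformly in t.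

   All the bounds follow from a single barrier argument, which uses the equation
   only inside the box that they define.  Clamping rho and u to the box gives a
   globally Lipschitz bounded field, which Picard iteration integrates.  Its
   solution stays in the box and hence solves the original system; conversely
   every solution of the original system solves the clamped one, whence
   uniqueness.

   For the weak asymptotics, moving the shifts by eps onto the test function
   costs O(eps sup |u|^2) = O(eps^(1 - 4 alpha)) times the mass, and replacing
   rho * phi_(eps^alpha) by rho costs O(eps^alpha). *)
Require Import Defs.
From HB Require Import structures.
From mathcomp Require Import all_boot all_order all_algebra.
From mathcomp Require Import all_classical all_reals all_analysis.
From mathcomp Require Import measurable_realfun ess_sup_inf.
From mathcomp Require Import ring lra.
Set Implicit Arguments.
Unset Strict Implicit.
Unset Printing Implicit Defensive.
Import Order.TTheory GRing.Theory Num.Theory.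
Import numFieldNormedType.Exports.
Local Open Scope ring_scope.
Local Open Scope classical_set_scope.

(** The hypotheses on the data bound uniformly in eps only the mass of [rho0e eps] and the sup of
    [|u0e eps|]. The exponential bounds on rho have exponents of order 1/eps and start from the
    extrema of [rho0e eps]; they keep m / rho away from vacuum while eps is fixed, and the limit
    uses mass and velocity alone. This is why the force is estimated by the sup of the derivative of
    the kernel times the L^1 norm of rho: no uniform sup bound on rho exists to be put in its place.
    Time derivatives are taken in the sup norm, so increments are controlled uniformly in x. This
    replaces compactness in the first-contact argument: it works for families indexed by any type,
    and the pointwise bounds and the single bound on the mass, which depend on one another, are
    propagated together. The constants of the box are frozen at a finite horizon T, which makes the
    clamped field autonomous. Solutions for integer horizons are glued by uniqueness. All integrands
    that matter are continuous and vanish outside a segment, so integrals reduce to primitives: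
    translation, scaling and exchange of integrals follow by differentiation. *)

Section calculus.
Variable R : realType.
Implicit Types (f g G : R -> R) (a b x t : R).

(** * Epsilon forms of continuity and derivative; integrals over segments *)

Lemma continuousP_eps f x :
  {for x, continuous f} <->
  (forall e : R, 0 < e -> exists2 d : R, 0 < d & forall h, `|h| < d -> `|f (x + h) - f x| < e).
Proof.
split=> [cf e e0|H].
  move/cvgrPdist_lt: cf => /(_ _ e0) /nbhs_ballP[d /= d0 dP].
  exists d => // h hd; rewrite distrC; apply: dP.
  by rewrite /ball /= opprD addrA subrr sub0r normrN.
apply/cvgrPdist_lt => e /H[d d0 dP]; apply/nbhs_ballP; exists d => //= y.
rewrite /ball /= distrC => xy; rewrite distrC.
by have := dP _ xy; have -> : x + (y - x) = y by ring.
Qed.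

(** Clearing the denominator admits h = 0 and gives the same shape as [uderiv] below, where the
    estimate is moreover uniform in a parameter. *)
Lemma is_derive_eps f x l :
  is_derive x 1 f l <->
  (forall e : R, 0 < e -> exists2 d : R, 0 < d &
     forall h, `|h| < d -> `|f (x + h) - f x - h * l| <= e * `|h|).
Proof.
split=> [[df <-] e e0|H].
  move/cvgrPdist_lt: df => /(_ _ e0).
  rewrite -/('D_1 f x) => /nbhs_ballP[d /= d0 dP].
  exists d => // h hd.
  have [->|h0] := eqVneq h 0; first by rewrite addr0 subrr mul0r subr0 normr0 mulr0.
  have := dP h; rewrite /ball /= sub0r normrN => /(_ hd h0).
  rewrite /GRing.scale /= mulr1 [h + x]addrC => /ltW hle.
  have -> : f (x + h) - f x - h * 'D_1 f x
          = - (h * ('D_1 f x - h^-1 * (f (x + h) - f x))).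
    by rewrite mulrBr mulrA divff// mul1r opprB.
  by rewrite normrN normrM mulrC ler_wpM2r.
have C : (fun h : R => h^-1 *: ((f \o shift x) (h *: 1) - f x)) @ 0^' --> l.
  apply/cvgrPdist_le => e /H[d d0 dP].
  apply/nbhs_ballP; exists d => //= h; rewrite /ball /= sub0r normrN => hd h0.
  rewrite /GRing.scale /= mulr1 [h + x]addrC.
  rewrite -(ler_pM2l (_ : 0 < `|h|)) ?normr_gt0// -normrM.
  rewrite mulrBr mulrA divff// mul1r -normrN opprB [leRHS]mulrC; exact: dP.
apply: DeriveDef; first by apply/cvg_ex; exists l.
exact/cvg_lim.
Qed.

Lemma is_derive_continuous f x l : is_derive x 1 f l -> {for x, continuous f}.
Proof.
by move=> [df _]; apply: differentiable_continuous; exact/derivable1_diffP.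
Qed.

Lemma ge0_derive_le G (g : R -> R) a b : a <= b ->
  (forall x, a <= x <= b -> is_derive x 1 G (g x)) ->
  (forall x, a <= x <= b -> 0 <= g x) -> G a <= G b.
Proof.
move=> ab dG g0; have [c cab Gc] : exists2 c, c \in `[a, b]%R &
    G b - G a = g c * (b - a).
  apply: MVT_segment => // [x|]; first by rewrite in_itv/= => /andP[? ?]; apply: dG; rewrite !ltW.
  apply: derivable_within_continuous => x; rewrite in_itv /= => xab.
  by case: (dG x xab).
rewrite -subr_ge0 Gc mulr_ge0 ?subr_ge0//; apply: g0.
by move: cab; rewrite in_itv.
Qed.

Lemma derive_le G H (g h : R -> R) a b : a <= b ->
  (forall x, a <= x <= b -> is_derive x 1 G (g x)) ->
  (forall x, a <= x <= b -> is_derive x 1 H (h x)) ->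
  (forall x, a <= x <= b -> g x <= h x) -> G b - G a <= H b - H a.
Proof.
move=> ab dG dH gh.
have : (H - G) a <= (H - G) b.
  apply: (@ge0_derive_le _ (fun x => h x - g x)) => // x xab.
    by have := dG x xab; have := dH x xab => ? ?; apply: is_deriveB.
  by rewrite subr_ge0 gh.
rewrite !fctE; lra.
Qed.

Lemma derive_bound G (g : R -> R) c a b :
  (forall x, is_derive x 1 G (g x)) -> (forall x, `|g x| <= c) ->
  `|G b - G a| <= c * `|b - a|.
Proof.
move=> dG gc; wlog ab : a b / a <= b => [H|].
  by case: (leP a b) => [/H//|/ltW /H]; rewrite distrC (distrC a).
have dc x : is_derive x 1 (fun y => c * y) c.
  have H : is_derive x 1 (c \*: (@id R)) (c *: (1:R)) by exact: is_deriveZ.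
  by apply: is_derive_eq H _; rewrite /GRing.scale /= mulr1.
have dNc x : is_derive x 1 (fun y => (- c) * y) (- c).
  have H : is_derive x 1 ((- c) \*: (@id R)) ((- c) *: (1:R)) by exact: is_deriveZ.
  by apply: is_derive_eq H _; rewrite /GRing.scale /= mulr1.
rewrite (ger0_norm (_ : 0 <= b - a)) ?subr_ge0// ler_norml; apply/andP; split.
  rewrite -mulNr mulrBr.
  apply: (@derive_le _ _ (fun=> - c) g) => // x _.
  by have := gc x; rewrite ler_norml => /andP[].
rewrite mulrBr; apply: (@derive_le _ _ g (fun=> c)) => // x _.
by have := gc x; rewrite ler_norml => /andP[].
Qed.

Definition iint a b f : R := \int[lebesgue_measure]_(x in `[a, b]) f x.

Lemma cont_integrable f a b : continuous f ->
  (@lebesgue_measure R).-integrable `[a, b] (EFin \o f).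
Proof.
move=> cf; apply: continuous_compact_integrable; first exact: segment_compact.
exact: continuous_subspaceT.
Qed.

Lemma iint_cst c a b : a <= b -> iint a b (fun=> c) = c * (b - a).
Proof.
move=> ab; rewrite /iint Rintegral_cst//.
rewrite /= lebesgue_measure_itv/= lte_fin.
case: ltP => [//|ba]; have -> : a = b by apply/eqP; rewrite eq_le ab ba.
by rewrite subrr mulr0.
Qed.

Lemma iint_le f g a b : continuous f -> continuous g ->
  (forall x, a <= x <= b -> f x <= g x) -> iint a b f <= iint a b g.
Proof.
move=> cf cg fg; apply: le_Rintegral; [by []|exact: cont_integrable|exact: cont_integrable|].
by move=> x /=; rewrite in_itv/=; exact: fg.
Qed.


Lemma iint_split f a b c : continuous f -> a <= b -> b <= c ->
  iint a c f = iint a b f + iint b c f.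
Proof.
move=> cf ab bc.
have := @Rintegral_itvB R f (BLeft a) (BRight c) b (cont_integrable _ _ cf).
rewrite !bnd_simp => /(_ ab bc); rewrite Rintegral_itv_obnd_cbnd; last first.
  apply: integrableS (cont_integrable b c cf) => //.
  by apply: subset_itvr; rewrite bnd_simp.
by rewrite /iint => <-; rewrite subrKC.
Qed.

(** The sign for x < 0 makes this a primitive on the whole line, so that two-sided derivatives are
    available even at time 0. *)
Definition prim f x : R := if 0 <= x then iint 0 x f else - iint x 0 f.

Lemma prim0 f : prim f 0 = 0.
Proof. by rewrite /prim lexx /iint set_itv1 Rintegral_set1. Qed.

Lemma prim_iint f a b : continuous f -> a <= b ->
  iint a b f = prim f b - prim f a.
Proof.
move=> cf ab; rewrite /prim.
case: (leP 0 a) => a0; case: (leP 0 b) => b0.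
- by rewrite (iint_split cf a0 ab) addrC addKr.
- by have := le_lt_trans (le_trans a0 ab) b0; rewrite ltxx.
- by rewrite opprK addrC; apply: iint_split => //; exact: ltW.
- by rewrite opprK (iint_split cf ab (ltW b0)) addrC addrK.
Qed.

Lemma is_derive_prim f x : continuous f -> is_derive x 1 (prim f) (f x).
Proof.
move=> cf; apply/is_derive_eps => e e0.
have /continuousP_eps/(_ _ e0)[d d0 dP] := cf x.
exists d => // h hd.
have bnd a b : a <= b -> (forall y, a <= y <= b -> `|f y - f x| <= e) ->
    `|prim f b - prim f a - (b - a) * f x| <= e * (b - a).
  move=> ab fe; rewrite -(prim_iint cf ab) ler_norml; apply/andP; split.
    rewrite lerBrDl -mulNr [leLHS]addrC [_ * f x]mulrC -mulrDl -iint_cst//.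
    apply: iint_le => // [y|y yab]; first exact: cvg_cst.
    by have := fe _ yab; rewrite ler_norml => /andP[]; lra.
  rewrite lerBlDl addrC [(b - a) * f x]mulrC -mulrDl -iint_cst//.
  apply: iint_le => // [y|y yab]; first exact: cvg_cst.
  by have := fe _ yab; rewrite ler_norml => /andP[]; lra.
have near y : `|y - x| <= `|h| -> `|f y - f x| <= e.
  move=> yx; have := dP (y - x) (le_lt_trans yx hd).
  by rewrite subrKC; exact: ltW.
case: (leP 0 h) => h0.
  have := bnd x (x + h); rewrite lerDl [x + h - x]addrC addKr [`|h|]ger0_norm//.
  apply => // y yx; apply: near; rewrite !ger0_norm//; lra.
have := bnd (x + h) x; rewrite [`|h|]ltr0_norm// gerDl opprD addrA subrr sub0r.
move=> H; rewrite (_ : _ - _ - _ = - (prim f x - prim f (x + h) - (- h) * f x)); last by ring.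
rewrite normrN; apply: H => [|y yx]; first exact: ltW.
by apply: near; rewrite [`|h|]ltr0_norm// ler_norml; lra.
Qed.

Lemma iintE f G a b : continuous f -> (forall x, is_derive x 1 G (f x)) ->
  a <= b -> iint a b f = G b - G a.
Proof.
move=> cf dG ab; rewrite prim_iint//.
have d0 x : is_derive x 1 (prim f - G) 0.
  have := is_derive_prim x cf => dp; have := dG x => dg.
  by apply: is_derive_eq (is_deriveB _ _) _; rewrite subrr.
by have := is_derive_0_is_cst a b d0; rewrite !fctE; lra.
Qed.

Lemma is_derive_shiftr G (g : R -> R) c :
  (forall x, is_derive x 1 G (g x)) ->
  forall x, is_derive x 1 (fun y => G (y + c)) (g (x + c)).
Proof.
move=> dG x; apply/is_derive_eps => e e0.
have /is_derive_eps/(_ _ e0)[d d0 dP] := dG (x + c).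
by exists d => // h /dP; rewrite (addrAC x c h).
Qed.

Lemma continuous_shiftr f c : continuous f -> continuous (fun x => f (x + c)).
Proof.
move=> cf x; apply/continuousP_eps => e e0.
have /continuousP_eps/(_ _ e0)[d d0 dP] := cf (x + c).
by exists d => // h /dP; rewrite (addrAC x c h).
Qed.

Lemma iint_shift f a b c : continuous f -> a <= b ->
  iint a b (fun x => f (x + c)) = iint (a + c) (b + c) f.
Proof.
move=> cf ab; rewrite (prim_iint cf) ?lerD2r//.
apply: (@iintE _ (fun x => prim f (x + c))) => //.
  exact: continuous_shiftr.
by apply: is_derive_shiftr => x; exact: is_derive_prim.
Qed.

Lemma iintD f g a b : continuous f -> continuous g ->
  iint a b (fun x => f x + g x) = iint a b f + iint a b g.
Proof. by move=> cf cg; apply: RintegralD => //; exact: cont_integrable. Qed.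

Lemma iintB f g a b : continuous f -> continuous g ->
  iint a b (fun x => f x - g x) = iint a b f - iint a b g.
Proof. by move=> cf cg; apply: RintegralB => //; exact: cont_integrable. Qed.

Lemma iintZ f c a b : continuous f ->
  iint a b (fun x => c * f x) = c * iint a b f.
Proof. by move=> cf; apply: RintegralZl => //; exact: cont_integrable. Qed.

Lemma continuous_norm f : continuous f -> continuous (fun x => `|f x|).
Proof.
move=> cf x; apply: (@continuous_comp _ _ _ f (fun y => `|y|)).
  exact: cf.
exact: norm_continuous.
Qed.

Lemma iint_norm f a b : continuous f ->
  `|iint a b f| <= iint a b (fun x => `|f x|).
Proof. by move=> cf; apply: le_normr_Rintegral => //; exact: cont_integrable. Qed.

Lemma eq_iint f g a b : (forall x, a <= x <= b -> f x = g x) ->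
  iint a b f = iint a b g.
Proof.
by move=> fg; apply: eq_Rintegral => x; rewrite inE/= in_itv/=; exact: fg.
Qed.

Lemma iint_ge0 f a b : (forall x, a <= x <= b -> 0 <= f x) -> 0 <= iint a b f.
Proof.
by move=> f0; apply: Rintegral_ge0 => x /=; rewrite in_itv/=; exact: f0.
Qed.

Lemma iint_bound f c a b : continuous f -> a <= b ->
  (forall x, a <= x <= b -> `|f x| <= c) -> `|iint a b f| <= c * (b - a).
Proof.
move=> cf ab fc; apply: le_trans (iint_norm _ _ cf) _; rewrite -iint_cst//.
by apply: iint_le => //; [exact: continuous_norm|move=> x; exact: cvg_cst].
Qed.

(** Comparison with the primitives of -c e^(l s) and c e^(l s). Integration gains the factor 1 / l
    on the weight e^(l t), which is what makes the Picard iteration contract. *)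
Lemma prim_bound_exp f (c l t : R) : continuous f -> 0 < l -> 0 <= t ->
  (forall s : R, 0 <= s <= t -> `|f s| <= c * expR (l * s)) ->
  `|prim f t| <= c / l * (expR (l * t) - 1).
Proof.
move=> cf l0 t0 fc.
have de (k x : R) : is_derive x 1 (fun y => k / l * expR (l * y)) (k * expR (l * x)).
  have H : is_derive x 1 (l \*: (@id R)) (l *: (1:R)) by exact: is_deriveZ.
  have H2 : is_derive x 1 (expR \o (l \*: (@id R))) (expR (l * x) * (l *: (1:R))).
    by apply: is_derive1_comp; exact: is_derive_expR.
  have H3 := is_deriveZ (k / l) H2.
  apply: is_derive_eq H3 _; rewrite /GRing.scale/= mulr1.
  by field; rewrite gt_eqF.
have H1 : - c / l * expR (l * t) - (- c / l) * expR (l * 0) <= prim f t - prim f 0.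
  apply: (@derive_le (fun y => - c / l * expR (l * y)) (prim f) (fun s => - c * expR (l * s)) f) => // x xt.
    exact: is_derive_prim.
  by have := fc _ xt; rewrite ler_norml => /andP[]; rewrite mulNr.
have H2 : prim f t - prim f 0 <= c / l * expR (l * t) - c / l * expR (l * 0).
  apply: (@derive_le (prim f) (fun y => c / l * expR (l * y)) f (fun s => c * expR (l * s))) => // x xt.
    exact: is_derive_prim.
  by have := fc _ xt; rewrite ler_norml => /andP[].
move: H1 H2; rewrite prim0 mulr0 expR0 ler_norml => H1 H2; apply/andP; split; lra.
Qed.

(** As a function of [a], the left side has derivative f (a + P) - f a = 0. *)
Lemma iint_periodic f (P a : R) : 0 < P -> continuous f -> periodic f P ->
  iint a (a + P) f = iint 0 P f.
Proof.
move=> P0 cf fP; have P0' := ltW P0.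
rewrite (prim_iint cf) ?lerDl// (prim_iint cf P0').
have d0 x : is_derive x 1 ((fun y => prim f (y + P)) - prim f) 0.
  have := is_derive_prim x cf => dp.
  have dg : is_derive x 1 (fun y => prim f (y + P)) (f (x + P)).
    by apply: is_derive_shiftr => y; exact: is_derive_prim.
  by apply: is_derive_eq (is_deriveB _ _) _; rewrite fP subrr.
by have := is_derive_0_is_cst a 0 d0; rewrite !fctE add0r.
Qed.

Lemma iint_periodicn f (P a : R) n : 0 < P -> continuous f -> periodic f P ->
  iint a (a + P *+ n) f = iint 0 P f *+ n.
Proof.
move=> P0 cf fP; elim: n => [|n IH]; first by rewrite !mulr0n addr0 /iint set_itv1 Rintegral_set1.
rewrite (@iint_split _ _ (a + P *+ n))// ?lerDl ?mulrn_wge0 ?(ltW P0)//.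
  by rewrite IH !mulrSr addrA iint_periodic.
by rewrite lerD2l mulrSr lerDl (ltW P0).
Qed.

End calculus.

(** * Compactly supported functions on the line; mean value estimates *)

Section continuity.
Variable R : realType.
Implicit Types (f g k : R -> R) (a b c d e h l s t x y z K C L mu : R).

Lemma contD f g : continuous f -> continuous g -> continuous (fun x => f x + g x).
Proof. by move=> cf cg x; apply: cvgD; [exact: cf|exact: cg]. Qed.

Lemma contB f g : continuous f -> continuous g -> continuous (fun x => f x - g x).
Proof. by move=> cf cg x; apply: cvgB; [exact: cf|exact: cg]. Qed.

Lemma contM f g : continuous f -> continuous g -> continuous (fun x => f x * g x).
Proof. by move=> cf cg x; apply: cvgM; [exact: cf|exact: cg]. Qed.

Lemma contZ f (c : R) : continuous f -> continuous (fun x => c * f x).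
Proof. by move=> cf; apply: contM => // x; exact: cvg_cst. Qed.

Lemma cont_flip k (x : R) : continuous k -> continuous (fun y => k (x - y)).
Proof.
move=> ck y; apply/continuousP_eps => e e0.
have /continuousP_eps/(_ _ e0)[d d0 dP] := ck (x - y).
by exists d => // h hd; have := dP (- h); rewrite normrN opprD addrA; apply.
Qed.

Lemma lipschitz_continuous f (C : R) :
  (forall x y, `|f x - f y| <= C * `|x - y|) -> continuous f.
Proof.
move=> lf x; apply/continuousP_eps => e e0.
have C0 : 0 <= C.
  by have := le_trans (normr_ge0 _) (lf 1 0); rewrite subr0 normr1 mulr1.
exists (e / (C + 1)) => [|h]; first by rewrite divr_gt0//; lra.
rewrite ltr_pdivlMr ?(ltr_wpDl C0)// => he; apply: le_lt_trans (lf _ _) _.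
rewrite [x + h - x]addrC addKr; apply: le_lt_trans he.
by rewrite mulrC ler_wpM2l//; lra.
Qed.

Lemma cont_bounded f (a b : R) : continuous f ->
  exists2 C : R, 0 < C & forall x, a <= x <= b -> `|f x| <= C.
Proof.
move=> cf; case: (leP a b) => ab; last first.
  by exists 1 => // x; lra.
have [|c _ cP] := EVT_max ab (f := fun x => `|f x|).
  by apply: continuous_subspaceT; exact: continuous_norm.
exists (`|f c| + 1) => [|x xab]; first by rewrite ltr_wpDl.
by apply: le_trans (cP x _) _; [rewrite in_itv|rewrite lerDl].
Qed.

Definition supp (K : R) f := forall x, K < `|x| -> f x = 0.

Lemma supp_bounded K f : continuous f -> supp K f ->
  exists2 C : R, 0 < C & forall x, `|f x| <= C.
Proof.
move=> cf sf; have [C C0 CP] := cont_bounded (- K) K cf.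
exists C => // x; case: (leP `|x| K) => xK; first by apply: CP; rewrite -ler_norml.
by rewrite sf// normr0 ltW.
Qed.

Lemma int_supp f (a b : R) : (forall x, ~~ (a <= x <= b) -> f x = 0) ->
  \int[lebesgue_measure]_x f x = iint a b f.
Proof.
move=> f0; rewrite /iint [RHS]Rintegral_mkcond; congr (Rintegral _ _ _).
apply/funext => x; rewrite patchE; case: ifPn => //.
by rewrite notin_setE/= in_itv/= => /negP/f0.
Qed.

Lemma int_shift f (a b c : R) : continuous f -> a <= b ->
  (forall x, ~~ (a <= x <= b) -> f x = 0) ->
  \int[lebesgue_measure]_x f (x + c) = \int[lebesgue_measure]_x f x.
Proof.
move=> cf ab f0; rewrite (int_supp f0) (@int_supp _ (a - c) (b - c)); last first.
  by move=> x xab; apply: f0; apply: contra xab; lra.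
by rewrite iint_shift// ?subrK// lerD2r.
Qed.

Lemma int_dilation f (K mu : R) : continuous f -> supp K f -> 0 < mu ->
  \int[lebesgue_measure]_x dilation f mu x = \int[lebesgue_measure]_x f x.
Proof.
move=> cf sf mu0; have K0 : 0 <= `|K| := normr_ge0 _.
have out x : ~~ (- `|K| <= x <= `|K|) -> f x = 0.
  rewrite -ler_norml -ltNge => xK; apply: sf; apply: le_lt_trans xK.
  exact: ler_norm.
rewrite (int_supp out) (@int_supp _ (- `|K| * mu) (`|K| * mu)); last first.
  move=> x xK; rewrite /dilation out ?mulr0//; apply: contra xK.
  by rewrite ler_pdivlMr// ler_pdivrMr.
rewrite (prim_iint cf); last by rewrite lerNl; lra.
have dG x : is_derive x 1 (fun y => prim f (mu^-1 * y)) (dilation f mu x).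
  have H : is_derive x 1 (mu^-1 \*: (@id R)) (mu^-1 *: (1:R)) by exact: is_deriveZ.
  have H2 : is_derive x 1 (prim f \o (mu^-1 \*: (@id R))) (f (mu^-1 * x) * (mu^-1 *: (1:R))).
    by apply: is_derive1_comp; exact: is_derive_prim.
  by apply: is_derive_eq H2 _; rewrite /GRing.scale/= mulr1 /dilation mulrC [x / mu]mulrC.
rewrite (iintE _ dG).
- by rewrite ![mu^-1 * _]mulrC !mulfK ?gt_eqF.
- rewrite /dilation; apply: contZ => x.
  apply: (@continuous_comp _ _ _ (fun x => x / mu) f); last exact: cf.
  exact: mulrr_continuous.
- by rewrite ler_wpM2r// ?(ltW mu0)//; lra.
Qed.

Lemma is_derive_unique f (x l l' : R) : is_derive x 1 f l -> is_derive x 1 f l' -> l = l'.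
Proof. by move=> [_ <-] [_ <-]. Qed.

Lemma is_derive1 f (x l : R) : is_derive x 1 f l -> derive1 f x = l.
Proof. by move=> [_ <-]; rewrite derive1E. Qed.

Lemma derivable_is_derive f (x : R) : derivable f x 1 -> is_derive x 1 f (derive1 f x).
Proof. by move=> df; rewrite derive1E; exact: DeriveDef. Qed.

(** The points with K < |x| form an open set, so f vanishes near each of them. *)
Lemma supp_derive K f k : (forall x, is_derive x 1 f (k x)) -> supp K f -> supp K k.
Proof.
move=> df sf x xK; apply: (is_derive_unique (df x)).
apply/is_derive_eps => e e0; exists (`|x| - K); first by rewrite subr_gt0.
move=> h hx; rewrite !sf// ?subr0 ?mulr0 ?subr0 ?normr0 ?mulr_ge0 ?(ltW e0)//.
have := ler_normB (x + h) h; rewrite addrK; lra.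
Qed.

Lemma mean_value f k (x h : R) : (forall x, is_derive x 1 f (k x)) ->
  exists2 c : R, `|c - x| <= `|h| & f (x + h) - f x = h * k c.
Proof.
move=> df; have cf : continuous f by move=> y; exact: is_derive_continuous (df y).
case: (leP 0 h) => h0.
  have [||c] := @MVT_segment _ f k x (x + h).
  - by rewrite lerDl.
  - exact: continuous_subspaceT.
  rewrite in_itv/= => /andP[c1 c2] ->; exists c.
    by rewrite !ger0_norm//; lra.
  by rewrite mulrC; congr (_ * _); ring.
have [||c] := @MVT_segment _ f k (x + h) x.
- by lra.
- exact: continuous_subspaceT.
rewrite in_itv/= => /andP[c1 c2] E; exists c.
  by rewrite [`|h|]ltr0_norm// ler_norml; lra.
rewrite -opprB E; ring.
Qed.

(** The mean value theorem gives L instead of the sharp L / 2, and asks only for a Lipschitz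
    derivative. *)
Lemma taylor1 f k (L x h : R) : (forall x, is_derive x 1 f (k x)) ->
  (forall x y, `|k x - k y| <= L * `|x - y|) -> 0 <= L ->
  `|f (x + h) - f x - h * k x| <= L * h ^+ 2.
Proof.
move=> df lk L0; have [c cx ->] := mean_value x h df.
rewrite -mulrBr normrM mulrC -(ger0_norm (sqr_ge0 h)) normrX expr2 mulrA.
by rewrite ler_wpM2r// (le_trans (lk _ _))// ler_wpM2l.
Qed.

Lemma derive_lipschitz f k (C : R) : (forall x, is_derive x 1 f (k x)) ->
  (forall x, `|k x| <= C) -> forall x y, `|f x - f y| <= C * `|x - y|.
Proof. by move=> df kC x y; apply: derive_bound kC. Qed.

End continuity.

(** * Continuous functions on the torus and their mass *)

Section torus.
Variable R : realType.
Implicit Types (f g k rho m u : R -> R) (a b c d e h l s t x y z K C L mu : R).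

Notation period := (pi *+ 2 : R).

Lemma period_gt0 : 0 < period.
Proof. by rewrite mulrn_wgt0// pi_gt0. Qed.

Lemma periodic_reduce f x : torus_periodic f ->
  exists2 y : R, 0 <= y <= period & f y = f x.
Proof.
move=> pf; have P0 := period_gt0.
have pn n z : f (z + period *+ n) = f z by apply: periodicn.
pose n := Num.floor (x / period).
have nx : n%:~R * period <= x < (n + 1)%:~R * period.
  by rewrite -ler_pdivlMr// -ltr_pdivrMr// floor_itv.
exists (x - n%:~R * period); first by move: nx; rewrite intrD mulrDl mul1r; lra.
(* [periodicn] shifts by natural multiples of the period, while the floor may be negative. *)
case: (n) => k.
  by rewrite -[LHS](pn k) -[_ *+ k]mulr_natl subrK.
by rewrite NegzE mulrNz mulNr opprK mulr_natl pn.
Qed.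

Lemma CT_cst c : CT (fun=> c).
Proof. by split => // x; exact: cvg_cst. Qed.

Lemma CT_D f g : CT f -> CT g -> CT (fun x => f x + g x).
Proof. by move=> [cf pf] [cg pg]; split; [exact: contD|move=> x /=; rewrite pf pg]. Qed.

Lemma CT_B f g : CT f -> CT g -> CT (fun x => f x - g x).
Proof. by move=> [cf pf] [cg pg]; split; [exact: contB|move=> x /=; rewrite pf pg]. Qed.

Lemma CT_M f g : CT f -> CT g -> CT (fun x => f x * g x).
Proof. by move=> [cf pf] [cg pg]; split; [exact: contM|move=> x /=; rewrite pf pg]. Qed.

Lemma CT_Z c f : CT f -> CT (fun x => c * f x).
Proof. by move=> cf; apply: CT_M => //; exact: CT_cst. Qed.

Lemma CT_shift c f : CT f -> CT (fun x => f (x + c)).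
Proof.
by move=> [cf pf]; split; [exact: continuous_shiftr|move=> x /=; rewrite addrAC pf].
Qed.

Lemma CT_comp (F : R -> R) f : continuous F -> CT f -> CT (fun x => F (f x)).
Proof.
move=> cF [cf pf]; split; last by move=> x /=; rewrite pf.
by move=> x; apply: (@continuous_comp _ _ _ f F); [exact: cf|exact: cF].
Qed.

Lemma CT_norm f : CT f -> CT (fun x => `|f x|).
Proof. by apply: CT_comp => x; exact: norm_continuous. Qed.

Lemma CT_max f g : CT f -> CT g -> CT (fun x => Num.max (f x) (g x)).
Proof.
move=> [cf pf] [cg pg]; split; last by move=> x /=; rewrite pf pg.
by move=> x; apply: continuous_max; [exact: cf|exact: cg].
Qed.

Lemma CT_min f g : CT f -> CT g -> CT (fun x => Num.min (f x) (g x)).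
Proof.
move=> [cf pf] [cg pg]; split; last by move=> x /=; rewrite pf pg.
by move=> x; apply: continuous_min; [exact: cf|exact: cg].
Qed.

Lemma CT_V f : CT f -> (forall x, f x != 0) -> CT (fun x => (f x)^-1).
Proof.
move=> [cf pf] f0; split; last by move=> x /=; rewrite pf.
by move=> x; apply: cvgV; [exact: f0|exact: cf].
Qed.

Lemma CT_bounded f : CT f -> exists2 C : R, 0 < C & forall x, `|f x| <= C.
Proof.
move=> [cf pf]; have [C C0 CP] := cont_bounded 0 period cf.
by exists C => // x; have [y yP <-] := periodic_reduce x pf; exact: CP.
Qed.

Lemma CT_gt0 f : CT f -> (forall x, 0 < f x) -> exists2 d : R, 0 < d & forall x, d <= f x.
Proof.
move=> [cf pf] f0; have [|c _ cP] := EVT_min (ltW period_gt0) (f := f).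
  exact: continuous_subspaceT.
exists (f c) => // x; have [y yP <-] := periodic_reduce x pf.
by apply: cP; rewrite in_itv.
Qed.

Lemma CT_ulim f : (forall e, 0 < e -> exists2 g, CT g & forall x, `|f x - g x| <= e) ->
  CT f.
Proof.
move=> fl; split => x /=.
  apply/continuousP_eps => e e0; have e3 : 0 < e / 4%:R by lra.
  have [g [cg _] gf] := fl _ e3.
  have /continuousP_eps/(_ _ e3)[d d0 dP] := cg x.
  exists d => // h /dP; have := gf x; have := gf (x + h).
  rewrite !ler_norml !ltr_norml; lra.
apply/eqP; rewrite -subr_eq0 -normr_le0; apply/ler_addgt0Pr => e e0.
have e3 : 0 < e / 2%:R by lra.
have [g [_ pg] gf] := fl _ e3; have := gf x; have := gf (x + period).
rewrite pg add0r !ler_norml; lra.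
Qed.

Definition mass f : R := iint 0 period f.

Lemma mass_shift f c : CT f -> mass (fun x => f (x + c)) = mass f.
Proof.
move=> [cf pf]; rewrite /mass iint_shift// ?(ltW period_gt0)// add0r addrC.
exact: iint_periodic period_gt0 _ _.
Qed.

Lemma mass_le f g : CT f -> CT g -> (forall x, f x <= g x) -> mass f <= mass g.
Proof. by move=> [cf _] [cg _] fg; apply: iint_le. Qed.

Lemma mass_bound f c : CT f -> (forall x, `|f x| <= c) -> `|mass f| <= c * period.
Proof.
move=> [cf _] fc; rewrite -[period]subr0; apply: iint_bound => //.
exact: ltW period_gt0.
Qed.

Lemma mass_ge0 f : (forall x, 0 <= f x) -> 0 <= mass f.
Proof. by move=> f0; apply: iint_ge0. Qed.

(** Nonnegativity allows the segment to be enlarged to n whole periods. In this way integrals over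
    the support of a kernel or of a test function are charged to the mass. *)
Lemma iint_mass f a b (n : nat) : CT f -> (forall x, 0 <= f x) -> a <= b -> b - a <= period *+ n ->
  iint a b f <= mass f *+ n.
Proof.
move=> [cf pf] f0 ab abn; rewrite -(@iint_periodicn _ f _ a n period_gt0 cf pf).
rewrite (@iint_split _ _ a b (a + period *+ n))//; last by lra.
by rewrite lerDl iint_ge0.
Qed.

Lemma period_archi L : exists n : nat, L <= period *+ n.
Proof.
exists (Num.truncn (`|L| / period)).+1.
rewrite -mulr_natl -ler_pdivrMr ?period_gt0//; apply/ltW.
apply: le_lt_trans (truncnS_gt _).
by rewrite ler_pM2r ?invr_gt0 ?period_gt0// ler_norm.
Qed.

(** * Convolution with a compactly supported kernel *)

Section convolution.
Variables (k k' : R -> R) (K : R).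
Hypotheses (sk : supp K k) (ck : continuous k).

Lemma conv_out rho x y : ~~ (x - K <= y <= x + K) -> rho y * k (x - y) = 0.
Proof.
move=> xy; rewrite sk ?mulr0// ltNge; apply: contra xy.
by rewrite ler_norml; lra.
Qed.

Lemma conv_iint rho x a b : a <= x - K -> x + K <= b ->
  convolution rho k x = iint a b (fun y => rho y * k (x - y)).
Proof.
move=> ax xb; apply: int_supp => y yab; apply: conv_out.
by apply: contra yab; lra.
Qed.

Lemma conv_bound rho x C : CT rho -> 0 <= K -> (forall z, `|k z| <= C) ->
  `|convolution rho k x| <= C * iint (x - K) (x + K) (fun y => `|rho y|).
Proof.
move=> [cr _] K0 kC; rewrite (@conv_iint _ _ (x - K) (x + K))//.
have cn := continuous_norm cr.
have ck2 := @cont_flip _ _ x ck.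
apply: le_trans (iint_norm _ _ (contM cr ck2)) _; rewrite -iintZ//.
apply: iint_le => [||y _].
- exact/continuous_norm/contM.
- exact: contZ.
- by rewrite normrM mulrC ler_wpM2r.
Qed.

(** Both convolutions are written over the common segment [x - K, y + K] (for x <= y), whose length
    is the factor 2 K + |x - y|. *)
Lemma conv_lip rho x y C L : CT rho -> 0 <= K -> 0 <= L ->
  (forall z, `|rho z| <= C) -> (forall z w, `|k z - k w| <= L * `|z - w|) ->
  `|convolution rho k x - convolution rho k y|
    <= C * L * (K *+ 2 + `|x - y|) * `|x - y|.
Proof.
move=> [cr _] K0 L0 rC kL; wlog xy : x y / x <= y.
  by move=> H; case: (leP x y) => [/H//|/ltW/H]; rewrite distrC (distrC y).
rewrite [`|x - y|]distrC (ger0_norm (_ : 0 <= y - x)) ?subr_ge0//.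
rewrite !(@conv_iint _ _ (x - K) (y + K)); try lra.
have cx := contM cr (@cont_flip _ _ x ck); have cy := contM cr (@cont_flip _ _ y ck).
rewrite -iintB// mulrAC (_ : K *+ 2 + (y - x) = y + K - (x - K)); last by rewrite mulr2n; ring.
apply: iint_bound; [exact: contB|lra|move=> z _].
rewrite -mulrBr normrM -mulrA ler_pM// (le_trans (kL _ _))//.
have -> : x - z - (y - z) = - (y - x) by ring.
by rewrite normrN ger0_norm ?subr_ge0.
Qed.

Lemma conv_continuous rho L : CT rho -> 0 <= K -> 0 <= L ->
  (forall z w, `|k z - k w| <= L * `|z - w|) -> continuous (convolution rho k).
Proof.
move=> Cr K0 L0 kL; have [C C0 rC] := CT_bounded Cr.
move=> x; apply/continuousP_eps => e e0.
pose D := C * L * (K *+ 2 + 1).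
have D0 : 0 <= D by rewrite /D !mulr_ge0 ?(ltW C0)// addr_ge0// mulrn_wge0.
exists (Num.min 1 (e / (D + 1))) => [|h].
  by rewrite lt_min ltr01/= divr_gt0//; lra.
rewrite lt_min => /andP[h1]; rewrite ltr_pdivlMr ?(ltr_wpDl D0)// => he.
apply: le_lt_trans (conv_lip _ _ Cr K0 L0 rC kL) _.
rewrite [x + h - x]addrC addKr; apply: le_lt_trans he.
rewrite [leRHS]mulrC ler_wpM2r//; apply: (@le_trans _ _ D); last by lra.
by apply: ler_wpM2l; [rewrite mulr_ge0// ltW|rewrite lerD2l ltW].
Qed.

Lemma conv_periodic rho : CT rho -> 0 <= K -> torus_periodic (convolution rho k).
Proof.
move=> [cr pr] K0 x; rewrite /convolution.
have cx := contM cr (@cont_flip _ _ (x + period) ck).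
rewrite -(@int_shift _ _ (x + period - K) (x + period + K) period)//; last 2 first.
- by rewrite lerBlDr; lra.
- by move=> y; exact: conv_out.
by congr (Rintegral _ _ _); apply/funext => y; rewrite pr; congr (_ * k _); ring.
Qed.

(** The Taylor remainder of the kernel is at most L h^2, uniformly in y, and is integrated against
    the bounded rho. *)
Lemma conv_derive rho L : CT rho -> 0 <= K -> 0 <= L ->
  supp K k' -> continuous k' -> (forall x, is_derive x 1 k (k' x)) ->
  (forall z w, `|k' z - k' w| <= L * `|z - w|) ->
  forall x, is_derive x 1 (convolution rho k) (convolution rho k' x).
Proof.
move=> Cr K0 L0 sk' ck' dk k'L x; have [C C0 rC] := CT_bounded Cr.
have [cr _] := Cr.
apply/is_derive_eps => e e0.
(* 2 K + 2 is the length of a segment that contains the supports of all kernels shifted by |h| <=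
   1. *)
pose D := C * L * (K *+ 2 + 2%:R).
have D0 : 0 <= D by rewrite /D !mulr_ge0 ?(ltW C0)// addr_ge0// mulrn_wge0.
exists (Num.min 1 (e / (D + 1))) => [|h].
  by rewrite lt_min ltr01/= divr_gt0//; lra.
rewrite lt_min => /andP[h1]; rewrite ltr_pdivlMr ?(ltr_wpDl D0)// => he.
have hh : - 1 <= h <= 1 by rewrite -ler_norml ltW.
rewrite !(@conv_iint _ _ (x - K - 1) (x + K + 1)); try lra.
have -> : convolution rho k' x
    = iint (x - K - 1) (x + K + 1) (fun y => rho y * k' (x - y)).
  apply: int_supp => y yab; rewrite sk' ?mulr0// ltNge; apply: contra yab.
  by rewrite ler_norml; lra.
have c1 := contM cr (@cont_flip _ _ x ck); have c2 := contM cr (@cont_flip _ _ (x + h) ck).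
have c3 := contM cr (@cont_flip _ _ x ck').
rewrite -iintZ// -!iintB//; last 2 first.
- exact: contB.
- exact: contZ.
apply: (@le_trans _ _ (C * (L * h ^+ 2) * (x + K + 1 - (x - K - 1)))).
  apply: iint_bound; [|lra|move=> y _].
    by apply: contB; [exact: contB|exact: contZ].
  rewrite (_ : _ - _ - _ = rho y * (k (x - y + h) - k (x - y) - h * k' (x - y))); last first.
    rewrite (_ : x + h - y = x - y + h); ring.
  by rewrite normrM ler_pM//; exact: taylor1.
rewrite (_ : _ * _ = D * `|h| * `|h|); last first.
  rewrite -(ger0_norm (sqr_ge0 h)) normrX /D mulr2n; ring.
rewrite ler_wpM2r//; apply: le_trans (ltW he).
by rewrite mulrC ler_wpM2l//; lra.
Qed.

End convolution.

End torus.

(** * The mollified potential and its force *)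

Section potential.
Variable R : realType.
Implicit Types (f g k rho m u : R -> R) (b c d e h l s t x y z K C L mu : R).

Notation period := (pi *+ 2 : R).

Lemma compact_supp f : compact (closure [set x | f x != 0]) ->
  exists2 K : R, 0 < K & supp K f.
Proof.
move=> /compact_bounded[M [_ MP]].
exists (`|M| + 1) => [|x]; first by rewrite ltr_wpDl.
move=> xM; apply/eqP; apply: contraTT xM => fx0; rewrite -leNgt.
by apply: (MP (`|M| + 1)); [rewrite (le_lt_trans (ler_norm M))// ltrDl|exact: subset_closure].
Qed.

(** C2 is a bound on the second derivative; the third derivative serves for the continuity of the
    second, hence for its boundedness. *)
Lemma Cc_kernel f : Cc_infty f ->
  exists K C1 C2 : R, [/\ 0 < K /\ supp K f, 0 < C1, 0 < C2,
    forall x, is_derive x 1 f (derive1 f x)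
  & (forall x, `|derive1 f x| <= C1) /\
    forall x y, `|derive1 f x - derive1 f y| <= C2 * `|x - y| ].
Proof.
move=> [sf /compact_supp[K K0 sK]].
have df x : is_derive x 1 f (derive1 f x) by apply: derivable_is_derive; exact: (sf 0%N).
have ddf x : is_derive x 1 (derive1 f) (derive1n 2 f x).
  by apply: derivable_is_derive; exact: (sf 1%N).
have dddf x : is_derive x 1 (derive1n 2 f) (derive1n 3 f x).
  by apply: derivable_is_derive; exact: (sf 2%N).
have s1 := supp_derive df sK; have s2 := supp_derive ddf s1.
have [|C1 C10 C1P] := supp_bounded _ s1.
  by move=> x; exact: is_derive_continuous (ddf x).
have [|C2 C20 C2P] := supp_bounded _ s2.
  by move=> x; exact: is_derive_continuous (dddf x).
exists K, C1, C2; split => //; split => //.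
exact: derive_lipschitz.
Qed.

Section dilation.
Variables (phi : R -> R) (K C1 C2 mu : R).
Hypotheses (K0 : 0 < K) (sphi : supp K phi) (C10 : 0 < C1) (C20 : 0 < C2).
Hypothesis dphi : forall x, is_derive x 1 phi (derive1 phi x).
Hypothesis phi'_bound : forall x, `|derive1 phi x| <= C1.
Hypothesis phi'_lip : forall x y, `|derive1 phi x - derive1 phi y| <= C2 * `|x - y|.
Hypotheses (mu0 : 0 < mu) (mu1 : mu <= 1).

Definition dil' x : R := mu ^- 2 * derive1 phi (x / mu).

(** Since mu <= 1 the support shrinks. Keeping the radius K makes the number of periods that cover
    it independent of eps. *)
Lemma supp_scaled f : supp K f -> supp K (fun x => f (x / mu)).
Proof.
move=> sf x xK; apply: sf; rewrite normrM (ger0_norm (_ : 0 <= mu^-1)) ?invr_ge0 ?ltW//.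
rewrite ltr_pdivlMr//; apply: le_lt_trans xK; rewrite ger_pMr//.
Qed.

Lemma supp_dil : supp K (dilation phi mu).
Proof. by move=> x xK; rewrite /dilation supp_scaled ?mulr0. Qed.

Lemma supp_dil' : supp K dil'.
Proof.
by move=> x xK; rewrite /dil' (supp_scaled (supp_derive dphi sphi)) ?mulr0.
Qed.

Lemma dil_derive x : is_derive x 1 (dilation phi mu) (dil' x).
Proof.
have H : is_derive x 1 (mu^-1 \*: (@id R)) (mu^-1 *: (1:R)) by exact: is_deriveZ.
have H2 : is_derive x 1 (phi \o (mu^-1 \*: (@id R)))
    (derive1 phi (mu^-1 * x) * (mu^-1 *: (1:R))).
  by apply: is_derive1_comp.
have := is_deriveZ mu^-1 H2.
have -> : mu^-1 \*: (phi \o mu^-1 \*: id) = dilation phi mu.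
  by apply/funext => y; rewrite /dilation mulrC /GRing.scale/= mulrC [y / mu]mulrC.
move=> H3; apply: is_derive_eq H3 _.
rewrite /GRing.scale/= mulr1 /dil' [mu^-1 * x]mulrC expr2 invfM; ring.
Qed.

Lemma dil'_bound x : `|dil' x| <= mu ^- 2 * C1.
Proof.
rewrite /dil' normrM (ger0_norm (_ : 0 <= mu ^- 2)); last first.
  by rewrite invr_ge0 exprn_ge0 ?ltW.
by rewrite ler_pM2l ?invr_gt0 ?exprn_gt0.
Qed.

(** The worse power mu^-3 serves for continuity and differentiability of convolutions at fixed eps;
    it does not enter the rates. *)
Lemma dil'_lip x y : `|dil' x - dil' y| <= mu ^- 3 * C2 * `|x - y|.
Proof.
have m2 : 0 < mu ^- 2 by rewrite invr_gt0 exprn_gt0.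
rewrite /dil' -mulrBr normrM (ger0_norm (ltW m2)).
apply: (@le_trans _ _ (mu ^- 2 * (C2 * `|x / mu - y / mu|))).
  by rewrite ler_pM2l.
have mi0 : 0 <= mu^-1 by rewrite invr_ge0 ltW.
rewrite -mulrBl normrM (ger0_norm mi0).
rewrite le_eqVlt; apply/orP; left; apply/eqP; by field; rewrite gt_eqF.
Qed.

Lemma dil_continuous : continuous (dilation phi mu).
Proof. by move=> x; exact: is_derive_continuous (dil_derive x). Qed.

Lemma dil'_continuous : continuous dil'.
Proof. exact: lipschitz_continuous dil'_lip. Qed.

End dilation.

Lemma C2_derive1 (a : R -> R) : C2 a -> torus_periodic a ->
  (forall x, is_derive x 1 a (derive1 a x)) /\ CT (derive1 a).
Proof.
move=> [da ca] pa.
have d1 x : is_derive x 1 a (derive1 a x).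
  by apply: derivable_is_derive; exact: (da 0%N).
have d2 x : is_derive x 1 (derive1 a) (derive1n 2 a x).
  by apply: derivable_is_derive; exact: (da 1%N).
split=> //; split; first by move=> x; exact: is_derive_continuous (d2 x).
move=> x; apply: (is_derive_unique _ (d1 x)).
have := @is_derive_shiftr R a (derive1 a) period d1 x.
by congr (is_derive _ _ _ _); apply/funext => y; exact: pa.
Qed.

(** Q and A are chosen before eps: the dependence on eps is wholly in the factor mu^-2 from the sup
    of the differentiated kernel. The force is affine in rho, so its Lipschitz estimate is the bound
    on the convolution applied to rho - rho'. *)
Lemma potential_force (g : R) (phi a : R -> R) : 0 <= g ->
  Cc_infty phi -> torus_periodic a -> C2 a ->
  exists Q A : R, [/\ 0 <= Q, 0 <= A & forall alpha eps : R, 0 < alpha -> 0 < eps < 1 ->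
    let q := Q * (eps `^ alpha) ^- 2 in
    let force rho := derive1 (potential g a phi alpha eps rho) in
    [/\ forall rho, CT rho -> CT (force rho),
        forall rho x, CT rho -> `|force rho x| <= q * mass (fun y => `|rho y|) + A
      & forall rho rho' x, CT rho -> CT rho' ->
         `|force rho x - force rho' x| <= q * mass (fun y => `|rho y - rho' y|)]].
Proof.
move=> g0 /Cc_kernel[K [C1 [C2 [[K0 sphi] C10 C20 dphi [b1 l1]]]]] pa a2.
have [da Ca'] := C2_derive1 a2 pa.
have [A A0 AP] := CT_bounded Ca'.
have [n nK] := period_archi (K *+ 2).
(* [n] periods cover the support [x - K, x + K] of the shifted kernel; the second constant bounds g
   a'. *)
exists (g * C1 *+ n), (g * A); split; first by rewrite mulrn_wge0 ?mulr_ge0// ltW.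
  by rewrite mulr_ge0// ltW.
move=> alpha eps alpha0 /andP[e0 e1]; set mu := eps `^ alpha => q force.
have mu0 : 0 < mu by rewrite powR_gt0.
have mu1 : mu <= 1.
  have := @ge0_ler_powR R alpha (ltW alpha0) eps 1.
  by rewrite powR1 !nnegrE; apply; [exact: ltW|exact: ler01|exact: ltW].
have K0' := ltW K0.
have ck := dil_continuous dphi (mu := mu).
have ck' := dil'_continuous l1 mu0.
have sk := supp_dil K0 sphi mu0 mu1; have sk' := supp_dil' K0 sphi dphi mu0 mu1.
have dd x : is_derive x 1 (dilation phi mu) (dil' phi mu x) by exact: dil_derive.
have L0 : 0 <= mu ^- 3 * C2 by apply: mulr_ge0; rewrite ?invr_ge0 ?exprn_ge0 ?(ltW mu0) ?(ltW C20).
have forceE rho x : CT rho ->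
    force rho x = g * convolution rho (dil' phi mu) x + g * derive1 a x.
  move=> Cr; apply: is_derive1.
  have H1 := conv_derive sk ck Cr K0' L0 sk' ck' dd (dil'_lip l1 mu0) x.
  have H2 := da x.
  exact: (is_deriveD (is_deriveZ g H1) (is_deriveZ g H2)).
have convB rho rho' x : CT rho -> CT rho' ->
    convolution rho (dil' phi mu) x - convolution rho' (dil' phi mu) x
    = convolution (fun y => rho y - rho' y) (dil' phi mu) x.
  move=> [cr _] [cr' _]; rewrite !(@conv_iint _ _ K sk' _ _ (x - K) (x + K))//.
  have c3 := @cont_flip _ _ x ck'.
  rewrite -iintB; [|exact: contM|exact: contM].
  by apply: eq_iint => y _; rewrite mulrBl.
have bound rho x : CT rho -> g * `|convolution rho (dil' phi mu) x|
    <= q * mass (fun y => `|rho y|).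
  move=> Cr; apply: (@le_trans _ _ (g * (mu ^- 2 * C1 * (mass (fun y => `|rho y|) *+ n)))).
    rewrite ler_wpM2l//.
    apply: le_trans (conv_bound sk' ck' x Cr K0' (dil'_bound b1 mu0)) _.
    rewrite ler_wpM2l ?mulr_ge0 ?invr_ge0 ?exprn_ge0 ?(ltW mu0) ?(ltW C10)//.
    apply: iint_mass => //; [exact: CT_norm|lra|].
    by apply: le_trans nK; rewrite mulr2n; lra.
  by rewrite /q -[_ *+ n]mulr_natl -[_ * _ *+ n]mulr_natl; lra.
split.
- move=> rho Cr; have -> : force rho =
      fun x => g * convolution rho (dil' phi mu) x + g * derive1 a x.
    by apply/funext => x; exact: forceE.
  have Cc : CT (convolution rho (dil' phi mu)).
    split; first exact: (conv_continuous sk' ck' Cr K0' L0 (dil'_lip l1 mu0)).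
    exact: (conv_periodic sk' ck' Cr K0').
  exact: (CT_D (CT_Z g Cc) (CT_Z g Ca')).
- move=> rho x Cr; rewrite forceE//; apply: le_trans (ler_normD _ _) _.
  rewrite !normrM (ger0_norm g0) lerD ?bound//.
  by rewrite ler_wpM2l.
- move=> rho rho' x Cr Cr'; rewrite !forceE//.
  rewrite (_ : _ - _ = g * (convolution rho (dil' phi mu) x - convolution rho' (dil' phi mu) x)); last by ring.
  rewrite convB// normrM (ger0_norm g0); apply: bound; exact: CT_B.
Qed.

End potential.

(** * Derivatives in time, uniform in a parameter, and the barrier argument *)

Section uniform_derivative.
Variables (R : realType).
Implicit Types (c d e h l s t T : R).

(** Differentiability in the sup norm, one-sided at 0 because t + h stays in [0, T[. The index type
    is arbitrary so that pointwise quantities (X = R), the mass (X = unit) and disjoint sums of such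
    families are covered alike. *)
Definition uderiv (X : Type) (T : R) (w w' : R -> X -> R) : Prop :=
  forall t, 0 <= t < T -> forall e, 0 < e -> exists2 d : R, 0 < d &
    forall h, `|h| < d -> 0 <= t + h < T ->
    forall x, `|w (t + h) x - w t x - h * w' t x| <= e * `|h|.

Lemma uderiv_sub (X : Type) (S T : R) (w w' : R -> X -> R) : S <= T ->
  uderiv T w w' -> uderiv S w w'.
Proof.
move=> ST dw t /andP[t0 tS] e /(dw t _)[|d d0 dP]; first by lra.
by exists d => // h hd /andP[h0 hS]; apply: dP => //; lra.
Qed.

Lemma uderiv_sum (X Y : Type) T (w w' : R -> X -> R) (v v' : R -> Y -> R) :
  uderiv T w w' -> uderiv T v v' ->
  uderiv T (fun t i => match i with inl x => w t x | inr y => v t y end)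
           (fun t i => match i with inl x => w' t x | inr y => v' t y end).
Proof.
move=> dw dv t tT e e0; have [d d0 dP] := dw t tT e e0.
have [b b0 bP] := dv t tT e e0.
exists (Num.min d b); first by rewrite lt_min d0.
move=> h; rewrite lt_min => /andP[hd hb] hT [x|y]; first exact: dP.
exact: bP.
Qed.

Lemma uderivD (X : Type) T (w w' v v' : R -> X -> R) :
  uderiv T w w' -> uderiv T v v' ->
  uderiv T (fun t x => w t x + v t x) (fun t x => w' t x + v' t x).
Proof.
move=> dw dv t tT e e0; have e2 : 0 < e / 2%:R by lra.
have [d d0 dP] := dw t tT _ e2; have [b b0 bP] := dv t tT _ e2.
exists (Num.min d b); first by rewrite lt_min d0.
move=> h; rewrite lt_min => /andP[hd hb] hT x.
rewrite (_ : _ - _ - _ = (w (t + h) x - w t x - h * w' t x) +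
  (v (t + h) x - v t x - h * v' t x)); last by ring.
apply: le_trans (ler_normD _ _) _.
have := dP _ hd hT x; have := bP _ hb hT x; lra.
Qed.

Lemma uderivN (X : Type) T (w w' : R -> X -> R) :
  uderiv T w w' -> uderiv T (fun t x => - w t x) (fun t x => - w' t x).
Proof.
move=> dw t tT e e0; have [d d0 dP] := dw t tT e e0.
exists d => // h hd hT x; have := dP _ hd hT x.
by rewrite -normrN; congr (`|_| <= _); ring.
Qed.

Lemma uderiv_t (X : Type) T (f f' : R -> R) : (forall t, is_derive t 1 f (f' t)) ->
  uderiv T (fun t (_ : X) => f t) (fun t _ => f' t).
Proof.
move=> df t _ e e0; have /is_derive_eps/(_ _ e0)[d d0 dP] := df t.
by exists d => // h hd _ _; apply: dP.
Qed.

(** One admissible h > 0 suffices: the derivative is uniformly within 1 of a difference quotient of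
    bounded functions. *)
Lemma uderiv_bounded (X : Type) T (w w' : R -> X -> R) t :
  (forall t, 0 <= t < T -> exists C : R, forall x, `|w t x| <= C) ->
  uderiv T w w' -> 0 <= t < T -> exists2 C : R, 0 < C & forall x, `|w' t x| <= C.
Proof.
move=> bw dw tT; have [d d0 dP] := dw t tT 1 ltr01.
pose h := Num.min (d / 2%:R) ((T - t) / 2%:R).
have h0 : 0 < h by rewrite lt_min; apply/andP; split; lra.
have hd : `|h| < d by rewrite gtr0_norm// gt_min; apply/orP; left; lra.
have hT : 0 <= t + h < T.
  have : h <= (T - t) / 2%:R by rewrite ge_min lexx orbT.
  lra.
have [C1 C1P] := bw t tT; have [C2 C2P] := bw _ hT.
exists ((`|C1| + `|C2|) / h + 1) => [|x].
  by rewrite ltr_wpDl// divr_ge0 ?(ltW h0)// addr_ge0.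
have := dP _ hd hT x; rewrite mul1r (gtr0_norm h0) => H.
have {}H : `|h * w' t x| <= h + `|w (t + h) x| + `|w t x|.
  have := ler_normB (w (t + h) x - w t x) (w (t + h) x - w t x - h * w' t x).
  rewrite opprB addrC addrNK => H2; have := ler_normB (w (t + h) x) (w t x); lra.
move: H; rewrite normrM (gtr0_norm h0) => H.
rewrite -lerBlDr ler_pdivlMr// mulrBl mul1r mulrC.
have := C1P x; have := C2P x.
by have := ler_norm C1; have := ler_norm C2; lra.
Qed.

Lemma uderivM_t (X : Type) T (f f' : R -> R) (w w' : R -> X -> R) :
  (forall t, 0 <= t < T -> exists C : R, forall x, `|w t x| <= C) ->
  (forall t, is_derive t 1 f (f' t)) -> uderiv T w w' ->
  uderiv T (fun t x => f t * w t x) (fun t x => f' t * w t x + f t * w' t x).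
Proof.
move=> bw df dw t tT e e0; have [C CP] := bw t tT.
have [B B0 BP] := uderiv_bounded bw dw tT.
(* D dominates the coefficients of the three error terms of the product rule, each of which is then
   at most k D |h| <= e |h| / 3. *)
pose D : R := `|C| + `|f t| + 1 + `|f' t| * (B + 1) + (B + 1).
have D1 : 1 <= D.
  have : 0 <= `|f' t| * (B + 1) by rewrite mulr_ge0//; lra.
  by rewrite /D; have := normr_ge0 C; have := normr_ge0 (f t); lra.
have D0 : 0 < D by lra.
pose k := Num.min 1 (e / (D * 3%:R)).
have k0 : 0 < k by rewrite lt_min ltr01 divr_gt0// mulr_gt0.
have kD : k * D <= e / 3%:R.
  apply: (@le_trans _ _ (e / (D * 3%:R) * D)).
    by rewrite ler_pM2r// ge_min lexx orbT.
  by rewrite le_eqVlt; apply/orP; left; apply/eqP; field; rewrite gt_eqF.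
have k1 : k <= 1 by rewrite ge_min lexx.
clearbody k.
have /is_derive_eps/(_ _ k0)[d1 d10 P1] := df t.
have [d2 d20 P2] := dw t tT _ k0.
exists (Num.min (Num.min d1 d2) k); first by rewrite !lt_min d10 d20.
move=> h; rewrite !lt_min => /andP[/andP[hd1 hd2] hk] hT x.
have {}P1 := P1 h hd1; have {}P2 := P2 h hd2 hT x.
set r1 := f (t + h) - f t - h * f' t in P1.
set r2 := w (t + h) x - w t x - h * w' t x in P2.
have hw : `|w (t + h) x - w t x| <= (B + 1) * `|h|.
  rewrite (_ : _ - _ = r2 + h * w' t x); last by rewrite /r2; ring.
  apply: le_trans (ler_normD _ _) _; rewrite normrM.
  have : `|h| * `|w' t x| <= `|h| * B by rewrite ler_wpM2l.
  have : k * `|h| <= `|h| by rewrite ler_piMl.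
  lra.
rewrite (_ : _ - _ - _ = r1 * w t x + f t * r2 +
   (h * f' t + r1) * (w (t + h) x - w t x)); last by rewrite /r1 /r2; ring.
have A1 : `|r1 * w t x| <= k * D * `|h|.
  rewrite normrM mulrAC ler_pM//; apply: le_trans (CP x) _.
  have := normr_ge0 (f t); have := ler_norm C.
  have : 0 <= `|f' t| * (B + 1) by rewrite mulr_ge0//; lra.
  rewrite /D; lra.
have A2 : `|f t * r2| <= k * D * `|h|.
  rewrite normrM mulrC mulrAC ler_pM//.
  have := normr_ge0 C.
  have : 0 <= `|f' t| * (B + 1) by rewrite mulr_ge0//; lra.
  rewrite /D; lra.
have A3 : `|(h * f' t + r1) * (w (t + h) x - w t x)| <= k * D * `|h|.
  rewrite normrM.
  apply: (@le_trans _ _ ((`|f' t| + 1) * `|h| * ((B + 1) * `|h|))).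
    rewrite ler_pM//; apply: le_trans (ler_normD _ _) _; rewrite normrM.
    have : k * `|h| <= `|h| by rewrite ler_piMl.
    lra.
  rewrite (_ : _ * _ = `|h| * ((`|f' t| + 1) * (B + 1)) * `|h|); last by ring.
  rewrite ler_wpM2r//; apply: ler_pM => //; [by rewrite mulr_ge0//; lra|exact: ltW|].
  rewrite mulrDl mul1r /D.
  by have := normr_ge0 C; have := normr_ge0 (f t); lra.
apply: le_trans (ler_normD _ _) _.
have := ler_normD (r1 * w t x) (f t * r2).
have := ler_wpM2r (normr_ge0 h) kD; lra.
Qed.

(* At a first time s beyond which the bound fails, the rate condition gives
   w (s + h) <= (1 - h lam) w s - h eta + o(h) <= 0, uniformly in x. *)
Lemma barrier (X : Type) T (w w' : R -> X -> R) :
  uderiv T w w' -> (forall x, w 0 x <= 0) ->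
  (forall t, 0 <= t < T -> (forall x, w t x <= 0) ->
     exists lam eta : R, [/\ 0 <= lam, 0 < eta &
       forall x, w' t x <= - lam * w t x - eta]) ->
  forall t, 0 <= t < T -> forall x, w t x <= 0.
Proof.
move=> dw w0 rate t1 /andP[t10 t1T] x1.
pose S := [set s | 0 <= s <= t1 /\ forall r : R, 0 <= r <= s -> forall x, w r x <= 0].
have S0 : S 0.
  split; first by rewrite lexx.
  by move=> r; rewrite -eq_le => /eqP <-.
have Sb : has_ubound S by exists t1 => s [] /andP[].
pose s := sup S.
have s0 : 0 <= s by exact: ub_le_sup.
have st1 : s <= t1 by apply: ge_sup; [exists 0|move=> y [] /andP[]].
have sT : 0 <= s < T by rewrite s0 (le_lt_trans st1).
have below (r : R) : 0 <= r < s -> forall x, w r x <= 0.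
  move=> /andP[r0 rs] x; have sr : 0 < s - r by rewrite subr_gt0.
  have hS : has_sup S by split => //; exists 0.
  have [y Sy ry] := sup_adherent sr hS.
  by case: Sy => _; apply; rewrite r0 /=; move: ry; rewrite -/s; lra.
(* The inequality reaches s itself by a backward step: w s x exceeds w (s - h) x by at most h (|w' s
   x| + 1), which is made smaller than any e. *)
have at_s x : w s x <= 0.
  have [<-//|ns0] := eqVneq 0 s.
  have s0' : 0 < s by rewrite lt_neqAle ns0.
  apply/ler_addgt0Pr => e e0; rewrite add0r.
  have [d d0 dP] := dw s sT 1 ltr01.
  pose h := Num.min (Num.min (d / 2%:R) s) (e / (`|w' s x| + 1)).
  have wp : 0 < `|w' s x| + 1 by rewrite ltr_wpDl.
  have h0 : 0 < h by rewrite !lt_min s0' (divr_gt0 e0 wp) !andbT; lra.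
  have hd : h < d.
    have : h <= d / 2%:R by rewrite /h !ge_min lexx.
    by lra.
  have hs : h <= s by rewrite /h !ge_min lexx orbT.
  have he : h * (`|w' s x| + 1) <= e.
    by rewrite -ler_pdivlMr// /h ge_min lexx orbT.
  have := dP (- h); rewrite normrN gtr0_norm// => /(_ hd).
  have shT : 0 <= s - h < T by lra.
  move=> /(_ shT x); have := below (s - h) _ x; rewrite mul1r ler_norml => H /andP[H1 _].
  have := H ltac:(lra); have : h * w' s x <= h * `|w' s x|.
    by rewrite ler_pM2l// ler_norm.
  lra.
have [lam [eta [lam0 eta0 rateP]]] := rate s sT at_s.
(* The error allowed in the derivative is eta itself, so the margin absorbs the remainder exactly.
   The bound (lam + 1)^-1 on the step keeps 1 - h lam nonnegative. *)
have [d d0 dP] := dw s sT eta eta0.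
pose k := Num.min (d / 2%:R) (lam + 1)^-1.
have k0 : 0 < k by rewrite lt_min invr_gt0; apply/andP; split; lra.
have after h : 0 <= h <= k -> s + h < T -> forall x, w (s + h) x <= 0.
  move=> /andP[h0 hk] hT x.
  have hd : `|h| < d.
    rewrite ger0_norm//; apply: le_lt_trans hk _; rewrite gt_min.
    by apply/orP; left; lra.
  have hl : h * lam <= 1.
    apply: (@le_trans _ _ ((lam + 1)^-1 * (lam + 1))).
      apply: ler_pM => //; last by lra.
      by apply: le_trans hk _; rewrite ge_min lexx orbT.
    by rewrite mulVf// gt_eqF//; lra.
  have := dP h hd; have -> : 0 <= s + h < T by lra.
  move=> /(_ isT x); rewrite (ger0_norm h0) ler_norml => /andP[_ H].
  have H2 : h * w' s x <= h * (- lam * w s x - eta) by rewrite ler_wpM2l.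
  have H3 : (1 - h * lam) * w s x <= 0 by rewrite mulr_ge0_le0//; lra.
  lra.
have [<-//|ns] := eqVneq s t1.
have st : s < t1 by rewrite lt_neqAle ns.
pose h := Num.min k (t1 - s).
have h0 : 0 < h by rewrite lt_min k0 subr_gt0.
have hk : h <= k by rewrite ge_min lexx.
have ht : h <= t1 - s by rewrite ge_min lexx orbT.
suff : S (s + h) by move=> /(ub_le_sup Sb); rewrite -/s; lra.
split; first by lra.
move=> r rh x; case: (ltP r s) => rs; first by apply: below; lra.
by have := after (r - s) _ _ x; rewrite subrKC; apply; lra.
Qed.

End uniform_derivative.

(** * Picard iteration for a bounded Lipschitz field; uniqueness *)

Section picard.
Variable R : realType.
Implicit Types (c d e h l s t x y : R).

(** With v n = c / 2^n = 2 v (n + 1), the intervals of centre u n and radius 2 v n are nested; the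
    limit is the supremum of their left ends. *)
Lemma geometric_limit (u : nat -> R) c : 0 <= c ->
  (forall n, `|u n.+1 - u n| <= c / 2%:R ^+ n) ->
  exists l, forall n, `|u n - l| <= c *+ 2 / 2%:R ^+ n.
Proof.
move=> c0 du; pose v n := c / 2%:R ^+ n.
have vS n : v n = v n.+1 *+ 2.
  by rewrite /v exprS; field; rewrite expf_neq0 ?pnatr_eq0.
have v0 n : 0 <= v n by rewrite /v mulr_ge0// invr_ge0 exprn_ge0.
have lo n k : u n - v n *+ 2 <= u (n + k)%N - v (n + k)%N *+ 2.
  elim: k => [|k]; first by rewrite addn0.
  move=> /le_trans; apply; rewrite addnS.
  have := du (n + k)%N; rewrite -/(v _) (vS (n + k)%N) ler_norml; lra.
have up n k : u (n + k)%N + v (n + k)%N *+ 2 <= u n + v n *+ 2.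
  elim: k => [|k]; first by rewrite addn0.
  apply: le_trans; rewrite addnS.
  have := du (n + k)%N; rewrite -/(v _) (vS (n + k)%N) ler_norml; lra.
pose S := [set u n - v n *+ 2 | n in [set: nat]].
have ub n : ubound S (u n + v n *+ 2).
  move=> _ [m _ <-]; have := lo m n; have := up n m; rewrite addnC.
  by have := v0 (m + n)%N; lra.
have SN : S !=set0 by exists (u 0%N - v 0%N *+ 2); exists 0%N.
exists (sup S) => n; rewrite mulrnAl -/(v n) ler_norml.
have := ge_sup SN (ub n).
have : u n - v n *+ 2 <= sup S.
  by apply: ub_le_sup; [exists (u 0%N + v 0%N *+ 2); exact: ub|exists n].
lra.
Qed.

Lemma iint_continuous (f : R -> R -> R) (B a b : R) : (forall s, continuous (f s)) ->
  (forall x, continuous (fun s => f s x)) -> (forall s x, `|f s x| <= B) ->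
  continuous (fun x => iint a b (fun s => f s x)).
Proof.
move=> Cf cf fB x.
have := @continuity_under_integral R _ _ (@lebesgue_measure R) (fun x s => f s x)
  `[a, b] (measurable_itv _) (x - 1) (x + 1) _ _ (fun=> B) _ _.
move=> H; apply: H => //.
- by move=> y _; exact: cont_integrable.
- by apply: nearW => s _ y _; exact: Cf.
- by apply: cont_integrable => y; exact: cvg_cst.
- by move=> y _; apply: nearW => s _.
- by rewrite inE/= in_itv/=; apply/andP; split; lra.
Qed.

Lemma iint_CT (f : R -> R -> R) (B a b : R) : (forall s, CT (f s)) ->
  (forall x, continuous (fun s => f s x)) -> (forall s x, `|f s x| <= B) ->
  CT (fun x => iint a b (fun s => f s x)).
Proof.
move=> Cf cf fB; split; last first.
  by move=> x /=; apply: eq_iint => s _; have [_ ->] := Cf s.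
by apply: iint_continuous fB => // s; have [] := Cf s.
Qed.

Lemma prim_CT (f : R -> R -> R) (B : R) t : (forall s, CT (f s)) ->
  (forall x, continuous (fun s => f s x)) -> (forall s x, `|f s x| <= B) ->
  CT (fun x => prim (fun s => f s x) t).
Proof.
move=> Cf cf fB; rewrite /prim; case: (leP 0 t) => t0; first exact: iint_CT fB.
rewrite (_ : (fun x => _) = (fun x => -1 * iint t 0 (fun s => f s x))).
  by apply: CT_Z; exact: iint_CT fB.
by apply/funext => x; rewrite mulN1r.
Qed.

(* The two components are rho (true) and m = rho u (false). *)
Definition state := bool -> R -> R.
Definition good (z : state) := forall b, CT (z b).
Definition uclose d (z w : state) := forall b x, `|z b x - w b x| <= d.

Variables (F : state -> state) (L B : R) (z0 : state).
Hypotheses (L0 : 0 < L) (B0 : 0 < B) (z0_good : good z0).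
Hypothesis F_good : forall z, good z -> good (F z).
Hypothesis F_bound : forall z b x, good z -> `|F z b x| <= B.
Hypothesis F_lip : forall d z w, good z -> good w -> uclose d z w ->
  uclose (L * d) (F z) (F w).

Fixpoint iterate n t : state := fun b x =>
  match n with
  | 0 => z0 b x
  | n.+1 => z0 b x + prim (fun s => F (iterate n s) b x) t
  end.

Lemma F_path_continuous (z : R -> state) b x : (forall t, good (z t)) ->
  (forall s t, uclose (B * `|t - s|) (z t) (z s)) -> continuous (fun s => F (z s) b x).
Proof.
move=> gz lz; apply: (@lipschitz_continuous _ _ (L * B)) => s t.
by rewrite -mulrA; exact: F_lip.
Qed.

Lemma iterate_prop n : (forall t, good (iterate n t)) /\
  (forall s t, uclose (B * `|t - s|) (iterate n t) (iterate n s)).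
Proof.
elim: n => [|n [gn ln]].
  by split=> // s t b x /=; rewrite subrr normr0 mulr_ge0// ltW.
have cF b x := @F_path_continuous _ b x gn ln; split.
  move=> t b /=; apply: CT_D; first exact: z0_good.
  by apply: (prim_CT (B := B)) => [s|x|s x]; [exact: F_good|exact: cF|exact: F_bound].
move=> s t b x /=; rewrite opprD addrACA subrr add0r.
apply: (@derive_bound _ _ (fun s => F (iterate n s) b x)).
  by move=> y; exact: is_derive_prim.
by move=> y; exact: F_bound.
Qed.

(** In the norm weighted by e^(-l t) the iteration contracts by L / l = 1 / 2; [c] bounds the first
    step. *)
Let l := L *+ 2.
Let c := B / l.

Let l_gt0 : 0 < l. Proof. by rewrite mulrn_wgt0. Qed.
Let c_ge0 : 0 <= c. Proof. by rewrite divr_ge0// ltW. Qed.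

Lemma iterate_step n t : 0 <= t ->
  uclose (c / 2%:R ^+ n * expR (l * t)) (iterate n.+1 t) (iterate n t).
Proof.
elim: n t => [|n IH] t t0 b x.
  rewrite [iterate 1 t]/= [iterate 0 t]/= addrC addKr expr0 divr1.
  have [g0 l0] := iterate_prop 0.
  apply: le_trans (prim_bound_exp (@F_path_continuous _ b x g0 l0) l_gt0 t0 (c := B) _) _.
    move=> s /andP[s0 _]; apply: le_trans (F_bound b x (g0 s)) _.
    rewrite ler_peMr ?(ltW B0)// -[leLHS]expR0 ler_expR.
    by rewrite mulr_ge0// ltW.
  by rewrite ler_wpM2l// gerBl.
have [g0 l0] := iterate_prop n; have [g1 l1] := iterate_prop n.+1.
have c0 := @F_path_continuous _ b x g0 l0; have c1 := @F_path_continuous _ b x g1 l1.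
have -> : iterate n.+2 t b x - iterate n.+1 t b x =
    prim (fun s => F (iterate n.+1 s) b x - F (iterate n s) b x) t.
  rewrite [iterate n.+2 t b x]/= [iterate n.+1 t b x]/= opprD addrACA subrr add0r.
  have := prim_iint (contB c1 c0) t0; rewrite prim0 subr0 => <-.
  by rewrite iintB// !prim_iint// !prim0 !subr0.
have cl s : 0 <= s <= t ->
    `|F (iterate n.+1 s) b x - F (iterate n s) b x| <= L * (c / 2%:R ^+ n) * expR (l * s).
  move=> /andP[s0 _]; rewrite -mulrA; apply: F_lip => //; exact: IH.
apply: le_trans (prim_bound_exp (contB c1 c0) l_gt0 t0 cl) _.
have -> : L * (c / 2%:R ^+ n) / l = c / 2%:R ^+ n.+1.
  rewrite /l exprS invfM -mulr_natl; field.
  by rewrite (gt_eqF L0) expf_neq0// mulr1 pnatr_eq0.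
by apply: ler_wpM2l; [rewrite divr_ge0 ?exprn_ge0|rewrite gerBl].
Qed.

(** The equation is recorded as a quadratic Taylor estimate between two times. It holds for every
    iterate, with L B a Lipschitz constant of the field along the path, and passes to the limit
    without exchanging limit and derivative. *)
Lemma picard : exists z : R -> state, [/\ z 0 = z0,
   forall t, 0 <= t -> good (z t),
   forall s t, 0 <= s -> 0 <= t -> uclose (B * `|t - s|) (z t) (z s)
 & forall s t b x, 0 <= s -> 0 <= t ->
    `|z t b x - z s b x - (t - s) * F (z s) b x| <= L * B * (t - s) ^+ 2].
Proof.
have lim t b x : exists y, 0 <= t ->
    forall n, `|iterate n t b x - y| <= (c * expR (l * t)) *+ 2 / 2%:R ^+ n.
  case: (leP 0 t) => t0; last by exists 0 => /=; lra.
  have [||y yP] := @geometric_limit (fun n => iterate n t b x) (c * expR (l * t)).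
  - by rewrite mulr_ge0// expR_ge0.
  - move=> n; rewrite mulrAC; exact: iterate_step.
  by exists y.
(* For t < 0 the condition is void and the value arbitrary, since the weighted estimate holds for t
   >= 0. *)
pose z t : state := fun b x => xget 0 [set y | 0 <= t ->
    forall n, `|iterate n t b x - y| <= (c * expR (l * t)) *+ 2 / 2%:R ^+ n].
have zP t b x : 0 <= t ->
    forall n, `|iterate n t b x - z t b x| <= (c * expR (l * t)) *+ 2 / 2%:R ^+ n.
  by have [y yP] := lim t b x; rewrite /z; case: xgetP => [w _|/(_ y)]; [exact|].
have approx t e : 0 <= t -> 0 < e -> exists N, forall n, (N <= n)%N ->
    uclose e (iterate n t) (z t).
  move=> t0 e0; pose D := (c * expR (l * t)) *+ 2.
  have D0 : 0 <= D by rewrite mulrn_wge0// mulr_ge0// expR_ge0.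
  exists (Num.truncn (D / e)).+1 => n nN b x; apply: le_trans (zP t b x t0 n) _.
  rewrite -/D ler_pdivrMr ?exprn_gt0// mulrC -ler_pdivrMr//.
  apply/ltW/(lt_le_trans (truncnS_gt _)); rewrite -natrX ler_nat.
  (* Here n <= 2^n turns the geometric rate into an explicit rank. *)
  by apply: leq_trans nN _; apply/ltnW/ltn_expl.
have zG t : 0 <= t -> good (z t).
  move=> t0 b; apply: CT_ulim => e e0; have [N NP] := approx t e t0 e0.
  exists (iterate N t b); first by have [+ _] := iterate_prop N; apply.
  by move=> x; rewrite distrC; exact: NP.
exists z; split.
- apply/funext => b; apply/funext => x; apply/eqP; rewrite -subr_eq0 -normr_le0.
  apply/ler_addgt0Pr => e e0; rewrite add0r; have [N NP] := approx 0 e (lexx _) e0.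
  have := NP N.+1 (leqnSn _) b x; rewrite /= prim0 addr0 distrC//.
- exact: zG.
- move=> s t s0 t0 b x; apply/ler_addgt0Pr => e e0; have e2 : 0 < e / 2%:R by lra.
  have [N NP] := approx s _ s0 e2; have [M MP] := approx t _ t0 e2.
  have := NP _ (leq_maxl N M) b x; have := MP _ (leq_maxr N M) b x.
  have [_ ln] := iterate_prop (maxn N M); have := ln s t b x.
  rewrite !ler_norml; lra.
- move=> s t b x s0 t0; apply/ler_addgt0Pr => e e0.
  (* The errors are e / k at time t, e / k at time s and |t - s| L e / k from the field; their sum
     is at most e. *)
  pose k : R := 3%:R + `|t - s| * L.
  have k0 : 0 < k.
    by have : 0 <= `|t - s| * L by [rewrite mulr_ge0// ltW]; rewrite /k; lra.
  have ek : 0 < e / k by rewrite divr_gt0.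
  have [N NP] := approx s _ s0 ek; have [M MP] := approx t _ t0 ek.
  set n := maxn N M.
  have nN : (N <= n)%N := leq_maxl N M; have nM : (M <= n)%N := leq_maxr N M.
  have H1 := NP _ nN; have H1' := NP _ (leqW nN) b x; have H2 := MP _ (leqW nM) b x.
  have [gn ln] := iterate_prop n.
  have H3 := F_lip (gn s) (zG s s0) H1 b x.
  have cF := @F_path_continuous _ b x gn ln.
  have H4 : `|iterate n.+1 t b x - iterate n.+1 s b x - (t - s) * F (iterate n s) b x|
      <= L * B * (t - s) ^+ 2.
    rewrite [iterate n.+1 t b x]/= [iterate n.+1 s b x]/= opprD addrACA subrr add0r.
    have := @taylor1 R (prim (fun s => F (iterate n s) b x)) (fun s => F (iterate n s) b x)
      (L * B) s (t - s); rewrite subrKC; apply.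
    + by move=> y; exact: is_derive_prim.
    + by move=> y y'; rewrite -mulrA; exact: F_lip.
    + by rewrite mulr_ge0// ltW.
  rewrite (_ : _ - _ - _ =
     (iterate n.+1 t b x - iterate n.+1 s b x - (t - s) * F (iterate n s) b x)
     - (iterate n.+1 t b x - z t b x) + (iterate n.+1 s b x - z s b x)
     + (t - s) * (F (iterate n s) b x - F (z s) b x)); last by ring.
  have H5 : `|(t - s) * (F (iterate n s) b x - F (z s) b x)| <= `|t - s| * (L * (e / k)).
    by rewrite normrM ler_wpM2l.
  have H6 : e / k * 2%:R + `|t - s| * (L * (e / k)) <= e.
    apply: (@le_trans _ _ (e / k * k)); last by rewrite divfK// gt_eqF.
    by rewrite /k [X in _ <= X]mulrDr; lra.
  apply: le_trans (ler_normD _ _) _.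
  apply: le_trans (lerD (ler_normD _ _) (lexx _)) _.
  apply: le_trans (lerD (lerD (ler_normB _ _) (lexx _)) (lexx _)) _.
  lra.
Qed.


(** Gronwall's inequality through [barrier]: for each e > 0 the two differences of sign, in both
    components, stay below e e^((L + 1) t). The excess of L + 1 over the Lipschitz constant is the
    margin eta, and lam = 0 suffices. *)
Lemma ode_unique T (z w z' w' : R -> state) :
  (forall t, 0 <= t < T -> good (z t) /\ good (w t)) ->
  (forall b, uderiv T (fun t => z t b) (fun t => z' t b)) ->
  (forall b, uderiv T (fun t => w t b) (fun t => w' t b)) ->
  (forall t, 0 <= t < T -> z' t = F (z t) /\ w' t = F (w t)) -> z 0 = w 0 ->
  forall t, 0 <= t < T -> z t = w t.
Proof.
move=> gzw dz dw z'F zw0 t1 t1T.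
apply/funext => b1; apply/funext => x1; apply/eqP; rewrite -subr_eq0 -normr_le0.
pose k := L + 1.
suff main e : 0 < e -> `|z t1 b1 x1 - w t1 b1 x1| <= e * expR (k * t1).
  apply/ler_addgt0Pr => e e0; rewrite add0r.
  have := main (e / expR (k * t1)); rewrite divfK ?gt_eqF ?expR_gt0//; apply.
  by rewrite divr_gt0 ?expR_gt0.
move=> e0; 
have de t : is_derive t 1 (fun s => - (e * expR (k * s))) (- (e * k * expR (k * t))).
  have H : is_derive t 1 (k \*: (@id R)) (k *: (1:R)) by exact: is_deriveZ.
  have H2 : is_derive t 1 (expR \o (k \*: (@id R))) (expR (k * t) * (k *: (1:R))).
    by apply: is_derive1_comp; exact: is_derive_expR.
  have H3 := is_deriveZ (- e) H2.
  have -> : (fun s => - (e * expR (k * s))) = (- e) \*: (expR \o k \*: id).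
    by apply/funext => s; rewrite -mulNr.
  by apply: is_derive_eq H3 _; rewrite /GRing.scale/= mulr1; ring.
have dE := @uderiv_t R R T _ _ de.
have db b := uderiv_sum (uderivD (uderivD (dz b) (uderivN (dw b))) dE)
   (uderivD (uderivD (dw b) (uderivN (dz b))) dE).
have sgn t b x : z t b x - w t b x + - (e * expR (k * t)) <= 0 ->
    w t b x - z t b x + - (e * expR (k * t)) <= 0 ->
    `|z t b x - w t b x| <= e * expR (k * t) by rewrite ler_norml; lra.
have init (b : bool) x : z 0 b x - w 0 b x + - (e * expR (k * 0)) <= 0 /\
    w 0 b x - z 0 b x + - (e * expR (k * 0)) <= 0.
  by rewrite zw0 subrr add0r oppr_le0 mulr_ge0 ?expR_ge0// ltW.
have H := barrier (uderiv_sum (db true) (db false)) _ _ t1T.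
lapply H; last by move=> [[x|x]|[x|x]];
  [have [] := init true x|have [] := init true x|have [] := init false x|have [] := init false x].
move=> {}H; lapply H => [{}H|].
  by case: b1; apply: sgn; [exact: (H (inl (inl x1)))|exact: (H (inl (inr x1)))|
    exact: (H (inr (inl x1)))|exact: (H (inr (inr x1)))].
move=> t tT Ht.
have cl : uclose (e * expR (k * t)) (z t) (w t).
  by case=> x; apply: sgn; [exact: (Ht (inl (inl x)))|exact: (Ht (inl (inr x)))|
    exact: (Ht (inr (inl x)))|exact: (Ht (inr (inr x)))].
exists 0, (e * expR (k * t)); split=> //; first by rewrite mulr_gt0 ?expR_gt0.
have [gz gw] := gzw t tT; have [Ez Ew] := z'F t tT.
have FL b x : - (L * (e * expR (k * t))) <= z' t b x - w' t b x <= L * (e * expR (k * t)).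
  by rewrite Ez Ew -ler_norml; exact: F_lip cl b x.
have kE : e * k * expR (k * t) = L * (e * expR (k * t)) + e * expR (k * t).
  by rewrite {1}/k; ring.
move=> [[x|x]|[x|x]]; rewrite kE oppr0 mul0r.
- have := FL true x; lra.
- have := FL true x; lra.
- have := FL false x; lra.
- have := FL false x; lra.
Qed.

End picard.

(** * The transport operator: sign, size and conservation *)

Section transport.
Variables (R : realType) (eps : R).
Hypothesis eps0 : 0 < eps.
Implicit Types (f u rho m : R -> R) (x b c t C M : R).

Lemma funrpos_CT u : CT u -> CT u^\+.
Proof. by move=> Cu; apply: CT_max => //; exact: CT_cst. Qed.

Lemma funrneg_CT u : CT u -> CT u^\-.
Proof.
move=> Cu; apply: CT_max; last exact: CT_cst.
by rewrite (_ : (fun x => _) = (fun x => -1 * u x));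
  [exact: CT_Z|apply/funext => x; rewrite mulN1r].
Qed.

Lemma funrpos_ge0 u x : 0 <= u^\+ x. Proof. by rewrite /funrpos le_max lexx orbT. Qed.
Lemma funrneg_ge0 u x : 0 <= u^\- x. Proof. by rewrite /funrneg le_max lexx orbT. Qed.

Lemma normr_posneg u x : `|u x| = u^\+ x + u^\- x.
Proof.
rewrite /funrpos /funrneg; case: (leP 0 (u x)) => u0.
  have n0 : - u x <= 0 by rewrite oppr_le0.
  by rewrite (ger0_norm u0) (max_r n0) addr0.
have n0 : 0 <= - u x by rewrite oppr_ge0 ltW.
by rewrite (ltr0_norm u0) (max_l n0) add0r.
Qed.

Lemma posnegE u x : u x = u^\+ x - u^\- x.
Proof.
rewrite /funrpos /funrneg; case: (leP 0 (u x)) => u0.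
  have n0 : - u x <= 0 by rewrite oppr_le0.
  by rewrite (max_r n0) subr0.
have n0 : 0 <= - u x by rewrite oppr_ge0 ltW.
by rewrite (max_l n0) sub0r opprK.
Qed.

Lemma funrpos_le u x : u^\+ x <= `|u x|.
Proof. by rewrite normr_posneg lerDl funrneg_ge0. Qed.

Lemma funrneg_le u x : u^\- x <= `|u x|.
Proof. by rewrite normr_posneg lerDr funrpos_ge0. Qed.

Lemma transport_CT f u : CT f -> CT u -> CT (transport eps f u).
Proof.
move=> Cf Cu; have Cp := CT_M Cf (funrpos_CT Cu); have Cn := CT_M Cf (funrneg_CT Cu).
have C0 := CT_M Cf (CT_norm Cu).
exact: (CT_Z eps^-1 (CT_D (CT_B (CT_shift (- eps) Cp) C0) (CT_shift eps Cn))).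
Qed.

(** The mass is invariant under shifts, so the two inflows balance the outflow f |u| = f u^+ + f
    u^-. *)
Lemma mass_transport f u : CT f -> CT u -> mass (transport eps f u) = 0.
Proof.
move=> Cf Cu; have Cp := CT_M Cf (funrpos_CT Cu); have Cn := CT_M Cf (funrneg_CT Cu).
have C0 := CT_M Cf (CT_norm Cu).
have Sp := CT_shift (- eps) Cp; have Sn := CT_shift eps Cn.
rewrite /mass /transport iintZ; last by case: (CT_D (CT_B Sp C0) Sn).
rewrite iintD; [|by case: (CT_B Sp C0)|by case: Sn].
rewrite iintB; [|by case: Sp|by case: C0].
have := mass_shift (- eps) Cp; rewrite /mass => ->.
have := mass_shift eps Cn; rewrite /mass => ->.
rewrite (_ : (fun x => f x * `|u x|) = fun x => f x * u^\+ x + f x * u^\- x); last first.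
  by apply/funext => x; rewrite normr_posneg mulrDr.
rewrite iintD; [|by case: Cp|by case: Cn]; ring.
Qed.

(** Both inflow terms have the sign of f. Dropping them leaves the outflow, which has the form - lam
    f of the rate condition in [barrier]. *)
Lemma transport_le f u x : (forall y, f y <= 0) ->
  transport eps f u x <= - (eps^-1 * `|u x|) * f x.
Proof.
move=> f0; rewrite mulNr -mulrA -mulrN ler_pM2l ?invr_gt0// mulrC.
have := mulr_le0_ge0 (f0 (x - eps)) (funrpos_ge0 u (x - eps)).
have := mulr_le0_ge0 (f0 (x + eps)) (funrneg_ge0 u (x + eps)); lra.
Qed.

Lemma transport_ge f u x : (forall y, 0 <= f y) ->
  - (eps^-1 * `|u x|) * f x <= transport eps f u x.
Proof.
move=> f0; rewrite mulNr -mulrA -mulrN ler_pM2l ?invr_gt0// mulrC.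
have := mulr_ge0 (f0 (x - eps)) (funrpos_ge0 u (x - eps)).
have := mulr_ge0 (f0 (x + eps)) (funrneg_ge0 u (x + eps)); lra.
Qed.

Lemma transport_ub f u x C M : (forall y, 0 <= f y <= C) -> (forall y, `|u y| <= M) ->
  transport eps f u x <= eps^-1 * (C * M *+ 2).
Proof.
move=> f0 uM; rewrite ler_pM2l ?invr_gt0// mulr2n.
have f0' y : 0 <= f y by case/andP: (f0 y).
have fC y : f y <= C by case/andP: (f0 y).
have H1 : f (x - eps) * u^\+ (x - eps) <= C * M.
  by rewrite ler_pM// ?funrpos_ge0// (le_trans (funrpos_le _ _)).
have H2 : f (x + eps) * u^\- (x + eps) <= C * M.
  by rewrite ler_pM// ?funrneg_ge0// (le_trans (funrneg_le _ _)).
have := mulr_ge0 (f0' x) (normr_ge0 (u x)); lra.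
Qed.

Lemma velocity_CT rho m : CT rho -> CT m -> (forall x, 0 < rho x) -> CT (velocity rho m).
Proof.
move=> Cr Cm r0; apply: CT_M => //; apply: CT_V => // x.
by rewrite gt_eqF.
Qed.

(** Uniformity in x lets the derivative pass through the integral over a period. *)
Lemma uderiv_mass T (w w' : R -> R -> R) :
  (forall t, 0 <= t < T -> CT (w t)) -> (forall t, 0 <= t < T -> CT (w' t)) ->
  uderiv T w w' -> uderiv T (fun t (_ : unit) => mass (w t)) (fun t _ => mass (w' t)).
Proof.
move=> Cw Cw' dw t tT e e0; have P0 := @period_gt0 R.
have eP : 0 < e / (pi *+ 2) by rewrite divr_gt0.
have [d d0 dP] := dw t tT _ eP; exists d => // h hd hT _.
have C1 := Cw _ hT; have C2 := Cw _ tT; have C3 := Cw' _ tT.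
have -> : mass (w (t + h)) - mass (w t) - h * mass (w' t) =
    mass (fun x => w (t + h) x - w t x - h * w' t x).
  have C4 := CT_B C1 C2; have C5 := CT_Z h C3.
  rewrite /mass (iintB _ _ (proj1 C4) (proj1 C5)).
  by rewrite (iintB _ _ (proj1 C1) (proj1 C2)) (iintZ _ _ _ (proj1 C3)).
have C6 := CT_B (CT_B C1 C2) (CT_Z h C3).
apply: le_trans (mass_bound C6 (dP h hd hT)) _.
by rewrite mulrAC divfK// gt_eqF.
Qed.

End transport.

(** * A priori bounds: the box and its invariance *)

Section a_priori.
Variables (R : realType) (g : R) (a phi : R -> R) (alpha eps q A : R).
Implicit Types (rho m : R -> R) (x t : R).
Hypotheses (eps0 : 0 < eps) (q0 : 0 <= q) (A0 : 0 <= A).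
Let force rho := derive1 (potential g a phi alpha eps rho).
Hypothesis force_bound : forall rho x, CT rho ->
  `|force rho x| <= q * mass (fun y => `|rho y|) + A.

Variables (T rmin rmax U M0 : R).
Hypotheses (T0 : 0 < T) (rmin0 : 0 < rmin) (rmax0 : 0 < rmax) (U0 : 0 <= U) (M00 : 0 <= M0).

(* The total mass is conserved and starts below M0.  The slack t in the mass
   bound, the summand 1 in the growth rate of speed and those in the exponents
   below make every bound strict in the sense of the lemma barrier. *)
Definition force_max : R := q * (M0 + T) + A.
Definition speed t : R := U + (force_max + 1) * t.
Definition rho_lo t : R := rmin * expR (- (speed T / eps + 1) * t).
Definition rho_hi t : R := rmax * expR ((speed T *+ 2 / eps + 1) * t).

Definition box t rho m : Prop :=
  [/\ forall x, rho_lo t <= rho x, forall x, rho x <= rho_hi t,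
      forall x, `|m x| <= speed t * rho x & mass rho <= M0 + t].

Lemma force_max_ge0 : 0 <= force_max.
Proof. by rewrite /force_max addr_ge0// mulr_ge0// addr_ge0// ltW. Qed.

Lemma speed_ge0 t : 0 <= t -> 0 <= speed t.
Proof.
by move=> t0; rewrite /speed addr_ge0// mulr_ge0// addr_ge0// force_max_ge0.
Qed.

Lemma speed_le t : t <= T -> speed t <= speed T.
Proof.
by move=> tT; rewrite /speed lerD2l ler_wpM2l// addr_ge0// force_max_ge0.
Qed.

Lemma rho_lo_gt0 t : 0 < rho_lo t.
Proof. by rewrite mulr_gt0// expR_gt0. Qed.

Lemma rho_lo0 : rho_lo 0 = rmin.
Proof. by rewrite /rho_lo mulr0 expR0 mulr1. Qed.

Lemma rho_hi0 : rho_hi 0 = rmax.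
Proof. by rewrite /rho_hi mulr0 expR0 mulr1. Qed.

Lemma speed0 : speed 0 = U.
Proof. by rewrite /speed mulr0 addr0. Qed.

Lemma is_derive_exp_scaled (c k t : R) :
  is_derive t 1 (fun s => c * expR (k * s)) (k * (c * expR (k * t))).
Proof.
have H : is_derive t 1 (k \*: (@id R)) (k *: (1:R)) by exact: is_deriveZ.
have H2 : is_derive t 1 (expR \o (k \*: (@id R))) (expR (k * t) * (k *: (1:R))).
  by apply: is_derive1_comp; exact: is_derive_expR.
apply: is_derive_eq (is_deriveZ c H2) _.
by rewrite /GRing.scale/= mulr1; ring.
Qed.

Lemma is_derive_affine (c k t : R) : is_derive t 1 (fun s => c + k * s) k.
Proof.
have H : is_derive t 1 (k \*: (@id R)) (k *: (1:R)) by exact: is_deriveZ.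
apply: is_derive_eq (is_deriveD (is_derive_cst c t 1) H) _.
by rewrite /GRing.scale/= mulr1 add0r.
Qed.

Section box_estimates.
Variables (t : R) (rho m : R -> R).
Hypotheses (tT : 0 <= t <= T) (Crho : CT rho) (Cm : CT m) (rmbox : box t rho m).
Let u := velocity rho m.

Lemma box_rho_gt0 x : 0 < rho x.
Proof. by case: rmbox => lo _ _ _; apply: lt_le_trans (lo x); exact: rho_lo_gt0. Qed.

Lemma box_velocity x : `|u x| <= speed t.
Proof.
have r0 := box_rho_gt0 x.
case: rmbox => _ _ + _ => /(_ x) mx.
by rewrite /u /velocity normrM normfV (gtr0_norm r0) ler_pdivrMr.
Qed.

Lemma box_speed x : eps^-1 * `|u x| <= speed T / eps.
Proof.
rewrite mulrC ler_pM2r ?invr_gt0//; apply: le_trans (box_velocity x) (speed_le _).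
by case/andP: tT.
Qed.

Lemma box_force x : `|force rho x| <= force_max.
Proof.
apply: le_trans (force_bound x Crho) _; rewrite /force_max lerD2r ler_wpM2l//.
case: rmbox => _ _ _ mr; rewrite (_ : (fun y => `|rho y|) = rho).
  by apply: le_trans mr _; rewrite lerD2l; case/andP: tT.
by apply/funext => y; rewrite gtr0_norm// box_rho_gt0.
Qed.

Lemma box_mass_rhs_ge x : - (speed T / eps) * rho x <= mass_rhs eps rho m x.
Proof.
have r0 y : 0 <= rho y by rewrite ltW// box_rho_gt0.
apply: le_trans (transport_ge eps0 u x r0).
by rewrite ler_wpM2r// lerN2 box_speed.
Qed.

Lemma box_mass_rhs_le x : mass_rhs eps rho m x <= (speed T *+ 2 / eps) * rho_hi t.
Proof.
have r0 y : 0 <= rho y <= rho_hi t.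
  by rewrite ltW ?box_rho_gt0//=; case: rmbox.
have uM y : `|u y| <= speed T.
  by apply: le_trans (box_velocity y) (speed_le _); case/andP: tT.
apply: le_trans (transport_ub eps0 x r0 uM) _.
by rewrite (_ : eps^-1 * _ = speed T *+ 2 / eps * rho_hi t)//; ring.
Qed.

(** For a frozen velocity [transport] is linear in f, so the nonpositive s m - speed t rho is
    transported as a whole and [transport_le] applies. The force costs at most force_max rho, and
    the growth rate force_max + 1 of the speed leaves the margin rho. The two values of s treat both
    signs of m. *)
Lemma box_momentum_rhs (s : R) x : `|s| = 1 ->
  s * momentum_rhs g a phi alpha eps rho m x - (speed t * mass_rhs eps rho m x +
    (force_max + 1) * rho x)
  <= - (speed T / eps) * (s * m x - speed t * rho x) - rho x.
Proof.
move=> s1; have r0 := box_rho_gt0 x.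
pose z y := s * m y - speed t * rho y.
have z0 y : z y <= 0.
  rewrite subr_le0; apply: le_trans (ler_norm _) _; rewrite normrM s1 mul1r.
  by case: rmbox.
have zE : transport eps z u x = s * transport eps m u x - speed t * transport eps rho u x.
  by rewrite /transport /z; ring.
have fE : - (s * (rho x * force rho x)) <= rho x * force_max.
  apply: le_trans (ler_norm _) _; rewrite normrN normrM s1 mul1r normrM (gtr0_norm r0).
  by rewrite ler_pM2l// box_force.
have := transport_le eps0 u x z0.
have : - (eps^-1 * `|u x|) * z x <= - (speed T / eps) * z x.
  by apply: (ler_wnM2r (z0 x)); rewrite lerN2; exact: box_speed.
rewrite zE -/(z x) /momentum_rhs /mass_rhs -/u -/(force rho); lra.
Qed.

End box_estimates.

(* The right-hand sides need to be the true ones only inside the box: the lemma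
   thus applies to the truncated system as well. *)
Lemma a_priori (rho m rho' m' : R -> R -> R) :
  (forall t, 0 <= t < T -> CT (rho t) /\ CT (m t)) ->
  (forall t, 0 <= t < T -> CT (rho' t)) ->
  uderiv T rho rho' -> uderiv T m m' ->
  (forall t, 0 <= t < T -> box t (rho t) (m t) ->
    rho' t = mass_rhs eps (rho t) (m t) /\
    m' t = momentum_rhs g a phi alpha eps (rho t) (m t)) ->
  box 0 (rho 0) (m 0) -> forall t, 0 <= t < T -> box t (rho t) (m t).
Proof.
move=> Crm Cr' dr dm rhs box0 t1 t1T.
have br t : 0 <= t < T -> exists C : R, forall x, `|rho t x| <= C.
  by move=> /Crm[/CT_bounded[C _ CP] _]; exists C.
have dlo := @uderiv_t R R T _ _ (is_derive_exp_scaled rmin (- (speed T / eps + 1))).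
have dhi := @uderiv_t R R T _ _ (is_derive_exp_scaled rmax (speed T *+ 2 / eps + 1)).
have dsp := uderivM_t br (is_derive_affine U (force_max + 1)) dr.
have dma := uderivD (uderiv_mass (fun t tT => proj1 (Crm t tT)) Cr' dr)
  (uderivN (@uderiv_t R unit T _ _ (is_derive_affine M0 1))).
have d1 := uderivD dlo (uderivN dr).
have d2 := uderivD dr (uderivN dhi).
have d3 := uderivD dm (uderivN dsp).
have d4 := uderivD (uderivN dm) (uderivN dsp).
(* All five inequalities of the box form one family: each rate estimate uses the others at the same
   time. *)
have H := barrier (uderiv_sum (uderiv_sum (uderiv_sum d1 d2) (uderiv_sum d3 d4)) dma) _ _ t1T.
lapply H; last first.
  case: box0 => lo hi sp ma.
  move=> [[[x|x]|[x|x]]|[]].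
  - by have := lo x; rewrite /rho_lo; lra.
  - by have := hi x; rewrite /rho_hi; lra.
  - by have := sp x; rewrite /speed ler_norml; lra.
  - by have := sp x; rewrite /speed ler_norml; lra.
  - by rewrite mul1r; lra.
have mkbox t : (forall x, rho_lo t + - rho t x <= 0) -> (forall x, rho t x + - rho_hi t <= 0) ->
    (forall x, m t x + - (speed t * rho t x) <= 0) ->
    (forall x, - m t x + - (speed t * rho t x) <= 0) ->
    mass (rho t) + - (M0 + 1 * t) <= 0 -> box t (rho t) (m t).
  move=> h1 h2 h3 h4 h5; split.
  - by move=> x; have := h1 x; lra.
  - by move=> x; have := h2 x; lra.
  - by move=> x; rewrite ler_norml; have := h3 x; have := h4 x; lra.
  - by move: h5; rewrite mul1r; lra.
move=> {}H; lapply H => [{}H|{H}].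
  apply: mkbox => [x|x|x|x|].
  - exact: (H (inl (inl (inl x)))).
  - exact: (H (inl (inl (inr x)))).
  - exact: (H (inl (inr (inl x)))).
  - exact: (H (inl (inr (inr x)))).
  - exact: (H (inr tt)).
move=> t tT Ht.
have bt : box t (rho t) (m t).
  apply: mkbox => [x|x|x|x|].
  - exact: (Ht (inl (inl (inl x)))).
  - exact: (Ht (inl (inl (inr x)))).
  - exact: (Ht (inl (inr (inl x)))).
  - exact: (Ht (inl (inr (inr x)))).
  - exact: (Ht (inr tt)).
have [Cr Cm] := Crm t tT; have tT' : 0 <= t <= T by lra.
have [-> ->] := rhs t tT bt.
(* lam dominates the outflow rate |u| / eps in the box. The margin is at least rho_lo t in the four
   pointwise inequalities, and equals the growth rate 1 of M0 + t in the one on the mass. *)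
exists (speed T / eps), (Num.min (rho_lo t) 1).
have lam0 : 0 <= speed T / eps by rewrite divr_ge0 ?speed_ge0 ?ltW.
split => //; first by rewrite lt_min rho_lo_gt0 ltr01.
have eta1 : Num.min (rho_lo t) 1 <= rho_lo t by rewrite ge_min lexx.
have eta2 : Num.min (rho_lo t) 1 <= 1 by rewrite ge_min lexx orbT.
have [lo hi _ _] := bt.
move=> [[[x|x]|[x|x]]|[]].
- have := box_mass_rhs_ge tT' bt x; have := lo x.
  rewrite -/(rho_lo t); lra.
- have := box_mass_rhs_le tT' bt x; have := lo x; have hx := hi x.
  have : 0 <= - (speed T / eps) * (rho t x - rho_hi t).
    by rewrite mulr_le0 ?oppr_le0// subr_le0.
  rewrite -/(rho_hi t); lra.
- have := box_momentum_rhs tT' Cr bt x (normr1 R); have := lo x.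
  rewrite !mul1r -/(speed t); lra.
- have := @box_momentum_rhs t _ _ tT' Cr bt (-1) x (normrN1 R); have := lo x.
  rewrite !mulN1r -/(speed t); lra.
- have r0 := box_rho_gt0 bt.
  rewrite mass_transport//; last exact: velocity_CT.
  have : 0 <= - (speed T / eps) * (mass (rho t) - (M0 + 1 * t)).
    by rewrite mulr_le0 ?oppr_le0//; exact: (Ht (inr tt)).
  lra.
Qed.

End a_priori.

(** * An algebra of bounded Lipschitz functionals of the state *)

Section bounded_lipschitz.
Variable R : realType.
Implicit Types (c d e x y : R) (f h : state R -> R -> R) (z w : state R).

Definition clamp (lo hi y : R) : R := Num.max lo (Num.min hi y).

Lemma clamp_id (lo hi y : R) : lo <= y <= hi -> clamp lo hi y = y.
Proof. by move=> /andP[ly yh]; rewrite /clamp (min_r yh) (max_r ly). Qed.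

Lemma clamp_itv (lo hi y : R) : lo <= hi -> lo <= clamp lo hi y <= hi.
Proof.
move=> lh; rewrite /clamp le_max lexx/= ge_max lh/=.
by rewrite ge_min lexx.
Qed.

Lemma clamp_lip (lo hi x y : R) : `|clamp lo hi x - clamp lo hi y| <= `|x - y|.
Proof.
have nxy : - `|x - y| <= x - y <= `|x - y| by rewrite -ler_norml.
have minE : `|Num.min hi x - Num.min hi y| <= `|x - y|.
  by rewrite ler_norml; case: (leP hi x) => ?; case: (leP hi y) => ?; lra.
rewrite /clamp; apply: le_trans minE.
set u := Num.min hi x; set v := Num.min hi y.
have nuv : - `|u - v| <= u - v <= `|u - v| by rewrite -ler_norml.
by rewrite ler_norml; case: (leP lo u) => ?; case: (leP lo v) => ?; lra.
Qed.

(** Boundedness accompanies the Lipschitz property because it makes the class stable under products.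
    The value at x may depend on the whole state, as shifts and the force require. *)
Definition bounded_lip f := exists2 C : R, 0 < C &
  (forall z x, good z -> `|f z x| <= C) /\
  (forall d z w, good z -> good w -> uclose d z w -> forall x, `|f z x - f w x| <= C * d).

Lemma uclose_ge0 d z w : uclose d z w -> 0 <= d.
Proof. by move=> /(_ true 0); exact: le_trans. Qed.

Lemma bounded_lip_cst c : bounded_lip (fun _ _ => c).
Proof.
exists (`|c| + 1); first by rewrite ltr_wpDl.
split=> [z x _|d z w _ _ /uclose_ge0 d0 x]; first by rewrite lerDl.
by rewrite subrr normr0 mulr_ge0// addr_ge0.
Qed.

Lemma bounded_lipM f h : bounded_lip f -> bounded_lip h ->
  bounded_lip (fun z x => f z x * h z x).
Proof.
move=> [C C0 [fC fL]] [D D0 [hD hL]]; exists (C * D *+ 2); first by rewrite mulrn_wgt0// mulr_gt0.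
split=> [z x gz|d z w gz gw zw x].
  apply: (@le_trans _ _ (C * D)); first by rewrite normrM ler_pM ?fC ?hD.
  by rewrite mulr2n lerDl mulr_ge0// ltW.
rewrite (_ : _ - _ = f z x * (h z x - h w x) + (f z x - f w x) * h w x); last by ring.
apply: le_trans (ler_normD _ _) _; rewrite !normrM.
have H1 : `|f z x| * `|h z x - h w x| <= C * (D * d).
  by rewrite ler_pM ?fC ?hL.
have H2 : `|f z x - f w x| * `|h w x| <= C * d * D.
  by rewrite ler_pM ?fL ?hD.
rewrite mulr2n; lra.
Qed.

Lemma bounded_lipD f h : bounded_lip f -> bounded_lip h ->
  bounded_lip (fun z x => f z x + h z x).
Proof.
move=> [C C0 [fC fL]] [D D0 [hD hL]]; exists (C + D); first exact: addr_gt0.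
split=> [z x gz|d z w gz gw zw x].
  by apply: le_trans (ler_normD _ _) _; rewrite lerD ?fC ?hD.
rewrite opprD addrACA mulrDl.
by apply: le_trans (ler_normD _ _) _; rewrite lerD ?fL ?hL.
Qed.

Lemma bounded_lip_comp (k : R -> R) f : (forall x y, `|k x - k y| <= `|x - y|) ->
  bounded_lip f -> bounded_lip (fun z x => k (f z x)).
Proof.
move=> kL [C C0 [fC fL]]; exists (`|k 0| + C); first by rewrite ltr_wpDl.
split=> [z x gz|d z w gz gw zw x].
  have := kL (f z x) 0; rewrite subr0 => H; have := fC z x gz.
  have := ler_normD (k (f z x) - k 0) (k 0); rewrite subrK; lra.
apply: le_trans (kL _ _) _; apply: le_trans (fL d z w gz gw zw x) _.
by rewrite ler_wpM2r ?(uclose_ge0 zw)// lerDr.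
Qed.

Lemma bounded_lipN f : bounded_lip f -> bounded_lip (fun z x => - f z x).
Proof. by apply: bounded_lip_comp => x y; rewrite -opprD normrN. Qed.

Lemma bounded_lip_shift c f : bounded_lip f -> bounded_lip (fun z x => f z (x + c)).
Proof.
move=> [C C0 [fC fL]]; exists C => //.
by split=> [z x gz|d z w gz gw zw x]; [exact: fC|exact: fL].
Qed.

Lemma bounded_lip_clamp (lo hi : R) b : lo <= hi ->
  bounded_lip (fun z x => clamp lo hi (z b x)).
Proof.
move=> lh; exists (`|lo| + `|hi| + 1); first by rewrite ltr_wpDl// addr_ge0.
split=> [z x gz|d z w gz gw zw x].
  have := clamp_itv (z b x) lh; rewrite ler_norml.
  have := ler_norm hi; have := ler_norm (- lo); rewrite normrN.
  have := normr_ge0 lo; have := normr_ge0 hi; lra.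
apply: le_trans (clamp_lip _ _ _ _) _; apply: le_trans (zw b x) _.
by rewrite ler_peMl ?(uclose_ge0 zw)// lerDr addr_ge0.
Qed.

Lemma bounded_lipV e f : 0 < e -> (forall z x, e <= f z x) -> bounded_lip f ->
  bounded_lip (fun z x => (f z x)^-1).
Proof.
move=> e0 ef [C C0 [fC fL]]; have f0 z x : 0 < f z x by exact: lt_le_trans (ef z x).
have fV z x : (f z x)^-1 <= e^-1 by rewrite lef_pV2 ?posrE.
have fV0 z x : 0 <= (f z x)^-1 by rewrite invr_ge0 ltW.
exists (e^-1 + C * e^-1 ^+ 2); first by rewrite addr_gt0// ?mulr_gt0// ?exprn_gt0// invr_gt0.
have e20 : 0 <= e^-1 ^+ 2 by rewrite sqr_ge0.
split=> [z x gz|d z w gz gw zw x].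
  rewrite ger0_norm//; apply: le_trans (fV z x) _.
  by rewrite lerDl mulr_ge0// ltW.
have d0 := uclose_ge0 zw.
have -> : (f z x)^-1 - (f w x)^-1 = (f w x - f z x) * ((f z x)^-1 * (f w x)^-1).
  by field; rewrite !gt_eqF.
rewrite normrM distrC (ger0_norm (mulr_ge0 (fV0 z x) (fV0 w x))) mulrDl.
apply: (@le_trans _ _ (C * d * (e^-1 * e^-1))).
  apply: ler_pM => //; [exact: mulr_ge0|exact: fL|exact: ler_pM].
rewrite mulrAC expr2 lerDr mulr_ge0// invr_ge0 ltW//.
Qed.

Lemma bounded_lip_transport (eps : R) f h : bounded_lip f -> bounded_lip h ->
  bounded_lip (fun z => transport eps (f z) (h z)).
Proof.
move=> bf bh.
have max_lip x y : `|Num.max x 0 - Num.max y 0| <= `|x - y|.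
  have := ler_norm (x - y); have := ler_norm (y - x); rewrite (distrC y).
  have := normr_ge0 (x - y); rewrite ler_norml.
  by case: (leP x 0); case: (leP y 0); lra.
have bp := bounded_lip_comp max_lip bh.
have bn := bounded_lip_comp max_lip (bounded_lipN bh).
have ba := bounded_lip_comp (fun x y => ler_dist_dist x y) bh.
apply: bounded_lipM; first exact: bounded_lip_cst.
apply: bounded_lipD; last exact: bounded_lip_shift (bounded_lipM bf bn).
apply: bounded_lipD; first exact: bounded_lip_shift (bounded_lipM bf bp).
by apply: bounded_lipN; exact: bounded_lipM.
Qed.

End bounded_lipschitz.

(** * The clamped field *)

Section truncated_system.
Variables (R : realType) (g : R) (a phi : R -> R) (alpha eps q A : R).
Implicit Types (rho m : R -> R) (x t : R) (z w : state R).
Hypotheses (eps0 : 0 < eps) (q0 : 0 <= q) (A0 : 0 <= A).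
Let force rho := derive1 (potential g a phi alpha eps rho).
Hypothesis force_CT : forall rho, CT rho -> CT (force rho).
Hypothesis force_bound : forall rho x, CT rho ->
  `|force rho x| <= q * mass (fun y => `|rho y|) + A.
Hypothesis force_lip : forall rho rho' x, CT rho -> CT rho' ->
  `|force rho x - force rho' x| <= q * mass (fun y => `|rho y - rho' y|).

Section truncation.
Variables (T rmin rmax U M0 : R).
Hypotheses (T0 : 0 < T) (rmin0 : 0 < rmin) (rmax0 : 0 < rmax) (rminmax : rmin <= rmax).
Hypotheses (U0 : 0 <= U) (M00 : 0 <= M0).

Notation speed := (speed q A T U M0).
Notation rho_lo := (rho_lo eps q A T rmin U M0).
Notation rho_hi := (rho_hi eps q A T rmax U M0).
Notation box := (box eps q A T rmin rmax U M0).

(** The clamps use the box at the final time, which contains those of earlier times, so the field is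
    autonomous. m is clamped before the division so that m / rho is a product of bounded Lipschitz
    functionals; no clamp acts on a state in the box. *)
Definition trunc_rho z x := clamp (rho_lo T) (rho_hi T) (z true x).
Definition trunc_m z x :=
  clamp (- (speed T * rho_hi T)) (speed T * rho_hi T) (z false x).
Definition trunc_u z x := clamp (- speed T) (speed T) (trunc_m z x / trunc_rho z x).
Definition trunc_field z : state R := fun b =>
  if b then transport eps (trunc_rho z) (trunc_u z)
  else fun x => transport eps (fun y => trunc_rho z y * trunc_u z y) (trunc_u z) x
    - trunc_rho z x * force (trunc_rho z) x.

Let lo0 : 0 < rho_lo T. Proof. exact: rho_lo_gt0. Qed.
Let sp0 : 0 <= speed T. Proof. by apply: speed_ge0 => //; exact: ltW. Qed.

Lemma rho_lo_le t : t <= T -> rho_lo T <= rho_lo t.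
Proof.
move=> tT; rewrite ler_wpM2l ?(ltW rmin0)// ler_expR !mulNr lerN2 ler_wpM2l//.
by rewrite addr_ge0// divr_ge0// ltW.
Qed.

Lemma rho_hi_le t : t <= T -> rho_hi t <= rho_hi T.
Proof.
move=> tT; rewrite ler_wpM2l ?(ltW rmax0)// ler_expR ler_wpM2l//.
by rewrite addr_ge0// divr_ge0 ?mulrn_wge0// ltW.
Qed.

Let lohi : rho_lo T <= rho_hi T.
Proof.
apply: (@le_trans _ _ (rho_lo 0)); first by apply: rho_lo_le; exact: ltW.
apply: (@le_trans _ _ (rho_hi 0)); last by apply: rho_hi_le; exact: ltW.
by rewrite rho_lo0 rho_hi0.
Qed.

Lemma trunc_rho_itv z x : rho_lo T <= trunc_rho z x <= rho_hi T.
Proof. exact: clamp_itv. Qed.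

Lemma trunc_rho_gt0 z x : 0 < trunc_rho z x.
Proof. by have /andP[+ _] := trunc_rho_itv z x; exact: lt_le_trans. Qed.

Lemma clamp_CT (lo hi : R) (f : R -> R) : CT f -> CT (fun x => clamp lo hi (f x)).
Proof.
move=> Cf; apply: CT_max; first exact: CT_cst.
by apply: CT_min => //; exact: CT_cst.
Qed.

Lemma trunc_rho_CT z : good z -> CT (trunc_rho z).
Proof. by move=> gz; apply: clamp_CT; exact: gz. Qed.

Lemma trunc_u_CT z : good z -> CT (trunc_u z).
Proof.
move=> gz; apply: clamp_CT; apply: CT_M; first by apply: clamp_CT; exact: gz.
by apply: CT_V => [|x]; [exact: trunc_rho_CT|rewrite gt_eqF// trunc_rho_gt0].
Qed.

Lemma trunc_field_good z : good z -> good (trunc_field z).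
Proof.
move=> gz; have Cr := trunc_rho_CT gz; have Cu := trunc_u_CT gz.
case; first exact: transport_CT.
apply: CT_B; first by apply: transport_CT => //; exact: CT_M.
by apply: CT_M => //; exact: force_CT.
Qed.

Lemma trunc_rho_bounded_lip : bounded_lip trunc_rho.
Proof. exact: bounded_lip_clamp. Qed.

Lemma trunc_u_bounded_lip : bounded_lip trunc_u.
Proof.
apply: bounded_lip_comp; first by move=> x y; exact: clamp_lip.
apply: bounded_lipM.
  apply: bounded_lip_clamp.
  by have := mulr_ge0 sp0 (le_trans (ltW lo0) lohi); lra.
apply: bounded_lipV lo0 _ trunc_rho_bounded_lip.
by move=> z x; have /andP[] := trunc_rho_itv z x.
Qed.

Lemma force_bounded_lip : bounded_lip (fun z => force (trunc_rho z)).
Proof.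
have [C C0 [rC rL]] := trunc_rho_bounded_lip; have P0 := @period_gt0 R.
exists (q * (C * (pi *+ 2)) + A + 1).
  by rewrite ltr_wpDl// addr_ge0// !mulr_ge0// ltW.
split=> [z x gz|d z w gz gw zw x].
  apply: le_trans (force_bound x (trunc_rho_CT gz)) _.
  rewrite -addrA lerD// ?lerDl// ler_wpM2l//.
  apply: le_trans (ler_norm _) _; apply: mass_bound.
    exact/CT_norm/trunc_rho_CT.
  by move=> y; rewrite normr_id; exact: rC.
have d0 := uclose_ge0 zw.
apply: le_trans (force_lip x (trunc_rho_CT gz) (trunc_rho_CT gw)) _.
apply: (@le_trans _ _ (q * (C * (pi *+ 2)) * d)).
  rewrite -mulrA ler_wpM2l// mulrAC; apply: le_trans (ler_norm _) _; apply: mass_bound.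
    by apply/CT_norm/CT_B; exact: trunc_rho_CT.
  by move=> y; rewrite normr_id; exact: rL.
by rewrite ler_wpM2r// -addrA lerDl addr_ge0.
Qed.

Lemma trunc_field_bounded_lip b : bounded_lip (fun z => trunc_field z b).
Proof.
have br := trunc_rho_bounded_lip; have bu := trunc_u_bounded_lip.
case: b; first exact: bounded_lip_transport.
apply: bounded_lipD; first by apply: bounded_lip_transport => //; exact: bounded_lipM.
by apply/bounded_lipN/bounded_lipM => //; exact: force_bounded_lip.
Qed.

Lemma trunc_field_box t z : 0 <= t <= T -> box t (z true) (z false) ->
  trunc_field z true = mass_rhs eps (z true) (z false) /\
  trunc_field z false = momentum_rhs g a phi alpha eps (z true) (z false).
Proof.
move=> /andP[t0 tT] bt; have [lo hi mb _] := bt.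
have tT' : 0 <= t <= T by rewrite t0.
have r0 x : 0 < z true x by exact: box_rho_gt0 bt x.
have hiT x : z true x <= rho_hi T by apply: le_trans (hi x) (rho_hi_le tT).
have rE : trunc_rho z = z true.
  apply/funext => x; rewrite /trunc_rho clamp_id// hiT andbT.
  exact: le_trans (rho_lo_le tT) (lo x).
have st : speed t <= speed T by exact: speed_le.
have mE x : trunc_m z x = z false x.
  rewrite /trunc_m clamp_id// -ler_norml; apply: le_trans (mb x) _.
  by rewrite ler_pM// ?speed_ge0// ltW.
have uE : trunc_u z = velocity (z true) (z false).
  apply/funext => x; rewrite /trunc_u mE rE clamp_id// -ler_norml.
  exact: le_trans (box_velocity rmin0 bt x) st.
rewrite /trunc_field rE uE; split => //.
apply/funext => x; rewrite /momentum_rhs; congr (transport _ _ _ _ - _).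
by apply/funext => y; rewrite /velocity mulrC divfK// gt_eqF.
Qed.

End truncation.

End truncated_system.

(** * Epsilon forms of uniform convergence and of [C1_to_CT] *)

Section uniform_convergence.
Variable R : realType.
Implicit Types (D : set R) (F : R -> R -> R) (e h s t x : R).

Lemma uniform_cvgP (G : set_system (R -> R)) (f : R -> R) : Filter G ->
  {uniform, G --> f} <-> forall e, 0 < e -> G [set k | forall x, `|f x - k x| < e].
Proof.
move=> FG; split=> [cv e e0|cv P /uniform_nbhs[E [/= entE EP]]].
  apply: cv; apply/uniform_nbhs; exists [set xy | ball xy.1 e xy.2]; split.
    by rewrite -entourage_ballE; exists e.
  by move=> k /= kP x; exact: kP.
move: entE; rewrite -entourage_ballE => -[e /= e0 eE].
by apply: filterS (cv e e0) => k /= kx; apply: EP => x _; apply: eE; exact: kx.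
Qed.

Lemma C1_quotientP D F (f : R -> R) t :
  {uniform, (fun h x => h^-1 * (F (t + h) x - F t x))
      @ within [set h | D (t + h)] 0^' --> f} <->
  forall e, 0 < e -> exists2 d : R, 0 < d & forall h, `|h| < d -> D (t + h) ->
    forall x, `|F (t + h) x - F t x - h * f x| <= e * `|h|.
Proof.
rewrite uniform_cvgP; split=> cv e e0.
  have /nbhs_ballP[d /= d0 dP] := cv e e0; exists d => // h hd Dh x.
  have [->|h0] := eqVneq h 0; first by rewrite addr0 subrr mul0r subr0 normr0 mulr0.
  have := dP h; rewrite /ball /= sub0r normrN => /(_ hd h0 Dh x) /ltW H.
  rewrite (_ : _ - _ - _ = - (h * (f x - h^-1 * (F (t + h) x - F t x)))); last first.
    by rewrite mulrBr mulrA divff// mul1r opprB.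
  by rewrite normrN normrM mulrC ler_wpM2r.
have e2 : 0 < e / 2%:R by lra.
have [d d0 dP] := cv _ e2.
apply/nbhs_ballP; exists d => //= h; rewrite /ball /= sub0r normrN => hd h0 Dh x.
have h0' : 0 < `|h| by rewrite normr_gt0.
have := dP h hd Dh x; rewrite -(ltr_pM2l h0') -normrM mulrBr mulrA divff// mul1r.
rewrite distrC => /le_lt_trans; apply.
by rewrite mulrC ltr_pM2l//; lra.
Qed.

Lemma within_uniform_continuousP D (F' : R -> R -> R) :
  {within D, continuous (F' : R -> {uniform R -> R})} <->
  forall t, D t -> forall e, 0 < e -> exists2 d : R, 0 < d & forall s, `|s - t| < d -> D s ->
    forall x, `|F' t x - F' s x| < e.
Proof.
split=> [/subspace_continuousP cF t Dt e e0|cF].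
  have /uniform_cvgP/(_ e e0)/nbhs_ballP[d /= d0 dP] := cF t Dt.
  by exists d => // s st Ds; apply: dP => //; rewrite /ball/= distrC.
apply/subspace_continuousP => t Dt; apply/uniform_cvgP => e e0.
have [d d0 dP] := cF t Dt e e0; apply/nbhs_ballP; exists d => //= s.
by rewrite /ball/= distrC => st Ds; exact: dP.
Qed.

End uniform_convergence.

(** * Existence and uniqueness for fixed eps *)

Section existence_uniqueness.
Variables (R : realType) (g : R) (a phi : R -> R) (alpha eps q A : R).
Implicit Types (rho m : R -> R -> R) (x s t T : R) (z w : state R).
Hypotheses (eps0 : 0 < eps) (q0 : 0 <= q) (A0 : 0 <= A).
Let force (rho : R -> R) := derive1 (potential g a phi alpha eps rho).
Hypothesis force_CT : forall rho : R -> R, CT rho -> CT (force rho).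
Hypothesis force_bound : forall (rho : R -> R) x, CT rho ->
  `|force rho x| <= q * mass (fun y => `|rho y|) + A.
Hypothesis force_lip : forall (rho rho' : R -> R) x, CT rho -> CT rho' ->
  `|force rho x - force rho' x| <= q * mass (fun y => `|rho y - rho' y|).

Notation mass_rate rho m := (fun t => mass_rhs eps (rho t) (m t)).
Notation momentum_rate rho m := (fun t => momentum_rhs g a phi alpha eps (rho t) (m t)).

(** A solution up to a finite horizon, in the language of [uderiv]. Continuity of the derivative is
    split off into [rhs_lipschitz], which the construction supplies. *)
Definition sol_on (rho0 m0 : R -> R) T rho m : Prop :=
  [/\ forall t, 0 <= t < T -> CT (rho t) /\ CT (m t),
      forall t x, 0 <= t < T -> 0 < rho t x,
      uderiv T rho (mass_rate rho m), uderiv T m (momentum_rate rho m)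
    & rho 0 = rho0 /\ m 0 = m0].

Definition rhs_lipschitz T rho m : Prop := exists2 D : R, 0 < D &
  forall s t x, 0 <= s < T -> 0 <= t < T ->
    `|mass_rate rho m t x - mass_rate rho m s x| <= D * `|t - s| /\
    `|momentum_rate rho m t x - momentum_rate rho m s x| <= D * `|t - s|.

Lemma is_solution_sol_on (rho0 m0 : R -> R) (T' : \bar R) T rho m :
  is_solution g a phi alpha eps rho0 m0 T' rho m -> (T%:E <= T')%E ->
  sol_on rho0 m0 T rho m.
Proof.
move=> [r0 [Cr dr _] [Cm dm _] r0E m0E] TT'.
have sub t : 0 <= t < T -> time_interval T' t.
  by move=> /andP[t0 tT]; split => //; apply: lt_le_trans TT'; rewrite lte_fin.
split => //.
- by move=> t /sub tT; split; [exact: Cr|exact: Cm].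
- by move=> t x /sub tT; exact: r0.
- move=> t tT e e0; have /C1_quotientP/(_ e e0)[d d0 dP] := dr t (sub _ tT).
  by exists d => // h hd hT x; apply: dP => //; exact: sub.
- move=> t tT e e0; have /C1_quotientP/(_ e e0)[d d0 dP] := dm t (sub _ tT).
  by exists d => // h hd hT x; apply: dP => //; exact: sub.
Qed.

Lemma sol_on_is_solution (rho0 m0 : R -> R) rho m :
  (forall T, 0 < T -> sol_on rho0 m0 T rho m /\ rhs_lipschitz T rho m) ->
  is_solution g a phi alpha eps rho0 m0 +oo%E rho m.
Proof.
(* Every condition is local in time, and [0, t + 1[ contains all admissible times at distance less
   than 1 from t. *)
move=> sol; have t1 t : time_interval +oo%E t -> 0 <= t < t + 1 /\ 0 < t + 1.
  by move=> [t0 _]; lra.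
split.
- by move=> t x /t1[tT /sol[[_ + _ _ _] _]]; apply.
- split.
  + by move=> t /t1[tT /sol[[+ _ _ _ _] _]] => /(_ t tT)[].
  + move=> t /t1[tT /sol[[_ _ dr _ _] _]]; apply/C1_quotientP => e e0.
    have [d d0 dP] := dr t tT e e0; exists (Num.min d 1); first by rewrite lt_min d0 ltr01.
    move=> h; rewrite lt_min => /andP[hd h1] [h0 _] x; apply: dP => //.
    by move: h1; rewrite ltr_norml; lra.
  + apply/within_uniform_continuousP => t /t1[tT /sol[_ [D D0 DP]]] e e0.
    exists (Num.min 1 (e / D)); first by rewrite lt_min ltr01 divr_gt0.
    move=> s; rewrite lt_min ltr_pdivlMr// => /andP[s1 sD] [s0 _] x.
    have sT : 0 <= s < t + 1 by move: s1; rewrite ltr_norml; lra.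
    have [H _] := DP s t x sT tT; apply: le_lt_trans H _.
    by rewrite distrC mulrC.
- split.
  + by move=> t /t1[tT /sol[[+ _ _ _ _] _]] => /(_ t tT)[].
  + move=> t /t1[tT /sol[[_ _ _ dr _] _]]; apply/C1_quotientP => e e0.
    have [d d0 dP] := dr t tT e e0; exists (Num.min d 1); first by rewrite lt_min d0 ltr01.
    move=> h; rewrite lt_min => /andP[hd h1] [h0 _] x; apply: dP => //.
    by move: h1; rewrite ltr_norml; lra.
  + apply/within_uniform_continuousP => t /t1[tT /sol[_ [D D0 DP]]] e e0.
    exists (Num.min 1 (e / D)); first by rewrite lt_min ltr01 divr_gt0.
    move=> s; rewrite lt_min ltr_pdivlMr// => /andP[s1 sD] [s0 _] x.
    have sT : 0 <= s < t + 1 by move: s1; rewrite ltr_norml; lra.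
    have [_ H] := DP s t x sT tT; apply: le_lt_trans H _.
    by rewrite distrC mulrC.
- by have [[_ _ _ _ []]] := sol 1 ltr01.
- by have [[_ _ _ _ []]] := sol 1 ltr01.
Qed.

Lemma sol_on_eq (rho0 m0 : R -> R) T rho m rho' m' : 0 < T ->
  (forall t, 0 <= t < T -> rho' t = rho t /\ m' t = m t) ->
  sol_on rho0 m0 T rho m -> sol_on rho0 m0 T rho' m'.
Proof.
move=> T0 E [C p dr dm [r0E m0E]]; split.
- by move=> t tT; have [-> ->] := E t tT; exact: C.
- by move=> t x tT; have [-> _] := E t tT; exact: p.
- move=> t tT e e0; have [d d0 dP] := dr t tT e e0; exists d => // h hd hT x.
  by have [-> ->] := E t tT; have [-> _] := E _ hT; exact: dP.
- move=> t tT e e0; have [d d0 dP] := dm t tT e e0; exists d; first exact: d0.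
  move=> h hd hT x; have [-> ->] := E t tT; have [_ ->] := E _ hT; exact: (dP h hd hT x).
- have O : 0 <= (0 : R) < T by rewrite lexx.
  by have [-> ->] := E 0 O.
Qed.

Lemma rhs_lipschitz_eq T rho m rho' m' :
  (forall t, 0 <= t < T -> rho' t = rho t /\ m' t = m t) ->
  rhs_lipschitz T rho m -> rhs_lipschitz T rho' m'.
Proof.
move=> E [D D0 DP]; exists D; first exact: D0.
move=> s t x sT tT; have [-> ->] := E s sT; have [-> ->] := E t tT.
exact: (DP s t x sT tT).
Qed.

Lemma sol_on_sub (rho0 m0 : R -> R) S T rho m : S <= T ->
  sol_on rho0 m0 T rho m -> sol_on rho0 m0 S rho m.
Proof.
move=> ST [C p dr dm i]; split => //.
- by move=> t tS; apply: C; lra.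
- by move=> t x tS; apply: p; lra.
- exact: uderiv_sub dr.
- exact: uderiv_sub dm.
Qed.

Section initial_data.
Variables (rho0 m0 : R -> R) (T rmin rmax U : R).
Hypotheses (T0 : 0 < T) (Crho0 : CT rho0) (Cm0 : CT m0).
Hypotheses (rmin0 : 0 < rmin) (rmax0 : 0 < rmax) (rminmax : rmin <= rmax) (U0 : 0 <= U).
Hypothesis rho0_itv : forall x, rmin <= rho0 x <= rmax.
Hypothesis m0_bound : forall x, `|m0 x| <= U * rho0 x.

Let M0 := mass rho0.

Let M00 : 0 <= M0.
Proof. by apply: mass_ge0 => x; have /andP[+ _] := rho0_itv x; apply: le_trans; exact: ltW. Qed.

Notation box := (box eps q A T rmin rmax U M0).
Notation F := (trunc_field g a phi alpha eps q A T rmin rmax U M0).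

Lemma initial_box : box 0 rho0 m0.
Proof.
split=> [x|x|x|]; rewrite ?rho_lo0 ?rho_hi0 ?speed0 ?addr0//.
- by have /andP[] := rho0_itv x.
- by have /andP[] := rho0_itv x.
Qed.

Lemma sol_on_box rho m : sol_on rho0 m0 T rho m ->
  forall t, 0 <= t < T -> box t (rho t) (m t).
Proof.
move=> [C p dr dm [r0E m0E]].
apply: (a_priori eps0 q0 A0 force_bound T0 rmin0 U0 M00 C _ dr dm) => //.
- move=> t tT; have [Cr Cm] := C t tT; apply: transport_CT => //.
  by apply: velocity_CT => // x; exact: p.
- by rewrite r0E m0E; exact: initial_box.
Qed.

Lemma F_bounded_lip : exists2 L : R, 0 < L &
  (forall z b x, good z -> `|F z b x| <= L) /\
  (forall d z w, good z -> good w -> uclose d z w -> uclose (L * d) (F z) (F w)).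
Proof.
have bl := trunc_field_bounded_lip eps0 q0 A0 force_bound force_lip T0 rmin0
  rmax0 rminmax U0 M00.
have [C C0 [CB CL]] := bl true; have [D D0 [DB DL]] := bl false.
exists (C + D); first exact: addr_gt0.
split=> [z [] x gz|d z w gz gw zw [] x].
- by apply: le_trans (CB z x gz) _; rewrite lerDl ltW.
- by apply: le_trans (DB z x gz) _; rewrite lerDr ltW.
- apply: le_trans (CL d z w gz gw zw x) _.
  by rewrite ler_wpM2r ?(uclose_ge0 zw)// lerDl ltW.
- apply: le_trans (DL d z w gz gw zw x) _.
  by rewrite ler_wpM2r ?(uclose_ge0 zw)// lerDr ltW.
Qed.

Definition pair_state (r m : R -> R) : state R := fun b => if b then r else m.

Lemma F_pair t (r m : R -> R) : 0 <= t <= T -> box t r m ->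
  F (pair_state r m) true = mass_rhs eps r m /\
  F (pair_state r m) false = momentum_rhs g a phi alpha eps r m.
Proof. by move=> tT bt; exact: (@trunc_field_box _ g a phi alpha _ _ _ eps0 q0 A0 _ _ _ _ _ T0 rmin0 rmax0 U0 M00 _ (pair_state r m) tT bt). Qed.

Lemma sol_on_unique rho m rho' m' :
  sol_on rho0 m0 T rho m -> sol_on rho0 m0 T rho' m' ->
  forall t, 0 <= t < T -> rho' t = rho t /\ m' t = m t.
Proof.
move=> s1 s2 t tT; have [L L0 [_ FL]] := F_bounded_lip.
have b1 := sol_on_box s1; have b2 := sol_on_box s2.
have [C1 _ dr1 dm1 [i1 j1]] := s1; have [C2 _ dr2 dm2 [i2 j2]] := s2.
pose z t := pair_state (rho' t) (m' t); pose w t := pair_state (rho t) (m t).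
suff zw : z t = w t.
  by split; [exact: (congr1 (fun f : state R => f true) zw)
            |exact: (congr1 (fun f : state R => f false) zw)].
apply: (ode_unique FL (z := z) (w := w) (z' := fun t => F (z t)) (w' := fun t => F (w t)) _ _ _ _ _ tT).
- move=> s sT; have [? ?] := C1 s sT; have [? ?] := C2 s sT.
  by split; case.
- have E s : 0 <= s < T -> F (z s) true = mass_rate rho' m' s /\
      F (z s) false = momentum_rate rho' m' s.
    by move=> sT; apply: F_pair (b2 s sT); lra.
  by case=> s sT; have [E1 E2] := E s sT; [rewrite E1; exact: dr2|rewrite E2; exact: dm2].
- have E s : 0 <= s < T -> F (w s) true = mass_rate rho m s /\
      F (w s) false = momentum_rate rho m s.
    by move=> sT; apply: F_pair (b1 s sT); lra.
  by case=> s sT; have [E1 E2] := E s sT; [rewrite E1; exact: dr1|rewrite E2; exact: dm1].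
- by [].
- by rewrite /z /w i1 j1 i2 j2.
Qed.

Lemma sol_on_exists : exists rho m, sol_on rho0 m0 T rho m /\ rhs_lipschitz T rho m.
Proof.
have [L L0 [FB FL]] := F_bounded_lip.
have F_good : forall z, good z -> good (F z).
  by move=> z gz; exact: (trunc_field_good eps0 q0 A0 force_CT T0 rmin0 rmax0 rminmax U0 M00 gz).
have g0 : good (pair_state rho0 m0) by case.
have [z [z0 gz zlip zder]] := picard L0 L0 g0 F_good FB FL.
have dz b : uderiv T (fun t => z t b) (fun t => F (z t) b).
  (* [F_bounded_lip] gives one constant L both as bound and as Lipschitz constant, so the remainder
     of [picard] is L^2 h^2. *)
  move=> t /andP[t0 tT] e e0; exists (e / (L * L)); first by rewrite divr_gt0 ?mulr_gt0.
  move=> h; rewrite ltr_pdivlMr ?mulr_gt0// => hL /andP[h0 _] x.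
  have := zder t (t + h) b x t0 h0; rewrite [t + h - t]addrC addKr => /le_trans; apply.
  rewrite -[h ^+ 2](ger0_norm (sqr_ge0 h)) normrX expr2 mulrA ler_wpM2r//.
  by rewrite mulrC ltW.
have gzT t : 0 <= t < T -> good (z t) by move=> /andP[t0 _]; exact: gz.
have bz : forall t, 0 <= t < T -> box t (z t true) (z t false).
  apply: (a_priori eps0 q0 A0 force_bound T0 rmin0 U0 M00 _ _ (dz true) (dz false)).
  - by move=> t tT; split; exact: gzT.
  - by move=> t tT; apply: F_good; exact: gzT.
  - by move=> t tT; apply: trunc_field_box => //; lra.
  - by rewrite z0; exact: initial_box.
have E t : 0 <= t < T ->
    F (z t) true = mass_rhs eps (z t true) (z t false) /\
    F (z t) false = momentum_rhs g a phi alpha eps (z t true) (z t false).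
  by move=> tT; apply: (trunc_field_box g a phi alpha eps0 q0 A0 T0 rmin0 rmax0 U0 M00 _ (bz t tT)); lra.
exists (fun t => z t true), (fun t => z t false); split.
  split.
  - by move=> t tT; split; exact: gzT.
  - by move=> t x tT; exact: (box_rho_gt0 rmin0 (bz t tT)).
  - by move=> t tT; have [<- _] := E t tT; exact: dz.
  - by move=> t tT; have [_ <-] := E t tT; exact: dz.
  - by rewrite z0.
exists (L * L); first exact: mulr_gt0.
move=> s t x sT tT; have [<- <-] := E s sT; have [<- <-] := E t tT.
have [s0 t0] : 0 <= s /\ 0 <= t by lra.
by rewrite -mulrA; split; apply: FL; [exact: gzT|exact: gzT|exact: zlip|exact: gzT|exact: gzT|exact: zlip].
Qed.

End initial_data.

(** * Gluing in time *)

Section global.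
Variables (rho0 m0 : R -> R).
Hypotheses (Crho0 : CT rho0) (Cm0 : CT m0) (rho0_gt0 : forall x, 0 < rho0 x).

(** Compactness of the torus places any positive continuous data in some box. These constants may
    depend on eps; they serve existence and uniqueness. *)
Lemma initial_bounds : exists rmin rmax U : R, [/\ 0 < rmin, rmin <= rmax, 0 <= U,
  forall x, rmin <= rho0 x <= rmax & forall x, `|m0 x| <= U * rho0 x].
Proof.
have [rmin rmin0 lo] := CT_gt0 Crho0 rho0_gt0.
have [rmax rmax0 hi] := CT_bounded Crho0; have [C C0 mC] := CT_bounded Cm0.
exists rmin, rmax, (C / rmin); split=> //.
- by apply: le_trans (lo 0) _; apply: le_trans (hi 0); exact: ler_norm.
- by rewrite divr_ge0// ltW.
- by move=> x; rewrite lo (le_trans _ (hi x))// ler_norm.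
- move=> x; apply: le_trans (mC x) _; rewrite -mulrA ler_peMr ?(ltW C0)//.
  by rewrite mulrC ler_pdivlMr// mul1r.
Qed.

Lemma sol_on_existsT T : 0 < T ->
  exists rho m, sol_on rho0 m0 T rho m /\ rhs_lipschitz T rho m.
Proof.
move=> T0; have [rmin [rmax [U [? ? ? ? ?]]]] := initial_bounds.
by apply: (@sol_on_exists _ _ _ rmin rmax U) => //; exact: lt_le_trans (_ : rmin <= _).
Qed.

Lemma sol_on_uniqueT T rho m rho' m' : 0 < T ->
  sol_on rho0 m0 T rho m -> sol_on rho0 m0 T rho' m' ->
  forall t, 0 <= t < T -> rho' t = rho t /\ m' t = m t.
Proof.
move=> T0; have [rmin [rmax [U [? ? ? ? ?]]]] := initial_bounds.
by apply: (@sol_on_unique _ _ _ rmin rmax U) => //; exact: lt_le_trans (_ : rmin <= _).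
Qed.

Lemma global_solution : exists rho m,
  is_solution g a phi alpha eps rho0 m0 +oo%E rho m /\
  forall (T : \bar R) rho' m', (0 < T)%E ->
    is_solution g a phi alpha eps rho0 m0 T rho' m' ->
    forall t, time_interval T t -> rho' t = rho t /\ m' t = m t.
Proof.
have Tn (n : nat) : 0 < n.+1%:R :> R by rewrite ltr0n.
have [n|f fP] := @choice nat ((R -> R -> R) * (R -> R -> R)) (fun n p =>
    sol_on rho0 m0 n.+1%:R p.1 p.2 /\ rhs_lipschitz n.+1%:R p.1 p.2).
  by have [rho [m H]] := sol_on_existsT (Tn n); exists (rho, m).
(* The solution of index n lives on [0, n + 1[, and t < truncn t + 1. Uniqueness makes the choice of
   index immaterial. *)
pose rho t := (f (Num.truncn t)).1 t; pose m t := (f (Num.truncn t)).2 t.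
have fE n t : 0 <= t < n.+1%:R -> rho t = (f n).1 t /\ m t = (f n).2 t.
  move=> /andP[t0 tn]; set k := Num.truncn t.
  have kn : (k <= n)%N by rewrite -ltnS -(ltr_nat R); apply: le_lt_trans tn; rewrite truncn_le.
  have tk : 0 <= t < k.+1%:R by rewrite t0 truncnS_gt.
  have [s1 _] := fP k; have [s2 _] := fP n.
  apply: (sol_on_uniqueT (Tn k) _ s1 tk).
  by apply: sol_on_sub s2; rewrite ler_nat ltnS.
have sol T : 0 < T -> sol_on rho0 m0 T rho m /\ rhs_lipschitz T rho m.
  move=> T0; pose n := Num.truncn T.
  have Tn1 : T <= n.+1%:R by exact/ltW/truncnS_gt.
  have [s r] := fP n; split.
    by apply: sol_on_sub Tn1 _; apply: sol_on_eq s => //; exact: fE.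
  have [D D0 DP] := rhs_lipschitz_eq (fE n) r.
  by exists D => // s' t x sT tT; apply: DP; lra.
exists rho, m; split; first exact: sol_on_is_solution.
move=> T rho' m' T0 sol' t [t0 tT].
(* T may be infinite; uniqueness is applied on a bounded interval [0, S[ that contains t. *)
have [S [tS ST]] : exists S : R, t < S /\ (S%:E <= T)%E.
  case: T T0 sol' tT => [T| |//] _ _ tT; first by exists T; split.
  by exists (t + 1); split; [rewrite ltrDl|exact: leey].
have S0 : 0 < S by lra.
have [s1 _] := sol S S0; have s2 := is_solution_sol_on sol' ST.
by apply: (sol_on_uniqueT S0 s1 s2); rewrite t0.
Qed.

End global.

End existence_uniqueness.

(** * From L^1 and L^oo norms to bounds on continuous data *)

Section torus_norms.
Variable R : realType.
Implicit Types (f u rho : R -> R) (x e M : R).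

Notation period := (pi *+ 2 : R).

Lemma cont_measurable f : continuous f -> measurable_fun setT f.
Proof. by move=> cf; apply: continuous_measurable_fun. Qed.

Lemma torus_measureT : (0 < torus_measure R setT)%E.
Proof.
rewrite /= /mrestr setTI lebesgue_measure_itv/= lte_fin period_gt0 oppr0.
by rewrite adde0 lte_fin period_gt0.
Qed.

(** By continuity, a violation at one point persists on an interval, which has positive measure. *)
Lemma CT_normLT_oo u M : CT u -> (normLT +oo%E u <= M%:E)%E -> forall x, `|u x| <= M.
Proof.
move=> [cu pu]; rewrite /normLT unlock torus_measureT => /ess_supP[A [mA A0 sub]] x.
have P0 := @period_gt0 R.
have [y0 y0P <-] := periodic_reduce x pu.
(* The representative must lie strictly left of the end of the period, so that an interval [y, b[
   fits inside it. *)
have [y [y1 yE]] : exists y, 0 <= y < period /\ u y = u y0.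
  case: (ltP y0 period) => yP; first by exists y0; split=> //; case/andP: y0P => ->.
  exists 0; rewrite lexx P0; split=> //; rewrite -(pu 0) add0r; congr u.
  by apply/eqP; rewrite eq_le yP; case/andP: y0P => _ ->.
rewrite -{}yE leNgt; apply/negP => My.
have uy0 : 0 < `|u y| - M by rewrite subr_gt0.
have /continuousP_eps/(_ _ uy0)[d d0 dP] := cu y.
pose b := Num.min (y + d) period.
have yb : y < b by rewrite lt_min ltrDl d0 /=; case/andP: y1.
have bp : b <= period by rewrite ge_min lexx orbT.
have bd : b <= y + d by rewrite ge_min lexx.
have subA : `[y, b[ `<=` A `&` `[0, period[.
  move=> z /=; rewrite !in_itv/= => /andP[yz zb]; split; last first.
    by case/andP: y1 => y00 _; rewrite (le_trans y00 yz) (lt_le_trans zb bp).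
  apply: sub => /=; rewrite lee_fin; apply/negP; rewrite -ltNge.
  have := dP (z - y); rewrite subrKC => H.
  have {}H := H _; have zy : `|z - y| < d by rewrite ger0_norm; lra.
  have := H zy; have := ler_distD (u z) (u y) 0; rewrite !subr0 distrC; lra.
have : (lebesgue_measure `[y, b[%classic <= torus_measure R A)%E.
  by rewrite /= /mrestr; apply: le_measure; rewrite ?inE//; exact: measurableI.
by rewrite A0 lebesgue_measure_itv/= lte_fin yb lee_fin; lra.
Qed.

Lemma CT_normLT_1 rho M : CT rho -> (forall x, 0 <= rho x) ->
  (normLT 1%E rho <= M%:E)%E -> mass rho <= M.
Proof.
move=> [cr _] r0; rewrite /normLT Lnorm1 => NM.
have P0 := ltW (@period_gt0 R).
rewrite /mass /iint -Rintegral_itv_bndo_bndc; last first.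
  apply: integrableS (cont_integrable 0 period cr) => //.
  by apply: subset_itvl; rewrite bnd_simp.
have mr : measurable_fun setT (EFin \o rho).
  by apply/measurable_EFinP; exact: cont_measurable.
have le : (\int[lebesgue_measure]_(x in `[0%R, period[) (rho x)%:E <=
    \int[torus_measure R]_x `|(rho x)%:E|)%E.
  rewrite (_ : (\int[lebesgue_measure]_(x in `[0%R, period[) (rho x)%:E)%E =
    (\int[torus_measure R]_(x in `[0%R, period[) `|(rho x)%:E|)%E); last first.
    under [RHS]eq_integral do rewrite gee0_abs ?lee_fin//.
    apply: eq_measure_integral => B mB sB /=.
    by rewrite /mrestr setIidl.
  apply: ge0_subset_integral => //.
  exact: measurableT_comp.
have le2 := le_trans le NM.
rewrite /Rintegral -lee_fin fineK// ge0_fin_numE; first exact: le_lt_trans le2 (ltry M).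
by apply: integral_ge0 => x _; rewrite lee_fin.
Qed.

(** Minkowski's inequality for f eps = f0 + (f eps - f0), once the second norm is at most 1. The
    convergence of the data acts through this bound, uniform in eps. *)
Lemma normLT_bounded (p : \bar R) (f0 : R -> R) (f : R -> R -> R) : (1 <= p)%E ->
  LT p f0 -> (forall eps : R, 0 < eps < 1 -> CT (f eps)) ->
  normLT p (f0 \- f eps)%R @[eps --> (0 : R)^'+] --> 0%E ->
  exists M d : R, 0 < d <= 1 /\ forall eps : R, 0 < eps < d -> (normLT p (f eps) <= M%:E)%E.
Proof.
move=> p1 [/andP[mf0 nf0] _] Cf cv.
move: mf0; rewrite inE/= => mf0.
move: nf0; rewrite inE/= /finite_norm => nf0.
pose N0 := normLT p f0.
have N0fin : N0 \is a fin_num by rewrite ge0_fin_numE// Lnorm_ge0.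
have : \forall eps \near (0:R)^'+, (normLT p (f0 \- f eps)%R <= 1%:E)%E.
  apply: (cv [set y | (y <= 1%:E)%E]).
  have lt01 : (0 < 1%:E :> \bar R)%E by rewrite lte_fin ltr01.
  have N1 : nbhs (0%E : \bar R) [set y | (y < 1%:E)%E] := open_ereal_lt' lt01.
  by apply: filterS N1 => y /ltW.
move=> /nbhs_ballP[d /= d0 dP].
exists (fine N0 + 1), (Num.min d 1); split.
  by rewrite lt_min d0 ltr01 ge_min lexx orbT.
move=> eps /andP[e0]; rewrite lt_min => /andP[ed e1].
have := dP eps; rewrite /ball/= sub0r normrN gtr0_norm// => /(_ ed e0) H.
have [ce _] : CT (f eps) by apply: Cf; rewrite e0.
have mfe : measurable_fun setT (f eps) by exact: cont_measurable.
have mg : measurable_fun setT (fun x => f eps x - f0 x) by exact: measurable_funB.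
have := eminkowski (torus_measure R) mf0 mg p1.
have -> : (f0 \+ (fun x => f eps x - f0 x))%R = f eps.
  by apply/funext => x /=; rewrite subrKC.
move=> /le_trans; apply; rewrite EFinD fineK// leeD//.
apply: le_trans H; rewrite /normLT -(oppe_Lnorm (torus_measure R)).
rewrite le_eqVlt; apply/orP; left; apply/eqP; congr (Lnorm _ _ _).
by apply/funext => x; exact: (congr1 EFin (opprB _ _)).
Qed.

End torus_norms.

(** * Consistency of transport and mollification against test functions *)

Section weak_consistency.
Variable R : realType.
Implicit Types (f u k psi rho : R -> R) (c e h s t x y C K L mu : R).

Notation period := (pi *+ 2 : R).

(** The function [l] of the upper limit s, obtained by integrating in x up to s and then in y, has
    derivative [iint c d (G s)]; the Lipschitz bound in x makes the Taylor remainder uniform in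
    y. *)
Lemma iint_exchange (G : R -> R -> R) (L B a b c d : R) : a <= b -> c <= d -> 0 <= L ->
  (forall x, continuous (G x)) -> (forall x x' y, `|G x y - G x' y| <= L * `|x - x'|) ->
  (forall x y, `|G x y| <= B) ->
  iint a b (fun x => iint c d (G x)) = iint c d (fun y => iint a b (fun x => G x y)).
Proof.
move=> ab cd L0 cG lG GB; have cG' y : continuous (fun x => G x y).
  by apply: lipschitz_continuous => x x'; exact: lG.
have dprim y x := is_derive_prim x (cG' y).
pose l s := iint c d (fun y => prim (fun x => G x y) s).
have cprim s : continuous (fun y => prim (fun x => G x y) s).
  rewrite /prim; case: (leP 0 s) => s0; first exact: iint_continuous GB.
  rewrite (_ : (fun y => _) = fun y => -1 * iint s 0 (fun x => G x y)).
    by apply: contZ; exact: iint_continuous GB.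
  by apply/funext => y; rewrite mulN1r.
have dl s : is_derive s 1 l (iint c d (G s)).
  apply/is_derive_eps => e e0; have D0 : 0 <= L * (d - c) by rewrite mulr_ge0// subr_ge0.
  exists (e / (L * (d - c) + 1)); first by rewrite divr_gt0// ltr_wpDl.
  move=> h; rewrite ltr_pdivlMr ?ltr_wpDl// => he.
  have cT := contB (contB (cprim (s + h)) (cprim s)) (contZ (c := h) (cG s)).
  rewrite /l -iintZ// -iintB// -iintB//; last 2 first.
  - exact: contB.
  - exact: contZ.
  apply: (@le_trans _ _ (L * h ^+ 2 * (d - c))).
    apply: iint_bound => // y _.
    by apply: (taylor1 s h (dprim y) _ L0) => x x'; exact: lG.
  rewrite -[h ^+ 2](ger0_norm (sqr_ge0 h)) normrX expr2 mulrA mulrAC ler_wpM2r//.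
  by rewrite mulrAC -[leRHS]addr0; have := normr_ge0 h; lra.
have cin : continuous (fun x => iint c d (G x)).
  apply: (@lipschitz_continuous _ _ (L * (d - c))) => x x'.
  rewrite -iintB// mulrAC; apply: iint_bound => //; exact: contB.
rewrite (iintE cin dl ab) /l -iintB//; apply: eq_iint => y _.
by rewrite prim_iint.
Qed.

(* Moving the shifts onto psi replaces eps^-1 (psi (x +- eps) - psi x) by
   +- psi' x, with an error of at most C eps. *)
Lemma transport_weak (eps K C : R) (n : nat) f u psi :
  0 < eps < 1 -> 0 <= K -> 0 <= C -> (K + 1) *+ 2 <= period *+ n ->
  CT f -> CT u -> supp K psi -> (forall x, is_derive x 1 psi (derive1 psi x)) ->
  continuous (derive1 psi) ->
  (forall x y, `|derive1 psi x - derive1 psi y| <= C * `|x - y|) ->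
  `|\int[lebesgue_measure]_x (transport eps f u x * psi x)
    - \int[lebesgue_measure]_x (f x * u x * derive1 psi x)|
    <= eps * (C * (mass (fun x => `|f x * u x|) *+ n)).
Proof.
move=> /andP[e0 e1] K0 C0 nK Cf Cu sp dp cp' lp.
have sp' := supp_derive dp sp.
have cp : continuous psi by move=> x; exact: is_derive_continuous (dp x).
pose p x := f x * u^\+ x; pose q x := f x * u^\- x.
have [cf _] := Cf; have [cu _] := Cu.
have cpp : continuous p by have [] := CT_M Cf (funrpos_CT Cu).
have cq : continuous q by have [] := CT_M Cf (funrneg_CT Cu).
(* The margin 1 around the support of [psi] leaves room for the shifts, since eps < 1. *)
pose a := - K - 1; pose b := K + 1; have ab : a <= b by rewrite /a /b; lra.
have out c x : `|c| <= 1 -> ~~ (a <= x <= b) -> psi (x + c) = 0.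
  move=> c1 xab; apply: sp; rewrite ltNge; apply: contra xab => xK.
  have := ler_normB (x + c) c; rewrite addrK => H.
  have : `|x| <= b by rewrite /b; lra.
  by rewrite ler_norml /a /b; lra.
have out0 x : ~~ (a <= x <= b) -> psi x = 0.
  by move=> H; rewrite -[x]addr0; apply: out => //; rewrite normr0.
have ne : `|eps| <= 1 by rewrite gtr0_norm// ltW.
have ne' : `|- eps| <= 1 by rewrite normrN.
have cps c : continuous (fun x => psi (x + c)) by exact: continuous_shiftr.
pose P1 x := p x * psi (x + eps); pose P2 x := (p x + q x) * psi x.
pose P3 x := q x * psi (x - eps).
have c1 : continuous P1 by exact: contM.
have c2 : continuous P2 by apply: contM => //; exact: contD.
have c3 : continuous P3 by exact: contM.
have o1 x : ~~ (a <= x <= b) -> P1 x = 0 by move=> H; rewrite /P1 out// mulr0.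
have o3 x : ~~ (a <= x <= b) -> P3 x = 0 by move=> H; rewrite /P3 out// mulr0.
have o2 x : ~~ (a <= x <= b) -> P2 x = 0 by move=> H; rewrite /P2 out0// mulr0.
have c1' := continuous_shiftr (c := - eps) c1; have c3' := continuous_shiftr (c := eps) c3.
have E1 : \int[lebesgue_measure]_x (transport eps f u x * psi x) =
    eps^-1 * (iint a b P1 - iint a b P2 + iint a b P3).
  (* The substitution is made on the whole line. The shifted integrands then need a segment larger
     by 1 on each side. *)
  rewrite -(int_supp o1) -(int_supp o3) -(int_shift (- eps) c1 ab o1) -(int_shift eps c3 ab o3).
  have o1' x : ~~ (a - 1 <= x <= b + 1) -> P1 (x - eps) = 0.
    by move=> H; apply: o1; apply: contra H; lra.
  have o3' x : ~~ (a - 1 <= x <= b + 1) -> P3 (x + eps) = 0.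
    by move=> H; apply: o3; apply: contra H; lra.
  have o2' x : ~~ (a - 1 <= x <= b + 1) -> P2 x = 0.
    by move=> H; apply: o2; apply: contra H; lra.
  rewrite (int_supp o1') (int_supp o3').
  have -> : iint a b P2 = iint (a - 1) (b + 1) P2 by rewrite -(int_supp o2) (int_supp o2').
  rewrite -iintB// -iintD//; last exact: contB.
  rewrite -iintZ; last by apply: contD => //; exact: contB.
  rewrite -(@int_supp _ _ (a - 1) (b + 1)); last first.
    by move=> x H; rewrite o1'// o2'// o3'// subr0 addr0 mulr0.
  congr (Rintegral _ _ _); apply/funext => x.
  rewrite /P1 /P2 /P3 /p /q /transport subrK addrK (normr_posneg u x); ring.
have o4 x : ~~ (a <= x <= b) -> f x * u x * derive1 psi x = 0.
  move=> xab; rewrite sp' ?mulr0// ltNge; apply: contra xab.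
  by rewrite ler_norml /a /b; lra.
rewrite E1 (int_supp o4).
have c4 : continuous (fun x => f x * u x * derive1 psi x).
  by apply: contM => //; exact: contM.
rewrite -iintB// -iintD//; last exact: contB.
have c5 : continuous (fun x => P1 x - P2 x + P3 x) by apply: contD => //; exact: contB.
rewrite -iintZ// -iintB//; last exact: contZ.
have Cfu := CT_norm (CT_M Cf Cu).
have pw x : `|eps^-1 * (P1 x - P2 x + P3 x) - f x * u x * derive1 psi x| <=
    eps * C * `|f x * u x|.
  (* With f u = p - q and f |u| = p + q, the error splits into the Taylor remainders of psi at eps,
     weighted by p, and at -eps, weighted by q; and |p| + |q| = |f u|. *)
  have t1 := taylor1 x eps dp lp C0; have t2 := taylor1 x (- eps) dp lp C0.
  rewrite -(ler_pM2l e0) -{1}(gtr0_norm e0) -normrM.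
  rewrite (_ : eps * (_ - _) = p x * (psi (x + eps) - psi x - eps * derive1 psi x) +
     q x * (psi (x - eps) - psi x - (- eps) * derive1 psi x)); last first.
    rewrite mulrBr mulrA divff ?gt_eqF// mul1r /P1 /P2 /P3 {1}(posnegE u x) /p /q; ring.
  apply: le_trans (ler_normD _ _) _; rewrite !normrM.
  have -> : eps * (eps * C * (`|f x| * `|u x|)) =
      `|p x| * (C * eps ^+ 2) + `|q x| * (C * (- eps) ^+ 2).
    rewrite !normrM (normr_posneg u x) (ger0_norm (funrpos_ge0 u x)) (ger0_norm (funrneg_ge0 u x)).
    ring.
  by apply: lerD; rewrite [in leRHS]normrM ler_wpM2l// mulr_ge0.
apply: le_trans (iint_norm _ _ _) _; first by apply: contB => //; exact: contZ.
apply: (@le_trans _ _ (iint a b (fun x => eps * C * `|f x * u x|))).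
  apply: iint_le => [||x _]; [|by apply: contZ; have [] := Cfu|exact: pw].
  by apply: continuous_norm; apply: contB => //; exact: contZ.
rewrite iintZ; last by have [] := Cfu.
rewrite -mulrA ler_pM2l// ler_wpM2l// iint_mass//.
by move: nK; rewrite mulr2n /a /b; lra.
Qed.

(** Exchanging the integrals moves the mollifier from rho onto psi. The averaged function [W] is
    within C K mu of psi, because the dilated kernel has integral 1 and support of radius K mu; only
    the mass of rho is then left. *)
Lemma mollifier_weak (phi psi rho : R -> R) (K K' C mu : R) (n : nat) :
  0 < mu <= 1 -> 0 <= K -> 0 <= K' -> 0 <= C -> (K + K') *+ 2 <= period *+ n ->
  supp K phi -> (forall x, 0 <= phi x) -> \int[lebesgue_measure]_x phi x = 1 ->
  (exists L : R, 0 <= L /\ forall x y, `|phi x - phi y| <= L * `|x - y|) ->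
  supp K' psi -> (forall x y, `|psi x - psi y| <= C * `|x - y|) ->
  CT rho -> (forall x, 0 <= rho x) ->
  `|\int[lebesgue_measure]_x (convolution rho (dilation phi mu) x * psi x)
    - \int[lebesgue_measure]_x (rho x * psi x)| <= mu * (C * K * (mass rho *+ n)).
Proof.
move=> /andP[mu0 mu1] K0 K'0 C0 nK sphi phi0 phi1 [L [L0 lphi]] spsi lpsi Crho rho0.
have [cr _] := Crho; have [Br Br0 rB] := CT_bounded Crho.
have cpsi := lipschitz_continuous lpsi; have [Bp Bp0 pB] := supp_bounded cpsi spsi.
have cphi := lipschitz_continuous lphi; have [Bf Bf0 fB] := supp_bounded cphi sphi.
pose d := dilation phi mu.
have m1 : 0 < mu^-1 by rewrite invr_gt0.
have d0 x : 0 <= d x by rewrite mulr_ge0// ltW.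
have dB x : `|d x| <= mu^-1 * Bf.
  by rewrite normrM (gtr0_norm m1) ler_wpM2l// ltW.
have dL x y : `|d x - d y| <= mu^-1 * (L * mu^-1) * `|x - y|.
  rewrite -mulrBr normrM (gtr0_norm m1) -mulrA ler_pM2l// -mulrA.
  by apply: le_trans (lphi _ _) _; rewrite -mulrBl normrM (gtr0_norm m1) [mu^-1 * _]mulrC.
have cd : continuous d := lipschitz_continuous dL.
have sd x : K * mu < `|x| -> d x = 0.
  move=> xK; rewrite /d /dilation sphi ?mulr0// normrM (gtr0_norm m1).
  by rewrite ltr_pdivlMr.
have Kmu : K * mu <= K by have := ler_wpM2l K0 mu1; rewrite mulr1.
have sdK : supp K d by move=> x xK; apply: sd; apply: le_lt_trans xK.
have d1 : \int[lebesgue_measure]_x d x = 1 by rewrite (int_dilation cphi sphi mu0).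
(* For x in the support of psi, the kernel confines y to [-A, A]; for such y, the support of x |-> d
   (x - y) lies in [-A2, A2]. *)
pose A := K' + K; pose A2 := A + K.
have A0 : - A <= A by rewrite /A; lra.
have A20 : - A2 <= A2 by rewrite /A2 /A; lra.
pose W y := iint (- A2) A2 (fun x => d (x - y) * psi x).
pose G x y := rho y * (d (x - y) * psi x).
have cdflip x : continuous (fun y => d (x - y)) := cont_flip cd.
have cG x : continuous (G x).
  by apply: contM => //; apply: contM => // y; exact: cvg_cst.
have GB x y : `|G x y| <= Br * (mu^-1 * Bf * Bp).
  by rewrite /G normrM ler_pM// normrM ler_pM.
pose LG := Br * (mu^-1 * (L * mu^-1) * Bp + mu^-1 * Bf * C).
have LG0 : 0 <= LG.
  have ? := ltW m1; have ? := ltW Br0; have ? := ltW Bp0; have ? := ltW Bf0.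
  by rewrite /LG mulr_ge0// addr_ge0// !mulr_ge0.
have GL x x' y : `|G x y - G x' y| <= LG * `|x - x'|.
  rewrite /G /LG -mulrBr normrM -[leRHS]mulrA ler_pM//.
  rewrite (_ : _ - _ = (d (x - y) - d (x' - y)) * psi x + d (x' - y) * (psi x - psi x')); last by ring.
  apply: le_trans (ler_normD _ _) _; rewrite [leRHS]mulrDl; apply: lerD; rewrite normrM.
    rewrite [leRHS]mulrAC ler_pM//; apply: le_trans (dL _ _) _.
    by rewrite (_ : x - y - (x' - y) = x - x')//; ring.
  by rewrite -[leRHS]mulrA ler_pM.
have E1 : \int[lebesgue_measure]_x (convolution rho d x * psi x) =
    iint (- A2) A2 (fun x => iint (- A) A (G x)).
  rewrite (@int_supp _ _ (- A2) A2); last first.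
    move=> x xA; rewrite spsi ?mulr0// ltNge; apply: contra xA.
    by rewrite ler_norml /A2 /A; lra.
  apply: eq_iint => x _; case: (leP `|x| K') => xK; last first.
    have -> : iint (- A) A (G x) = iint (- A) A (fun=> 0).
      by apply: eq_iint => y _; rewrite /G spsi// !mulr0.
    by rewrite iint_cst// mul0r spsi// mulr0.
  rewrite (@conv_iint _ _ K sdK _ x (- A) A); last 2 first.
  - by move: xK; rewrite ler_norml /A; lra.
  - by move: xK; rewrite ler_norml /A; lra.
  rewrite mulrC -iintZ; last by apply: contM => //; exact: cdflip.
  by apply: eq_iint => y _; rewrite /G; ring.
have E2 : \int[lebesgue_measure]_x (rho x * psi x) = iint (- A) A (fun y => rho y * psi y).
  apply: int_supp => x xA; rewrite spsi ?mulr0// ltNge; apply: contra xA.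
  by rewrite ler_norml /A; lra.
have cW : continuous W.
  apply: (iint_continuous (f := fun x y => d (x - y) * psi x) (B := mu^-1 * Bf * Bp)).
  - by move=> x; apply: contM => // y; exact: cvg_cst.
  - move=> y; apply: contM => //; exact: (continuous_shiftr (c := - y) cd).
  - by move=> x y; rewrite normrM ler_pM.
have Wpsi y : - A <= y <= A -> `|W y - psi y| <= C * (K * mu).
  move=> yA; have cdy : continuous (fun x => d (x - y)) := continuous_shiftr (c := - y) cd.
  have dy1 : iint (- A2) A2 (fun x => d (x - y)) = 1.
    rewrite -int_supp; last first.
      move=> x xA; apply: sdK; rewrite ltNge; apply: contra xA.
      by rewrite ler_norml /A2; lra.
    rewrite (@int_shift _ d (- K) K (- y))//; first by lra.
    by move=> x xK; apply: sdK; rewrite ltNge; apply: contra xK; rewrite ler_norml.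
  have -> : W y - psi y = iint (- A2) A2 (fun x => d (x - y) * (psi x - psi y)).
    rewrite /W -[X in _ - X]mul1r -dy1 mulrC -iintZ// -iintB; [|exact: contM|exact: contZ].
    by apply: eq_iint => x _; ring.
  have cc : continuous (fun x => d (x - y) * (psi x - psi y)).
    by apply: contM => //; apply: contB => // x; exact: cvg_cst.
  apply: le_trans (iint_norm _ _ cc) _.
  rewrite -[leRHS]mulr1 -dy1 -iintZ//; apply: iint_le => [||x _].
  - exact: continuous_norm.
  - exact: contZ.
  rewrite normrM (ger0_norm (d0 _)) mulrC; case: (leP `|x - y| (K * mu)) => xy.
    by rewrite ler_wpM2r//; apply: le_trans (lpsi _ _) _; rewrite ler_wpM2l.
  by rewrite sd// !mulr0.
rewrite E1 E2 (iint_exchange A20 A0 LG0 cG GL GB).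
have -> : iint (- A) A (fun y => iint (- A2) A2 (fun x => G x y)) =
    iint (- A) A (fun y => rho y * W y).
  apply: eq_iint => y _; rewrite /W -iintZ//.
  by apply: contM => //; exact: (continuous_shiftr (c := - y) cd).
rewrite -iintB; [|exact: contM|exact: contM].
have cD : continuous (fun y => rho y * W y - rho y * psi y) by apply: contB; exact: contM.
apply: le_trans (iint_norm _ _ cD) _.
apply: (@le_trans _ _ (iint (- A) A (fun y => C * (K * mu) * rho y))).
  apply: iint_le => [||y yA]; [exact: continuous_norm|exact: contZ|].
  by rewrite -mulrBr normrM (ger0_norm (rho0 y)) mulrC ler_wpM2r// Wpsi.
rewrite iintZ// (_ : mu * (C * K * _) = C * (K * mu) * (mass rho *+ n)); last by ring.
rewrite ler_wpM2l ?mulr_ge0 ?(ltW mu0)//; apply: iint_mass => //.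
by move: nK; rewrite mulr2n /A; lra.
Qed.

End weak_consistency.

(** * Limits as eps tends to 0, and pointwise time derivatives *)

Section weak_limits.
Variable R : realType.
Implicit Types (E theta : R -> R) (c d e t x : R).

Lemma bounded_cvg0 E theta c d : 0 < d ->
  (forall eps : R, 0 < eps < d -> `|E eps| <= c * theta eps) ->
  theta eps @[eps --> 0^'+] --> 0 -> E eps @[eps --> 0^'+] --> 0.
Proof.
move=> d0 Eb th0; apply/cvgrPdist_le => e e0.
have ce : 0 < e / (`|c| + 1) by rewrite divr_gt0// ltr_wpDl.
have /cvgrPdist_le/(_ _ ce) H := th0.
near=> eps; have epsd : 0 < eps < d.
  by apply/andP; split; near: eps; [exact: nbhs_right_gt|exact: nbhs_right_lt].
rewrite sub0r normrN.
apply: le_trans (Eb _ epsd) _; apply: le_trans (ler_norm _) _; rewrite normrM.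
have te : `|theta eps| <= e / (`|c| + 1).
  by rewrite -normrN -sub0r; near: eps.
apply: (@le_trans _ _ ((`|c| + 1) * (e / (`|c| + 1)))).
  by rewrite ler_pM// lerDl.
by rewrite mulrC divfK// gt_eqF// ltr_wpDl.
Unshelve. all: by end_near. Qed.

Lemma rate_cvg0 (alpha : R) : alpha < 1 / 4%:R ->
  eps * (eps `^ alpha) ^- 4 @[eps --> (0 : R)^'+] --> 0.
Proof.
move=> a4; have b0 : 0 < 1 - alpha * 4%:R by lra.
have H := powR_cvg0 b0; apply: cvg_trans H; apply: near_eq_cvg.
near=> eps; have e0 : 0 < eps by near: eps; exact: nbhs_right_gt.
rewrite powRD; last by apply/implyP => _; rewrite gt_eqF.
by rewrite powRr1 ?ltW// powRN powRrM powR_mulrn// powR_ge0.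
Unshelve. all: by end_near. Qed.

Lemma uderiv_derive1 T (w w' : R -> R -> R) t x : 0 < t < T -> uderiv T w w' ->
  derive1 (fun s => w s x) t = w' t x.
Proof.
move=> /andP[t0 tT] dw; apply: is_derive1; apply/is_derive_eps => e e0.
have tT' : 0 <= t < T by rewrite ltW.
have [d d0 dP] := dw t tT' e e0.
exists (Num.min d (Num.min t (T - t))); first by rewrite !lt_min d0 t0 subr_gt0.
move=> h; rewrite !lt_min => /and3P[hd ht hT]; apply: dP => //.
by move: ht hT; rewrite !ltr_norml; lra.
Qed.

End weak_limits.

(** * Bounds on solutions that are uniform in the initial density *)

Section solution_bounds.
Variables (R : realType) (g : R) (a phi : R -> R) (alpha eps q A : R).
Hypotheses (eps0 : 0 < eps) (q0 : 0 <= q) (A0 : 0 <= A).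
Let force (rho : R -> R) := derive1 (potential g a phi alpha eps rho).
Hypothesis force_bound : forall (rho : R -> R) x, CT rho ->
  `|force rho x| <= q * mass (fun y => `|rho y|) + A.

(** The extrema of rho0 serve to enter the box and leave no trace in the conclusion, whose constants
    depend on the data through U and M only. *)
Lemma sol_on_bounds (rho0 u0 : R -> R) (T U M : R) rho m : 0 < T -> 0 <= U ->
  CT rho0 -> CT u0 -> (forall x, 0 < rho0 x) ->
  (forall x, `|u0 x| <= U) -> mass rho0 <= M ->
  sol_on g a phi alpha eps rho0 (rho0 \* u0) T rho m ->
  forall t, 0 <= t < T -> mass (rho t) <= M + T /\
    forall x, `|velocity (rho t) (m t) x| <= U + (q * (M + T) + A + 1) * T.
Proof.
move=> T0 U0 Cr Cu r0 uU rM sol t tT.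
have [rmin rmin0 lo] := CT_gt0 Cr r0; have [rmax rmax0 hi] := CT_bounded Cr.
have itv x : rmin <= rho0 x <= rmax by rewrite lo (le_trans _ (hi x))// ler_norm.
have mU x : `|(rho0 \* u0) x| <= U * rho0 x.
  by rewrite normrM mulrC (gtr0_norm (r0 x)) ler_wpM2r// ltW.
have rmm : rmin <= rmax by have := itv 0; lra.
have m0 : 0 <= mass rho0 by apply: mass_ge0 => x; exact: ltW.
have tT' : 0 <= t <= T by lra.
have bt := sol_on_box eps0 q0 A0 force_bound T0 rmin0 U0 itv mU sol tT.
split.
  by case: bt => _ _ _ /le_trans; apply; lra.
move=> x; apply: le_trans (box_velocity rmin0 bt x) _.
rewrite /speed /force_max lerD2l.
have c1 : q * (mass rho0 + T) + A + 1 <= q * (M + T) + A + 1.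
  by rewrite !lerD2r ler_wpM2l// lerD2r.
have c0 : 0 <= q * (mass rho0 + T) + A + 1.
  by rewrite !addr_ge0// mulr_ge0// addr_ge0// ltW.
by apply: ler_pM => //; lra.
Qed.

End solution_bounds.

(** * Weak residuals of the three equations at fixed eps and t *)

Section weak_estimates.
Variables (R : realType) (g : R) (a phi : R -> R) (alpha eps : R).
Hypotheses (g0 : 0 <= g) (phi_Cc : Cc_infty phi) (phi_ge0 : forall x, 0 <= phi x).
Hypotheses (phi_int : \int[lebesgue_measure]_x phi x = 1).
Hypotheses (a_cont : continuous a) (eps01 : 0 < eps < 1).
Variables (rho m psi : R -> R) (K C S W : R) (n : nat).
Hypotheses (Crho : CT rho) (Cm : CT m) (rho0 : forall x, 0 < rho x) (K0 : 0 <= K) (C0 : 0 <= C).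
Hypotheses (Kn : (K + 1) *+ 2 <= pi *+ 2 *+ n) (spsi : supp K psi).
Hypothesis dpsi : forall x : R, is_derive x 1 psi (derive1 psi x).
Hypothesis lpsi' : forall x y : R, `|derive1 psi x - derive1 psi y| <= C * `|x - y|.
Hypotheses (S1 : 1 <= S) (W0 : 0 <= W).
Hypothesis velS : forall x, `|velocity rho m x| <= S.
Hypothesis massW : mass rho <= W.

Let u := velocity rho m.
Let Cu : CT u. Proof. exact: velocity_CT. Qed.
Let mE x : m x = rho x * u x.
Proof. by rewrite /u /velocity mulrC divfK// gt_eqF. Qed.
Let cpsi : continuous psi. Proof. by move=> x; exact: is_derive_continuous (dpsi x). Qed.
Let cpsi' : continuous (derive1 psi). Proof. exact: lipschitz_continuous lpsi'. Qed.
Let out (f : R -> R) x : ~~ (- K <= x <= K) -> f x * psi x = 0.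
Proof. by rewrite -ler_norml -ltNge => xK; rewrite spsi// mulr0. Qed.

(** Serves both balance laws, with f = rho and f = rho u. As S >= 1, the power S^2 demanded by the
    momentum flux also covers the mass flux. *)
Lemma flux_weak (f : R -> R) : CT f -> (forall x, `|f x * u x| <= S ^+ 2 * rho x) ->
  `|\int[lebesgue_measure]_x (transport eps f u x * psi x)
    - \int[lebesgue_measure]_x (f x * u x * derive1 psi x)|
  <= eps * (C * (S ^+ 2 * W *+ n)).
Proof.
move=> Cf fu.
apply: le_trans (transport_weak eps01 K0 C0 Kn Cf Cu spsi dpsi cpsi' lpsi') _.
have e0 : 0 <= eps by case/andP: eps01 => /ltW.
rewrite ler_wpM2l// ler_wpM2l// lerMn2r; apply/orP; right.
apply: (@le_trans _ _ (mass (fun x => S ^+ 2 * rho x))).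
  by apply: mass_le => //; [exact/CT_norm/CT_M|exact: CT_Z].
rewrite /mass iintZ; last by case: Crho.
by rewrite ler_wpM2l// sqr_ge0.
Qed.

Lemma mass_weak :
  `|\int[lebesgue_measure]_x (mass_rhs eps rho m x * psi x)
    - \int[lebesgue_measure]_x (m x * derive1 psi x)|
  <= eps * (C * (S ^+ 2 * W *+ n)).
Proof.
rewrite (_ : (fun x => m x * _) = fun x => rho x * u x * derive1 psi x); last first.
  by apply/funext => x; rewrite mE.
apply: flux_weak => // x; rewrite normrM mulrC (gtr0_norm (rho0 x)).
apply: ler_wpM2r; [exact: ltW|apply: le_trans (velS x) _].
by rewrite expr2 ler_peMr// (le_trans ler01 S1).
Qed.

Lemma momentum_weak : CT (derive1 (potential g a phi alpha eps rho)) ->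
  `|\int[lebesgue_measure]_x (momentum_rhs g a phi alpha eps rho m x * psi x)
    - \int[lebesgue_measure]_x (m x * u x * derive1 psi x)
    + \int[lebesgue_measure]_x
        (rho x * derive1 (potential g a phi alpha eps rho) x * psi x)|
  <= eps * (C * (S ^+ 2 * W *+ n)).
Proof.
move=> Cf; set force := derive1 _ in Cf *.
have [c1 _] := transport_CT eps Cm Cu; have [c2 _] := CT_M Crho Cf.
rewrite (_ : \int[lebesgue_measure]_x (momentum_rhs g a phi alpha eps rho m x * psi x) =
  \int[lebesgue_measure]_x (transport eps m u x * psi x) -
  \int[lebesgue_measure]_x (rho x * force x * psi x)); last first.
  rewrite (int_supp (out (fun x => momentum_rhs g a phi alpha eps rho m x))).
  rewrite (int_supp (out (transport eps m u))) (int_supp (out (fun x => rho x * force x))).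
  rewrite -iintB; [|exact: contM|exact: contM].
  by apply: eq_iint => x _; rewrite /momentum_rhs mulrBl.
(* The force in the equation cancels the one in the weak formulation exactly, so the residual is
   that of transport alone. *)
rewrite addrAC subrK; apply: flux_weak => // x.
rewrite mE -mulrA normrM mulrC (gtr0_norm (rho0 x)); apply: ler_wpM2r; first exact: ltW.
by rewrite -expr2 normrX lerXn2r// nnegrE (le_trans ler01 S1).
Qed.

Lemma potential_weak (Kphi C1 C2 : R) (k : nat) : 0 < alpha ->
  0 <= Kphi -> supp Kphi phi -> (Kphi + K) *+ 2 <= pi *+ 2 *+ k ->
  0 <= C1 -> (forall x, `|derive1 phi x| <= C1) ->
  (forall x y, `|psi x - psi y| <= C2 * `|x - y|) -> 0 <= C2 ->
  `|\int[lebesgue_measure]_x (potential g a phi alpha eps rho x * psi x)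
    - g * \int[lebesgue_measure]_x (rho x * psi x)
    - g * \int[lebesgue_measure]_x (a x * psi x)|
  <= eps `^ alpha * (g * (C2 * Kphi * (W *+ k))).
Proof.
move=> alpha0 Kp0 sphi kK C10 phi'B lpsi C20.
have /andP[e0 e1] := eps01; set mu := eps `^ alpha.
have mu0 : 0 < mu by rewrite powR_gt0.
have mu1 : mu <= 1.
  have := @ge0_ler_powR R alpha (ltW alpha0) eps 1.
  by rewrite powR1 !nnegrE; apply; [exact: ltW|exact: ler01|exact: ltW].
have dphi (x : R) : is_derive x 1 phi (derive1 phi x).
  by apply: derivable_is_derive; case: phi_Cc => /(_ 0%N).
have dd (x : R) : is_derive x 1 (dilation phi mu) (dil' phi mu x) by exact: dil_derive.
have sd : supp Kphi (dilation phi mu).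
  move=> x xK; rewrite /dilation sphi ?mulr0// normrM (gtr0_norm (_ : 0 < mu^-1)) ?invr_gt0//.
  by rewrite ltr_pdivlMr//; apply: le_lt_trans xK; have := ler_wpM2l Kp0 mu1; rewrite mulr1.
have cd : continuous (dilation phi mu) by exact: dil_continuous.
have dL := derive_lipschitz dd (dil'_bound phi'B mu0).
have L0 : 0 <= mu ^- 2 * C1 by rewrite mulr_ge0// invr_ge0 exprn_ge0// ltW.
have cc := conv_continuous sd cd Crho Kp0 L0 dL.
have [cr _] := Crho.
have r0 x : 0 <= rho x by exact: ltW.
have := mollifier_weak (mu := mu) (K' := K) _ Kp0 K0 C20 kK sphi phi_ge0 phi_int _ spsi lpsi Crho r0.
rewrite mu0 mu1 => /(_ isT) => H.
have {}H := H (ex_intro _ C1 (conj C10 (derive_lipschitz dphi phi'B))).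
rewrite (_ : \int[lebesgue_measure]_x (potential g a phi alpha eps rho x * psi x) =
  g * \int[lebesgue_measure]_x (convolution rho (dilation phi mu) x * psi x) +
  g * \int[lebesgue_measure]_x (a x * psi x)); last first.
  rewrite (int_supp (out (potential g a phi alpha eps rho))).
  rewrite (int_supp (out (convolution rho (dilation phi mu)))) (int_supp (out a)).
  have ca := contM a_cont cpsi; have cp := contM cc cpsi.
  rewrite -!iintZ// -iintD; [|exact: contZ|exact: contZ].
  by apply: eq_iint => x _; rewrite /potential -/mu; ring.
rewrite addrAC addrK -mulrBr normrM (ger0_norm g0) mulrCA ler_wpM2l//.
apply: le_trans H _; rewrite ler_wpM2l ?(ltW mu0)// ler_wpM2l ?mulr_ge0//.
by rewrite lerMn2r massW orbT.
Qed.

End weak_estimates.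

(** * Constants uniform in eps, and passage to the limit *)

Theorem theorem3 (R : realType) (g : R) (phi a : R -> R) (alpha : R)
  (rho0 u0 : R -> R) (rho0e u0e : R -> R -> R)
  (g_eq : g = 98%:R / 10%:R)
  (phi_Cc : Cc_infty phi)
  (phi_ge0 : forall x, 0 <= phi x)
  (phi_even : forall x, phi (- x) = phi x)
  (phi_int : \int[lebesgue_measure]_x phi x = 1)
  (a_periodic : torus_periodic a) (a_C2 : C2 a)
  (alpha_bounds : 0 < alpha < 1 / 4%:R)
  (rho0_L1 : LT 1%E rho0)
  (rho0_ge0 : \forall x \ae torus_measure R, 0 <= rho0 x)
  (u0_Loo : LT +oo%E u0)
  (rho0e_CT : forall eps : R, 0 < eps < 1 -> CT (rho0e eps))
  (u0e_CT : forall eps : R, 0 < eps < 1 -> CT (u0e eps))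
  (rho0e_gt0 : forall eps x : R, 0 < eps < 1 -> 0 < rho0e eps x)
  (rho0e_cvg : normLT 1%E (rho0 \- rho0e eps)%R @[eps --> (0 : R)^'+] --> 0%E)
  (u0e_cvg : normLT +oo%E (u0 \- u0e eps)%R @[eps --> (0 : R)^'+] --> 0%E) :
  (forall eps : R, 0 < eps < 1 ->
     exists rho m : R -> R -> R,
       is_solution g a phi alpha eps (rho0e eps) (rho0e eps \* u0e eps)
         +oo%E rho m /\
       forall (T : \bar R) (rho' m' : R -> R -> R), (0 < T)%E ->
         is_solution g a phi alpha eps (rho0e eps) (rho0e eps \* u0e eps)
           T rho' m' ->
         forall t, time_interval T t -> rho' t = rho t /\ m' t = m t) /\
  (forall rho m : R -> R -> R -> R,
     (forall eps : R, 0 < eps < 1 ->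
        is_solution g a phi alpha eps (rho0e eps) (rho0e eps \* u0e eps)
          +oo%E (rho eps) (m eps)) ->
     weak_asymptotic_solution g a rho m
       (fun eps t => potential g a phi alpha eps (rho eps t))).
Proof.
have g0 : 0 <= g by rewrite g_eq divr_ge0.
have /andP[al0 al4] := alpha_bounds.
have [Q [A [Q0 A0 F]]] := potential_force g0 phi_Cc a_periodic a_C2.
have q0 eps : 0 <= Q * (eps `^ alpha) ^- 2 by rewrite mulr_ge0// invr_ge0 exprn_ge0// powR_ge0.
split.
  move=> eps e01; have [F1 F2 F3] := F alpha eps al0 e01.
  have [e0 _] := andP e01; have Cr := rho0e_CT _ e01.
  apply: (global_solution e0 (q0 eps) A0 F1 F2 F3 Cr) => [|x]; last exact: rho0e_gt0.
  by apply: CT_M => //; exact: u0e_CT.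
move=> rho m sol t psi t0 psi_Cc.
have [K [_ [C [[K0 spsi] _ C0 dpsi [_ lpsi']]]]] := Cc_kernel psi_Cc.
have [Kphi [C1 [_ [[Kphi0 sphi] C10 _ dphi [phi'B _]]]]] := Cc_kernel phi_Cc.
have [C2 C20 psi'B] : exists2 C2 : R, 0 < C2 & forall x, `|derive1 psi x| <= C2.
  by apply: supp_bounded (supp_derive dpsi spsi); exact: lipschitz_continuous lpsi'.
have lpsi := derive_lipschitz dpsi psi'B.
have [n nK] := period_archi ((K + 1) *+ 2).
have [k kK] := period_archi ((Kphi + K) *+ 2).
have p1 : (1 <= +oo :> \bar R)%E by rewrite leey.
have [U [d1 [/andP[d10 d11] UP]]] := normLT_bounded p1 u0_Loo u0e_CT u0e_cvg.
have [M [d2 [/andP[d20 d21] MP]]] := normLT_bounded (lexx _) rho0_L1 rho0e_CT rho0e_cvg.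
(* Any horizon beyond t serves; t is then an interior time, where the derivative is two-sided. *)
pose T : R := t + 1; have T0 : 0 < T by rewrite /T; lra.
have tT : 0 <= t < T by rewrite /T; lra.
have tT' : 0 < t < T by rewrite /T; lra.
pose W : R := `|M| + T; have W0 : 0 <= W by rewrite addr_ge0// ltW.
(* Since mu^-2 >= 1, the velocity bound |U| + (Q mu^-2 W + A + 1) T is at most V mu^-2; the last
   summand 1 ensures S >= 1. *)
pose V : R := `|U| + (Q * W + A + 1) * T + 1.
have V1 : 1 <= V.
  rewrite lerDr addr_ge0// mulr_ge0 ?(ltW T0)// !addr_ge0// mulr_ge0//.
have V0 : 0 <= V by lra.
pose mu eps : R := eps `^ alpha.
pose S eps : R := V * mu eps ^- 2.
pose d := Num.min d1 d2; have d0 : 0 < d by rewrite lt_min d10.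
have small (eps : R) : 0 < eps < d -> [/\ 0 < eps < 1, 0 < eps < d1 & 0 < eps < d2].
  move=> /andP[e0]; rewrite lt_min => /andP[ed1 ed2].
  by rewrite e0 ed1 ed2 (lt_le_trans ed1 d11).
have estimates (eps : R) : 0 < eps < d ->
   [/\ sol_on g a phi alpha eps (rho0e eps) (rho0e eps \* u0e eps) T (rho eps) (m eps),
       1 <= S eps, mass (rho eps t) <= W &
       forall x, `|velocity (rho eps t) (m eps t) x| <= S eps].
  move=> /small[e01 e1 e2]; have [F1 F2 F3] := F alpha eps al0 e01.
  have [e0 elt1] := andP e01.
  have solT := is_solution_sol_on (sol eps e01) (leey T%:E).
  have uU x : `|u0e eps x| <= `|U|.
    apply: le_trans (ler_norm U); exact: CT_normLT_oo (u0e_CT eps e01) (UP eps e1) x.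
  have rM : mass (rho0e eps) <= `|M|.
    apply: le_trans (ler_norm M); apply: CT_normLT_1 (MP eps e2); first exact: rho0e_CT.
    by move=> x; exact/ltW/rho0e_gt0.
  have [mW vS] := sol_on_bounds e0 (q0 eps) A0 F2 T0 (normr_ge0 U) (rho0e_CT eps e01)
    (u0e_CT eps e01) (fun x => rho0e_gt0 eps x e01) uU rM solT tT.
  have mu1 : 1 <= mu eps ^- 2.
    rewrite -invr1 lef_pV2 ?posrE ?exprn_gt0 ?powR_gt0//.
    rewrite exprn_ile1 ?powR_ge0//.
    have := @ge0_ler_powR R alpha (ltW al0) eps 1.
    by rewrite powR1 !nnegrE; apply; [exact: ltW|exact: ler01|exact: ltW].
  split=> //; first by rewrite -[leLHS]mulr1 ler_pM.
  move=> x; apply: le_trans (vS x) _; rewrite /S /V -/W -/(mu eps).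
  have := ler_wpM2l (normr_ge0 U) mu1.
  have : (A + 1) * T * 1 <= (A + 1) * T * mu eps ^- 2.
    by rewrite ler_wpM2l// mulr_ge0 ?(ltW T0)// addr_ge0.
  have : 0 <= mu eps ^- 2 by lra.
  lra.
have rate := rate_cvg0 al4.
have S4 (eps : R) : eps * (C * (S eps ^+ 2 * W *+ n)) = C * (V ^+ 2 * W *+ n) * (eps * mu eps ^- 4).
  have -> : mu eps ^- 4 = (mu eps ^- 2) ^+ 2 by rewrite exprVn -exprM.
  by rewrite /S -[_ *+ n]mulr_natl -[V ^+ 2 * W *+ n]mulr_natl; ring.
split.
- apply: (bounded_cvg0 (c := C * (V ^+ 2 * W *+ n)) d0 _ rate) => eps ed.
  have [[Cs ps dr dm _] S1 mW vS] := estimates eps ed; have [e01 _ _] := small eps ed.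
  have [Cr Cm] := Cs t tT; rewrite -S4.
  have -> : (fun x => derive1 (fun s : R => rho eps s x) t * psi x) =
      fun x => mass_rhs eps (rho eps t) (m eps t) x * psi x.
    by apply/funext => x; rewrite (uderiv_derive1 _ tT' dr).
  by apply: (mass_weak e01 Cr Cm _ (ltW K0) (ltW C0) nK spsi dpsi lpsi' S1 vS mW) => x; exact: ps.
- apply: (bounded_cvg0 (c := C * (V ^+ 2 * W *+ n)) d0 _ rate) => eps ed.
  have [[Cs ps dr dm _] S1 mW vS] := estimates eps ed; have [e01 _ _] := small eps ed.
  have [Cr Cm] := Cs t tT; rewrite -S4; have [F1 _ _] := F alpha eps al0 e01.
  have -> : (fun x => derive1 (fun s : R => m eps s x) t * psi x) =
      fun x => momentum_rhs g a phi alpha eps (rho eps t) (m eps t) x * psi x.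
    by apply/funext => x; rewrite (uderiv_derive1 _ tT' dm).
  by apply: (momentum_weak e01 Cr Cm _ (ltW K0) (ltW C0) nK spsi dpsi lpsi' S1 vS mW (F1 _ Cr)) => x; exact: ps.
- apply: (bounded_cvg0 (c := g * (C2 * Kphi * (W *+ k))) d0 _ (powR_cvg0 al0)) => eps ed.
  have [[Cs ps _ _ _] S1 mW vS] := estimates eps ed; have [e01 _ _] := small eps ed.
  have [Cr Cm] := Cs t tT; rewrite [leRHS]mulrC.
  have ca : continuous a.
    by move=> x; have [da _] := C2_derive1 a_C2 a_periodic; exact: is_derive_continuous (da x).
  apply: (potential_weak g0 phi_Cc phi_ge0 phi_int ca e01 Cr _ (ltW K0) spsi dpsi mW al0 (ltW Kphi0) sphi kK (ltW C10) phi'B lpsi (ltW C20)).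
  by move=> x; exact: ps.
Qed.
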